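(* Let $d\ge 3$, $m>0$, and let $H=H_D+V$ with $H_D=-i\alpha\cdot\nabla+m\beta$ the free Dirac operator on $\mathbb{R}^d$. Assume that $V:\mathbb{R}^d\to\mathbb{C}^{N\times N}$ is a Hermitian matrix-valued potential with $V\in C^\infty(\mathbb{R}^d\setminus\{0\})$, that $V$ is bounded outside any ball containing the origin, and that $H$ is essentially self-adjoint on $C_c^\infty(\mathbb{R}^d;\mathbb{C}^N)$ and self-adjoint on $L^2(\mathbb{R}^d;\mathbb{C}^N)$ with domain $\mathcal{D}(H)\subseteq H^1(\mathbb{R}^d;\mathbb{C}^N)$. Assume that there exist positive constants $C_1,C_2,C_3,C_4$ such that, for every $j=1,\dots,d$, $$|\nabla V(x)|\le\frac{C_1}{|x|^2},\qquad \big|[\alpha_j,V]\big|\le\frac{C_2}{|x|},\qquad \big|(x\cdot\nabla)\{V,\beta\}\big|\le\frac{C_3}{|x|^2},\qquad \big|[\beta,V]\big|\le\frac{C_4}{|x|^2}.$$ If $$\frac{4C_1}{d-2}+C_2+\frac{2mC_4}{d-2}+\frac{2mC_3}{(d-2)^2}<1,$$ then $\sigma_p(H_D+V)=\varnothing$, i.e. $H$ has no eigenvalues.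
   Context: Let $N=2^{\lfloor (d+1)/2\rfloor}$ and let $\alpha_1,\dots,\alpha_d,\beta$ be Hermitian $N\times N$ matrices with $\alpha_j\alpha_k+\alpha_k\alpha_j=2\delta_{jk}I$, $\alpha_j\beta+\beta\alpha_j=0$, $\beta^2=I$. The free Dirac operator is $H_D=-i\sum_j\alpha_j\partial_j+m\beta$ on $L^2(\mathbb{R}^d;\mathbb{C}^N)$. $[A,B]=AB-BA$, $\{A,B\}=AB+BA$; $(x\cdot\nabla)\{V,\beta\}$ is the derivative $\sum_j x_j\partial_j$ of the matrix-valued function $\{V,\beta\}$. $|\cdot|$ denotes the pointwise norm: Euclidean norm on $\mathbb{C}^N$, operator norm on matrices, and $|\nabla V|=(\sum_j|\partial_jV|^2)^{1/2}$. $\sigma_p$ denotes the set of eigenvalues (point spectrum). *)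

(* Defs.v *)
(* R^d is encoded as 'rV[R]_d and C^N as 'cV[R[i]]_N, for R : realType. *)
From HB Require Import structures.
From mathcomp Require Import all_boot all_order all_algebra.
From mathcomp Require Import all_classical all_reals all_analysis.
From mathcomp Require Import complex.

Set Implicit Arguments.
Unset Strict Implicit.
Unset Printing Implicit Defensive.
Import Order.TTheory GRing.Theory Num.Theory numFieldNormedType.Exports.
Local Open Scope classical_set_scope.
Local Open Scope ring_scope.
Local Open Scope complex_scope.

(* Lebesgue measure on R^n, by recursion on n through R^(1+n) = R x R^n.    *)
(* The sigma-algebra is generated by the coordinates, i.e. the Borel one.   *)

Definition rV_display : measure_display. Proof. exact. Qed.

Section rV_measurable.
Context {R : realType} (n : nat).

Let coors : 'I_n -> 'rV[R]_n -> R := fun i x => x 0 i.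

Let rV_set0 : g_sigma_preimage coors set0.
Proof. exact: sigma_algebra0. Qed.

Let rV_setC A : g_sigma_preimage coors A -> g_sigma_preimage coors (~` A).
Proof. exact: sigma_algebraC. Qed.

Let rV_bigcup (F : (set 'rV[R]_n)^nat) :
  (forall i, g_sigma_preimage coors (F i)) ->
  g_sigma_preimage coors (\bigcup_i (F i)).
Proof. exact: sigma_algebra_bigcup. Qed.

HB.instance Definition _ := @isMeasurable.Build rV_display 'rV[R]_n
  (g_sigma_preimage coors) rV_set0 rV_setC rV_bigcup.

End rV_measurable.

Lemma measurable_rV_coord (R : realType) n (i : 'I_n) :
  measurable_fun [set: 'rV[R]_n] (fun x : 'rV[R]_n => x 0 i).
Proof.
move=> _ Y mY; rewrite setTI; apply: sub_sigma_algebra => /=.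
rewrite -bigcup_seq/=; exists i => /=; first by rewrite mem_index_enum.
by exists Y => //; rewrite setTI.
Qed.

Lemma measurable_fun_rV (R : realType) d1 (T1 : measurableType d1) n
    (f : T1 -> 'rV[R]_n) :
  (forall i, measurable_fun [set: T1] (fun x => f x 0 i)) ->
  measurable_fun [set: T1] f.
Proof.
move=> mf; suff H : measurable `<=` [set A | measurable (f @^-1` A)].
  by move=> _ A mA; rewrite setTI; exact: H.
apply: smallest_sub.
  split => /=.
  - by rewrite preimage_set0.
  - move=> A mA; rewrite setTD.
    by rewrite preimage_setC; exact: measurableC.
  - by move=> F mF; rewrite preimage_bigcup; exact: bigcupT_measurable.
case: n => [|n] in f mf *; first by rewrite big_ord0.
rewrite -bigcup_mkord_ord; apply: bigcup_sub => i Ii.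
move=> A [B mB <-] /=.
have := mf (inord i) measurableT B mB; rewrite !setTI.
by congr (measurable _); rewrite -comp_preimage.
Qed.

Section cons_measure.
Context {R : realType} (n : nat).
Variable mu : {sigma_finite_measure set 'rV[R]_n -> \bar R}.

Definition cons_rV (p : R * 'rV[R]_n) : 'rV[R]_n.+1 :=
  row_mx (p.1)%:M p.2 : 'rV[R]_(1 + n).

Definition uncons_rV (x : 'rV[R]_n.+1) : R * 'rV[R]_n :=
  (x 0 0, rsubmx (x : 'rV[R]_(1 + n))).

Lemma cons_rV0 p : cons_rV p 0 0 = p.1.
Proof.
have := row_mxEl (p.1)%:M p.2 (0 : 'I_1) (0 : 'I_1).
rewrite [RHS]mxE eqxx mulr1n => <-.
by apply: (f_equal (fun k : 'I_n.+1 => cons_rV p 0 k)); exact/val_inj.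
Qed.

Lemma cons_rVS p (i : 'I_n) : cons_rV p 0 (lift ord0 i) = p.2 0 i.
Proof.
have <- := row_mxEr (p.1)%:M p.2 (0 : 'I_1) i.
by apply: (f_equal (fun k : 'I_n.+1 => cons_rV p 0 k)); exact/val_inj.
Qed.

Lemma cons_rVK : cancel cons_rV uncons_rV.
Proof.
by move=> [a v]; rewrite /uncons_rV cons_rV0 /cons_rV row_mxKr.
Qed.

Lemma uncons_rVK : cancel uncons_rV cons_rV.
Proof.
move=> x; apply/rowP => j; have [->|] := eqVneq j ord0; first by rewrite cons_rV0.
rewrite eq_sym => /unlift_some[k -> _]; rewrite cons_rVS mxE.
by congr (x _ _); exact/val_inj.
Qed.

Lemma measurable_cons_rV : measurable_fun setT cons_rV.
Proof.
apply: measurable_fun_rV => i; have [->|] := eqVneq i ord0.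
  by under eq_fun do rewrite cons_rV0; exact: measurable_fst.
rewrite eq_sym => /unlift_some[k -> _]; under eq_fun do rewrite cons_rVS.
by apply: (measurableT_comp (measurable_rV_coord k)); exact: measurable_snd.
Qed.

Lemma measurable_uncons_rV : measurable_fun setT uncons_rV.
Proof.
apply/measurable_fun_pairP; split; first exact: measurable_rV_coord.
apply: measurable_fun_rV => i /=; under eq_fun do rewrite /comp /= mxE.
exact: measurable_rV_coord.
Qed.

Definition cons_measure : set 'rV[R]_n.+1 -> \bar R :=
  pushforward (@lebesgue_measure R \x mu)%E cons_rV.

Let cons_measure0 : cons_measure set0 = 0%E.
Proof. by rewrite /cons_measure /pushforward preimage_set0 measure0. Qed.

Let cons_measure_ge0 A : (0 <= cons_measure A)%E.
Proof. by rewrite /cons_measure /pushforward; exact: measure_ge0. Qed.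

Let cons_measure_sigma_additive : semi_sigma_additive cons_measure.
Proof.
move=> F mF tF mUF; rewrite /cons_measure /pushforward preimage_bigcup.
apply: measure_semi_sigma_additive.
- by move=> k; rewrite -[X in measurable X]setTI; exact: measurable_cons_rV.
- apply/trivIsetP => /= i j _ _ ij; rewrite -preimage_setI.
  by move/trivIsetP : tF => /(_ _ _ _ _ ij) ->//; rewrite preimage_set0.
- by rewrite -preimage_bigcup -[X in measurable X]setTI; exact: measurable_cons_rV.
Qed.

HB.instance Definition _ := isMeasure.Build _ _ _ cons_measure
  cons_measure0 cons_measure_ge0 cons_measure_sigma_additive.

Let cons_measure_sigma_finite : sigma_finite setT cons_measure.
Proof.
have /sigma_finiteP[F [TF ndF Foo]] := sigma_finiteT (@lebesgue_measure R).
have /sigma_finiteP[G [TG ndG Goo]] := sigma_finiteT mu.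
exists (fun k => uncons_rV @^-1` (F k `*` G k)).
  rewrite -preimage_bigcup (_ : \bigcup_i _ = setT) ?preimage_setT//.
  rewrite -setXTT TF TG predeqE => -[x y]; split.
    by move=> [k _ []/= ? ?]; split; exists k.
  move=> [/= [k _ Fkx] [l _ Gly]]; exists (maxn k l) => //; split.
  - by move: x Fkx; exact/subsetPset/ndF/leq_maxl.
  - by move: y Gly; exact/subsetPset/ndG/leq_maxr.
move=> k; have [mF Fk] := Foo k; have [mG Gk] := Goo k; split.
  rewrite -[X in measurable X]setTI; apply: measurable_uncons_rV => //.
  exact: measurableX.
rewrite /cons_measure /pushforward -comp_preimage.
rewrite (_ : uncons_rV \o cons_rV = id); last first.
  by apply/funext => p /=; rewrite cons_rVK.
by rewrite preimage_id product_measure1E// lte_mul_pinfty// ge0_fin_numE.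
Qed.

HB.instance Definition _ := Measure_isSigmaFinite.Build _ _ _ cons_measure
  cons_measure_sigma_finite.

End cons_measure.

Fixpoint lebesgue_rV (R : realType) (n : nat) :
    {sigma_finite_measure set 'rV[R]_n -> \bar R} :=
  match n with
  | 0%N => @dirac _ 'rV[R]_0 0 R
  | n'.+1 => cons_measure (lebesgue_rV R n')
  end.

Lemma lebesgue_rV_box (R : realType) n (A : 'I_n -> set R) :
  (forall i, measurable (A i)) ->
  lebesgue_rV R n [set x | forall i, A i (x 0 i)] =
  (\prod_(i < n) lebesgue_measure (A i))%E.
Proof.
elim: n A => [|n ih] A mA.
  rewrite big_ord0 /= diracE.
  by rewrite mem_set//= => -[].
rewrite big_ord_recl -ih//= /cons_measure /pushforward /=.
rewrite -product_measure1E//=; last 2 first.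
- exact: mA.
- rewrite (_ : (fun _ => _) = \bigcap_(i in [set: 'I_n])
      ((fun x : 'rV[R]_n => x 0 i) @^-1` A (lift ord0 i))); last first.
    by apply/seteqP; split => [x Ax i _|x Ax i]; exact: Ax.
  apply: fin_bigcap_measurable => [|i _]; first exact: finite_finset.
  rewrite -[X in measurable X]setTI; exact: measurable_rV_coord.
congr (product_measure1 _ _ _); apply/seteqP; split => [p /= Ap|p [/= Ap0 ApS] i].
  by split => [|i]; [rewrite -cons_rV0; exact: Ap|rewrite -cons_rVS; exact: Ap].
have [->|] := eqVneq i ord0; first by rewrite cons_rV0.
by rewrite eq_sym => /unlift_some[k -> _]; rewrite cons_rVS; exact: ApS.
Qed.

(* Pointwise norms. The library norm on matrices is the sup norm of the     *)
(* entries, hence these definitions.                                        *)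

Section pointwise_norms.
Context {R : realType}.

Definition enorm (d : nat) (x : 'rV[R]_d) : R :=
  Num.sqrt (\sum_i x 0 i ^+ 2).

Definition cnorm (N : nat) (v : 'cV[R[i]]_N) : R :=
  Num.sqrt (\sum_k (complex.Re (v k 0) ^+ 2 + complex.Im (v k 0) ^+ 2)).

Definition opnorm (N : nat) (A : 'M[R[i]]_N) : R :=
  sup [set cnorm (A *m v) | v in [set v : 'cV[R[i]]_N | cnorm v <= 1]].

End pointwise_norms.

(* Smooth matrix-valued functions; real and imaginary parts of the entries  *)
(* are differentiated separately, R[i] being no normed module over R.       *)

Section smooth.
Context {R : realType} {d : nat}.

Definition re_entry (p q : nat) (F : 'rV[R]_d -> 'M[R[i]]_(p, q)) a b :
  'rV[R]_d -> R := fun x => complex.Re (F x a b).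

Definition im_entry (p q : nat) (F : 'rV[R]_d -> 'M[R[i]]_(p, q)) a b :
  'rV[R]_d -> R := fun x => complex.Im (F x a b).

Definition pderiv (p q : nat) (j : 'I_d) (F : 'rV[R]_d -> 'M[R[i]]_(p, q)) :
    'rV[R]_d -> 'M[R[i]]_(p, q) :=
  fun x => \matrix_(a, b)
    ('D_(delta_mx 0 j) (re_entry F a b) x
       +i* 'D_(delta_mx 0 j) (im_entry F a b) x).

Definition smooth_on (p q : nat) (U : set 'rV[R]_d)
    (F : 'rV[R]_d -> 'M[R[i]]_(p, q)) : Prop :=
  forall (s : seq 'I_d) (x : 'rV[R]_d) a b, U x ->
    let G := foldr (@pderiv p q) F s in
    [/\ {for x, continuous (re_entry G a b)},
        {for x, continuous (im_entry G a b)} &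
        forall j : 'I_d, derivable (re_entry G a b) x (delta_mx 0 j) /\
                         derivable (im_entry G a b) x (delta_mx 0 j)].

Definition radial_deriv (p q : nat) (F : 'rV[R]_d -> 'M[R[i]]_(p, q)) :
    'rV[R]_d -> 'M[R[i]]_(p, q) :=
  fun x => \sum_j (x 0 j)%:C *: pderiv j F x.

Definition grad_norm (N : nat) (F : 'rV[R]_d -> 'M[R[i]]_N)
    (x : 'rV[R]_d) : R :=
  Num.sqrt (\sum_j opnorm (pderiv j F x) ^+ 2).

Definition bounded_away_from_0 (N : nat) (F : 'rV[R]_d -> 'M[R[i]]_N) : Prop :=
  forall (c : 'rV[R]_d) (r : R), enorm (0 - c) < r ->
    exists M : R, forall x, r <= enorm (x - c) -> opnorm (F x) <= M.

End smooth.

(* L^2(R^d; C^N) and H^1(R^d; C^N), through Borel representatives: elements *)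
(* of L^2 are functions, to be compared with ae_equal.                      *)

Section L2.
Context {R : realType} {d N : nat}.
Local Notation spinor := ('rV[R]_d -> 'cV[R[i]]_N).
Local Notation mu := (lebesgue_rV R d).

Definition ae_equal (u v : spinor) : Prop := {ae mu, forall x, u x = v x}.

Definition L2 : set spinor := [set u |
  (forall k, measurable_fun setT (re_entry u k 0) /\
             measurable_fun setT (im_entry u k 0)) /\
  (\int[mu]_x (cnorm (u x) ^+ 2)%:E < +oo)%E].

Definition L2norm (u : spinor) : R :=
  Num.sqrt (\int[mu]_x (cnorm (u x) ^+ 2))%R.

(* linear in the first argument *)
Definition L2dot (u v : spinor) : R[i] :=
  let h x := \sum_k u x k 0 * (v x k 0)^* in
  (\int[mu]_x complex.Re (h x))%R +i* (\int[mu]_x complex.Im (h x))%R.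

Definition test_functions : set spinor := [set phi |
  smooth_on setT phi /\ compact (closure [set x | phi x <> 0])].

Definition weak_pderiv (j : 'I_d) (u g : spinor) : Prop :=
  forall phi, test_functions phi -> L2dot u (pderiv j phi) = - L2dot g phi.

Definition sobolevH1 : set spinor := [set u | L2 u /\
  exists g : 'I_d -> spinor, forall j, L2 (g j) /\ weak_pderiv j u (g j)].

(* Unbounded operators on L^2 are given by their graphs, which relate all   *)
(* representatives of u to all representatives of T u.                      *)

Definition op_dom (T : set (spinor * spinor)) : set spinor :=
  [set u | exists f, T (u, f)].

Definition op_restrict (T : set (spinor * spinor)) (D : set spinor) :
    set (spinor * spinor) :=
  [set uf | T uf /\ D uf.1].

Definition op_adjoint (T : set (spinor * spinor)) : set (spinor * spinor) :=
  [set vw | [/\ L2 vw.1, L2 vw.2 &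
     forall u f, T (u, f) -> L2dot f vw.1 = L2dot u vw.2]].

Definition op_closure (T : set (spinor * spinor)) : set (spinor * spinor) :=
  [set vw | [/\ L2 vw.1, L2 vw.2 &
     forall e : R, 0 < e -> exists u f, [/\ T (u, f),
       L2norm (u \- vw.1) < e & L2norm (f \- vw.2) < e]]].

Definition L2_dense (D : set spinor) : Prop :=
  forall v, L2 v -> forall e : R, 0 < e ->
    exists2 u, D u & L2norm (u \- v) < e.

Definition self_adjoint (T : set (spinor * spinor)) : Prop :=
  L2_dense (op_dom T) /\ op_adjoint T = T.

Definition essentially_self_adjoint_on (T : set (spinor * spinor))
    (D : set spinor) : Prop :=
  D `<=` op_dom T /\ self_adjoint (op_closure (op_restrict T D)).

Definition point_spectrum (T : set (spinor * spinor)) : set R[i] :=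
  [set z | exists u f, [/\ T (u, f), ~ ae_equal u (fun=> 0) &
                           ae_equal f (fun x => z *: u x)]].

End L2.

Definition dirac_dim (d : nat) : nat := 2 ^ (d.+1)./2.

Section dirac.
Context {R : realType} {d N : nat}.
Local Notation spinor := ('rV[R]_d -> 'cV[R[i]]_N).

Definition commutator (A B : 'M[R[i]]_N) : 'M[R[i]]_N := A *m B - B *m A.

Definition anticommutator (A B : 'M[R[i]]_N) : 'M[R[i]]_N := A *m B + B *m A.

Definition dirac_matrices (alpha : 'I_d -> 'M[R[i]]_N) (beta : 'M[R[i]]_N) :
    Prop :=
  (forall j, alpha j \is hermsymmx) /\ beta \is hermsymmx /\
  (forall j k, anticommutator (alpha j) (alpha k) = (2 * (j == k)%:R)%:M) /\
  (forall j, anticommutator (alpha j) beta = 0) /\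
  beta *m beta = 1%:M.

(* the graph of -i alpha . grad + m beta + V with domain
   {u in H^1 | (-i alpha . grad + m beta + V) u in L^2} *)
Definition dirac_op (m : R) (alpha : 'I_d -> 'M[R[i]]_N) (beta : 'M[R[i]]_N)
    (V : 'rV[R]_d -> 'M[R[i]]_N) : set (spinor * spinor) :=
  [set uf | [/\ L2 uf.1, L2 uf.2 &
     exists g : 'I_d -> spinor,
       (forall j, L2 (g j) /\ weak_pderiv j uf.1 (g j)) /\
       ae_equal uf.2 (fun x => - 'i *: (\sum_j alpha j *m g j x)
                        + m%:C *: (beta *m uf.1 x) + V x *m uf.1 x)]].

End dirac.

(* Main.v *)
Require Import Defs.
From HB Require Import structures.
From mathcomp Require Import all_boot all_order all_algebra.
From mathcomp Require Import all_classical all_reals all_analysis.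
From mathcomp Require Import complex.
From mathcomp Require Import ring lra.
From mathcomp Require Import measurable_realfun.

(**
By the bound on its gradient, V has a limit at infinity along every ray, and for
d >= 2 the limit does not depend on the ray. The commutator bounds make this
limit commute with all alpha_j and beta; since N = 2^{floor((d+1)/2)} is the
smallest dimension of a Clifford module, the limit is a real scalar c. So
W = V - c satisfies |W| <= C1/|x|, and so does the radial derivative
U = (x . grad)V. Let u be an eigenfunction, K = -i alpha . grad u, so that
K + m beta u + W u = l u with l real.

Hardy's inequality and C1 < (d-2)/4 bound the H^1 norm of a test function by its
graph norm. As the test functions are a core of H, u is an H^1 limit of test
functions, whence |K|^2 = |grad u|^2, Re<beta u, K> = 0 and Hardy's inequality
for u. Self-adjointness also shows that H is defined on the dilations u(s x);
comparing <H u, u(s .)> with <u, H u(s .)> and letting s decrease to 1 gives the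
virial identity Re<u, K> = Re<U u, u>.

Hence Re<K + m beta u + W u, K - U u> = l Re<u, K - U u> = 0. Both |W u| and
|U u| are at most 2 C1/(d-2) |grad u|, and 2 Re<beta u, U u> is the form of
(x . grad){V, beta}, at most C3 |u/|x||^2. With s = 2 C1/(d-2),
Re<K + W u, K - U u> >= (1-s)^2 |grad u|^2, and therefore
(1 - 4 C1/(d-2) - 2 m C3/(d-2)^2) |grad u|^2 <= 0, which forces u = 0.
*)

(** The formal source of the virial identity is the commutator of H with x . grad, but x . grad u
    need not lie in L^2, whence the finite dilations. The difference quotients of the potential
    along them are bounded by C1/|x| uniformly in the step, so Hardy's inequality supplies the
    dominating function for the limit. The domain of H is not explicit. That it contains the
    dilations of u is an adjoint argument: the differential expression is symmetric between test
    functions and any H^1 function v with v/|x| in L^2, and test functions are a core. The core also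
    replaces mollification: it gives the density of test functions in L^2 and, with the a priori
    bound, approximation in H^1. The multiplier K - U u is chosen because the virial identity makes
    it orthogonal to u: neither the sign nor the size of the eigenvalue matters, and the shift by c
    disappears together with it. These identities involve real parts only, so spinors are treated as
    a real inner product space. *)

Set Implicit Arguments.
Unset Strict Implicit.
Unset Printing Implicit Defensive.
Import Order.TTheory GRing.Theory Num.Theory numFieldNormedType.Exports.
Local Open Scope classical_set_scope.
Local Open Scope ring_scope.

(** * The commutant of a Clifford system *)

Section clifford.
Context {F : numFieldType} {N n : nat} (g : 'I_n -> 'M[F]_N).
Hypothesis gg : forall i, g i * g i = 1.
Hypothesis gC : forall i j, i != j -> g i * g j = - (g j * g i).

Let G (S : {set 'I_n}) : 'M[F]_N := \prod_(i in S) g i.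

(** Every factor with index other than j contributes one sign. *)
Let comm_prod j (r : seq 'I_n) (P : pred 'I_n) :
  g j * \prod_(i <- r | P i) g i =
  (-1) ^+ count (fun i => P i && (i != j)) r * (\prod_(i <- r | P i) g i * g j).
Proof.
elim: r => [|i r ih]; first by rewrite big_nil /= expr0 !mul1r mulr1.
rewrite big_cons /=; case: ifP => Pi; last by rewrite ih add0n.
have [->|ij] := eqVneq i j.
  by rewrite /= ?andbF add0n {1}ih !mulrA -signr_odd commr_sign.
rewrite mulrA gC 1?eq_sym// mulNr -(mulrA (g i) (g j)) ih /= exprD expr1 mulN1r mulNr.
by congr (- _); rewrite !mulrA -signr_odd commr_sign.
Qed.

Let comm_G j (S : {set 'I_n}) :
  g j * G S = (-1) ^+ #|S :\ j| * (G S * g j).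
Proof.
rewrite /G comm_prod; congr (_ ^+ _ * _).
rewrite -sum1_count -sum1_card; apply: eq_bigl => i.
by rewrite !inE andbC.
Qed.

Let unit_G S : G S \in unitmx.
Proof.
apply: (big_ind (fun A => A \in unitmx)); first exact: unitmx1.
  by move=> A B uA uB; rewrite -[_ * _]/(A *m B) unitmx_mul uA.
by move=> i _; have /mulmx1_unit[] := gg i.
Qed.

(** The parity of S without j is that of S, flipped when j lies in S. If no j separates S from T,
    then T is S or its complement; in the second case S and T have opposite parities, and n, the sum
    of their sizes, is odd. *)
Let separating_generator (S T : {set 'I_n}) : ~~ odd n -> S != T ->
  exists j, odd #|S :\ j| != odd #|T :\ j|.
Proof.
move=> n_even ST; apply/existsP; apply: contraNT n_even.
rewrite negb_exists => /forallP H.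
have {}H j : odd #|S| (+) (j \in S) = odd #|T| (+) (j \in T).
  have := H j; rewrite negbK => /eqP; rewrite (cardsD1 j S) (cardsD1 j T) !oddD !oddb.
  by move=> ->; do 2 case: (j \in _); case: (odd _).
have [e|/negbTE e] := boolP (odd #|S| == odd #|T|).
  case/eqP: ST; apply/setP => j; have := H j; rewrite (eqP e).
  by do 2 case: (j \in _); case: (odd _).
have TS : T = ~: S.
  apply/setP => j; rewrite inE; have := H j; move: e.
  by do 2 case: (j \in _); case: (odd #|S|); case: (odd #|T|).
have := cardsC S; rewrite -TS card_ord => <-; rewrite oddD.
by move: e; case: (odd #|S|); case: (odd #|T|).
Qed.

(* Some generator anticommutes with (G S)^-1 * G T, whose trace is then its own opposite. *)
Let trace_orth (S T : {set 'I_n}) : ~~ odd n -> S != T -> \tr (invmx (G S) *m G T) = 0.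
Proof.
move=> n_even ST; have [j jST] := separating_generator n_even ST.
set X := _ *m _.
have inv_comm : invmx (G S) * g j = (-1) ^+ #|S :\ j| * (g j * invmx (G S)).
  have VG : invmx (G S) * G S = 1 by exact: mulVmx.
  have GV : G S * invmx (G S) = 1 by exact: mulmxV.
  rewrite -[LHS]mulr1 -[X in _ * X = _]GV mulrA -(mulrA _ (g j)) comm_G -signr_odd.
  by rewrite mulrA commr_sign -(mulrA _ (invmx (G S))) (mulrA (invmx (G S)) (G S)) VG mul1r -mulrA.
have XgC : X * g j = - (g j * X).
  rewrite /X -[_ *m _]/(invmx (G S) * G T) -mulrA.
  have -> : G T * g j = (-1) ^+ #|T :\ j| * (g j * G T).
    by rewrite comm_G mulrA -exprD addnn -mul2n exprM sqrrN expr1n expr1n mul1r.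
  rewrite mulrA -signr_odd commr_sign -mulrA (mulrA (invmx (G S))) inv_comm.
  rewrite -(signr_odd _ #|S :\ j|) !mulrA -signr_addb addbC.
  by move: jST; rewrite negb_eqb => ->; rewrite mulN1r !mulNr.
have : \tr X = - \tr X.
  rewrite -{1}[X]mulr1 -(gg j) mulrA XgC mulNr raddfN /=; congr (- _).
  by rewrite -[_ * g j]/((_ * _) *m g j) mxtrace_mulC -[g j *m _]/(g j * _) mulrA gg mul1r.
by move/eqP; rewrite -subr_eq0 opprK -mulr2n mulrn_eq0 /= => /eqP.
Qed.

(* The 2^n products G S are trace-orthogonal, hence independent, and 2^n = N^2 is the full dimension. *)
Let span_G (X : 'M[F]_N) : ~~ odd n -> (N * N = 2 ^ n)%N -> (0 < N)%N ->
  exists c : {set 'I_n} -> F, X = \sum_S c S *: G S.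
Proof.
move=> n_even NN N0.
have card_sets : #|{: {set 'I_n}}| = (N * N)%N.
  by rewrite -cardsT -powersetT card_powerset cardsT card_ord NN.
(* The rows of [M] are the products [G S], the columns of [L] the transposed inverses, so that the
   entries of [M *m L] are the traces of [trace_orth]. *)
pose M : 'M[F]_(#|{: {set 'I_n}}|, N * N) := \matrix_s mxvec (G (enum_val s)).
pose L : 'M[F]_(N * N, #|{: {set 'I_n}}|) :=
  (\matrix_s mxvec (invmx (G (enum_val s)))^T)^T.
have ML : M *m L = N%:R%:M.
  apply/matrixP => s t; rewrite !mxE.
  transitivity (\tr (invmx (G (enum_val t)) *m G (enum_val s))).
    transitivity (\sum_a \sum_b M s (mxvec_index a b) * L (mxvec_index a b) t).
      rewrite pair_bigA (reindex _ (curry_mxvec_bij _ _)) /=.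
      by apply: eq_bigr => -[a b] _.
    rewrite exchange_big /=; apply: eq_bigr => b _; rewrite mxE; apply: eq_bigr => a _.
    by rewrite !mxE !mxvecE mxE mulrC.
  have [<-|st] := eqVneq t s.
    by rewrite mulVmx ?unit_G// mxtrace1 ?eqxx ?mulr1n.
  rewrite trace_orth//.
  by apply: contraNneq st => /enum_val_inj ->.
have N0F : N%:R != 0 :> F by rewrite pnatr_eq0 -lt0n.
have rM : \rank M = (N * N)%N.
  apply/eqP; rewrite eqn_leq rank_leq_col /=.
  by have := mxrankM_maxl M L; rewrite ML -scalemx1 mxrank_scale_nz// mxrank1 [X in (X <= _)%N -> _]card_sets.
have /submxP[D XD] : (mxvec X <= M)%MS by apply: submx_full; rewrite /row_full rM.
exists (fun S => D 0 (enum_rank S)).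
rewrite -[LHS]mxvecK XD mulmx_sum_row linear_sum /=.
rewrite (reindex_onto enum_rank enum_val) /=; last by move=> i _; rewrite enum_valK.
apply: eq_big => [S|S _]; first by rewrite enum_rankK eqxx.
by rewrite linearZ /= rowK mxvecK enum_rankK.
Qed.

Lemma clifford_commutant (E : 'M[F]_N) : ~~ odd n -> (N * N = 2 ^ n)%N ->
  (forall i, E * g i = g i * E) -> exists c, E = c%:M.
Proof.
move=> n_even NN Eg; have N0 : (0 < N)%N.
  by case: N NN => //; rewrite mul0n => /esym/eqP; rewrite expn_eq0.
have EG S : GRing.comm E (G S).
  by apply: (big_ind (GRing.comm E)) => [|A B|i _];
    [exact: commr1 | exact: commrM | exact: Eg].
have EX X : E *m X = X *m E.
  have [c ->] := span_G X n_even NN N0; rewrite mulmx_sumr mulmx_suml.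
  by apply: eq_bigr => S _; rewrite -scalemxAr -scalemxAl [E *m _]EG.
(* Commutation with the matrix unit [delta_mx c d], read at the entry (a, b). *)
have Eab a b c d : E a c * (d == b)%:R = (a == c)%:R * E d b.
  have := congr1 (fun Y : 'M[F]_N => Y a b) (EX (delta_mx c d)); rewrite !mxE.
  rewrite (bigD1 c)//= big1 ?addr0 => [|k kc]; last by rewrite mxE (negbTE kc) mulr0.
  rewrite (bigD1 d)//= big1 ?addr0 => [|k kd]; last by rewrite mxE (negbTE kd) andbF mul0r.
  by rewrite !mxE !eqxx andbT eq_sym.
exists (E (Ordinal N0) (Ordinal N0)); apply/matrixP => a b; rewrite !mxE.
have := Eab a b b b; rewrite eqxx mulr1 => ->.
have := Eab (Ordinal N0) b (Ordinal N0) b; rewrite !eqxx mulr1 mul1r => <-.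
by rewrite mulr_natl.
Qed.
End clifford.

(** * Spinors as a real inner product space *)

Local Open Scope complex_scope.

Section real_inner_product.
Context {R : realType}.
Local Notation C := R[i].
Local Notation Re := (@complex.Re R).
Local Notation Im := (@complex.Im R).

Lemma cReD (x y : C) : Re (x + y) = Re x + Re y. Proof. by case: x y => ? ? []. Qed.
Lemma cImD (x y : C) : Im (x + y) = Im x + Im y. Proof. by case: x y => ? ? []. Qed.
Lemma cReN (x : C) : Re (- x) = - Re x. Proof. by case: x. Qed.
Lemma cImN (x : C) : Im (- x) = - Im x. Proof. by case: x. Qed.
Lemma cReM (x y : C) : Re (x * y) = Re x * Re y - Im x * Im y.
Proof. by case: x y => ? ? []. Qed.
Lemma cImM (x y : C) : Im (x * y) = Re x * Im y + Im x * Re y.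
Proof. by case: x y => ? ? []. Qed.
Lemma cRe_sum I (r : seq I) (P : pred I) (f : I -> C) :
  Re (\sum_(i <- r | P i) f i) = \sum_(i <- r | P i) Re (f i).
Proof. by apply: (big_morph Re cReD). Qed.
Lemma cIm_sum I (r : seq I) (P : pred I) (f : I -> C) :
  Im (\sum_(i <- r | P i) f i) = \sum_(i <- r | P i) Im (f i).
Proof. by apply: (big_morph Im cImD). Qed.

Context {N : nat}.
Implicit Types (v w : 'cV[C]_N) (A B : 'M[C]_N).

(** The real part of the Hermitian product. Its imaginary part is recovered by multiplying one
    argument by i. *)
Definition rdot v w : R := \sum_k (Re (v k 0) * Re (w k 0) + Im (v k 0) * Im (w k 0)).

Lemma rdotC v w : rdot v w = rdot w v.
Proof. by apply: eq_bigr => k _; rewrite mulrC (mulrC (Im _)). Qed.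

Lemma rdotDl v v' w : rdot (v + v') w = rdot v w + rdot v' w.
Proof.
rewrite /rdot -big_split; apply: eq_bigr => k _ /=.
by rewrite mxE cReD cImD; ring.
Qed.

Lemma rdotDr v w w' : rdot v (w + w') = rdot v w + rdot v w'.
Proof. by rewrite rdotC rdotDl !(rdotC _ v). Qed.

Lemma rdotNl v w : rdot (- v) w = - rdot v w.
Proof.
rewrite /rdot -sumrN; apply: eq_bigr => k _ /=.
by rewrite mxE cReN cImN; ring.
Qed.

Lemma rdotNr v w : rdot v (- w) = - rdot v w.
Proof. by rewrite rdotC rdotNl rdotC. Qed.

Lemma rdotBl v v' w : rdot (v - v') w = rdot v w - rdot v' w.
Proof. by rewrite rdotDl rdotNl. Qed.

Lemma rdotBr v w w' : rdot v (w - w') = rdot v w - rdot v w'.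
Proof. by rewrite rdotDr rdotNr. Qed.

Lemma rdotZl (r : R) v w : rdot (r%:C *: v) w = r * rdot v w.
Proof.
rewrite /rdot mulr_sumr; apply: eq_bigr => k _ /=.
by rewrite mxE cReM cImM /=; ring.
Qed.

Lemma rdotZr (r : R) v w : rdot v (r%:C *: w) = r * rdot v w.
Proof. by rewrite rdotC rdotZl rdotC. Qed.

Lemma rdot0l w : rdot 0 w = 0.
Proof. by rewrite /rdot big1// => k _; rewrite mxE /= !mul0r addr0. Qed.

Lemma rdot0r v : rdot v 0 = 0. Proof. by rewrite rdotC rdot0l. Qed.

Lemma rdotii v w : rdot ('i *: v) ('i *: w) = rdot v w.
Proof. by apply: eq_bigr => k _; rewrite !mxE !cReM !cImM /=; ring. Qed.

Lemma rdotil v w : rdot ('i *: v) w = - rdot v ('i *: w).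
Proof.
rewrite -sumrN; apply: eq_bigr => k _; rewrite !mxE !cReM !cImM /=; ring.
Qed.

Lemma rdot_ge0 v : 0 <= rdot v v.
Proof. by apply: sumr_ge0 => k _; rewrite -!expr2 addr_ge0// sqr_ge0. Qed.

Lemma rdot_eq0 v : rdot v v = 0 -> v = 0.
Proof.
move=> v0; apply/matrixP => k j; rewrite (ord1 j) mxE.
have /eqP := v0; rewrite psumr_eq0 => [/allP/(_ k)|i _]; last first.
  by rewrite -!expr2 addr_ge0// sqr_ge0.
rewrite mem_index_enum => /(_ isT) /=; rewrite -!expr2.
rewrite paddr_eq0 ?sqr_ge0// !sqrf_eq0 => /andP[/eqP a /eqP b].
by apply/eqP; rewrite eq_complex a b !eqxx.
Qed.

Lemma cnorm_sqr v : cnorm v ^+ 2 = rdot v v.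
Proof.
rewrite /cnorm sqr_sqrtr; first by apply: eq_bigr => k _; rewrite !expr2.
by apply: sumr_ge0 => k _; rewrite addr_ge0// sqr_ge0.
Qed.

Lemma cnorm_ge0 v : 0 <= cnorm v. Proof. exact: sqrtr_ge0. Qed.

Lemma rdot_cauchy_schwarz v w : `|rdot v w| <= cnorm v * cnorm w.
Proof.
rewrite -(@ler_sqr _ `|_|) ?nnegrE ?mulr_ge0 ?cnorm_ge0// exprMn !cnorm_sqr real_normK ?num_real//.
have [w0|w0] := eqVneq (rdot w w) 0.
  by rewrite (rdot_eq0 w0) !rdot0r expr0n mulr0.
have wp : 0 < rdot w w by rewrite lt_def w0 rdot_ge0.
(* Up to the factor |w|^2, this is the component of v orthogonal to w. *)
have := rdot_ge0 ((rdot w w)%:C *: v - (rdot v w)%:C *: w).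
rewrite rdotBl !rdotBr !rdotZl !rdotZr (rdotC w v) => H.
rewrite -(ler_pM2l wp); nra.
Qed.

Lemma cnormZ (r : R) v : cnorm (r%:C *: v) = `|r| * cnorm v.
Proof.
apply/eqP; rewrite -(@eqrXn2 _ 2) ?mulr_ge0 ?cnorm_ge0//.
by rewrite cnorm_sqr exprMn cnorm_sqr rdotZl rdotZr real_normK ?num_real// mulrA.
Qed.

Lemma cnorm0 : cnorm (0 : 'cV[C]_N) = 0.
Proof. by apply/eqP; rewrite -sqrf_eq0 cnorm_sqr rdot0l. Qed.

Lemma cnormN v : cnorm (- v) = cnorm v.
Proof. by apply/eqP; rewrite -(@eqrXn2 _ 2) ?cnorm_ge0// !cnorm_sqr rdotNl rdotNr opprK. Qed.

Lemma cnorm_eq0 v : cnorm v = 0 -> v = 0.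
Proof. by move=> v0; apply: rdot_eq0; rewrite -cnorm_sqr v0 expr0n. Qed.

Lemma cnormD v w : cnorm (v + w) <= cnorm v + cnorm w.
Proof.
rewrite -ler_sqr ?nnegrE ?addr_ge0 ?cnorm_ge0// cnorm_sqr rdotDl !rdotDr (rdotC w v).
have := le_trans (ler_norm _) (rdot_cauchy_schwarz v w).
rewrite -!cnorm_sqr; nra.
Qed.

Lemma cnorm_sum I (r : seq I) (P : pred I) (f : I -> 'cV[C]_N) :
  cnorm (\sum_(i <- r | P i) f i) <= \sum_(i <- r | P i) cnorm (f i).
Proof.
elim/big_ind2 : _ => [|x y z t xy zt|//]; first by rewrite cnorm0.
by rewrite (le_trans (cnormD _ _))// lerD.
Qed.

Lemma cnorm_le v (c : R) : 0 <= c ->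
  (forall w, rdot v w <= c * cnorm w) -> cnorm v <= c.
Proof.
move=> c0 /(_ v); rewrite -cnorm_sqr expr2.
have [->//|v0] := eqVneq (cnorm v) 0.
by rewrite ler_pM2r// lt_def v0 cnorm_ge0.
Qed.

Lemma cnorm_entry v k : `|Re (v k 0)| <= cnorm v /\ `|Im (v k 0)| <= cnorm v.
Proof.
have H : Re (v k 0) ^+ 2 + Im (v k 0) ^+ 2 <= rdot v v.
  rewrite /rdot (bigD1 k)//= -!expr2 lerDl sumr_ge0// => i _.
  by rewrite -!expr2 addr_ge0// sqr_ge0.
have a := sqr_ge0 (Re (v k 0)); have b := sqr_ge0 (Im (v k 0)).
by split; rewrite -ler_sqr ?nnegrE ?cnorm_ge0// real_normK ?num_real// cnorm_sqr; lra.
Qed.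

Lemma cnorm_le_sum v : cnorm v <= \sum_k (`|Re (v k 0)| + `|Im (v k 0)|).
Proof.
have ge0 k : 0 <= `|Re (v k 0)| + `|Im (v k 0)| by rewrite addr_ge0.
rewrite -ler_sqr ?nnegrE ?cnorm_ge0 ?sumr_ge0// cnorm_sqr.
rewrite /rdot expr2 mulr_suml ler_sum// => k _.
apply: (@le_trans _ _ ((`|Re (v k 0)| + `|Im (v k 0)|) * (`|Re (v k 0)| + `|Im (v k 0)|))).
  rewrite -!expr2 -(@real_normK _ (Re _)) ?num_real// -(@real_normK _ (Im _)) ?num_real//.
  rewrite sqrrD; have := mulr_ge0 (normr_ge0 (Re (v k 0))) (normr_ge0 (Im (v k 0))); lra.
by rewrite ler_wpM2l// (bigD1 k)//= lerDl sumr_ge0.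
Qed.

(** For fixed v and w, the form <A v, w> is real-linear in the entries of A. Isolating its
    coefficients lets limits and derivatives in A be taken entry by entry. *)
Definition rdot_coef_re v w (a b : 'I_N) :=
  Re (v b 0) * Re (w a 0) + Im (v b 0) * Im (w a 0).
Definition rdot_coef_im v w (a b : 'I_N) :=
  Re (v b 0) * Im (w a 0) - Im (v b 0) * Re (w a 0).

Lemma rdot_mulmxE A v w : rdot (A *m v) w =
  \sum_a \sum_b (Re (A a b) * rdot_coef_re v w a b + Im (A a b) * rdot_coef_im v w a b).
Proof.
apply: eq_bigr => a _; rewrite mxE cRe_sum cIm_sum !mulr_suml -big_split.
apply: eq_bigr => b _ /=; rewrite cReM cImM /rdot_coef_re /rdot_coef_im; ring.
Qed.

Lemma hermsymmx_entry A : A \is hermsymmx -> forall a b, A a b = (A b a)^*.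
Proof. by move=> /is_hermitianmxP hA a b; rewrite {1}hA expr0 scale1r !mxE. Qed.

Lemma rdot_herm A v w : A \is hermsymmx -> rdot (A *m v) w = rdot v (A *m w).
Proof.
move=> /hermsymmx_entry hA; rewrite [RHS]rdotC !rdot_mulmxE exchange_big /=.
apply: eq_bigr => a _; apply: eq_bigr => b _; rewrite (hA b a).
rewrite /rdot_coef_re /rdot_coef_im; case: (A a b) => x y /=; ring.
Qed.

(** The [sup] in [opnorm] is meaningful only for a bounded set; a crude bound by the sizes of the
    entries is enough. *)
Lemma opnorm_bounded A : has_sup [set cnorm (A *m v) | v in [set v : 'cV[C]_N | cnorm v <= 1]].
Proof.
split; first by exists (cnorm (A *m 0)), 0 => //=; rewrite cnorm0.
exists (\sum_a (\sum_b (`|Re (A a b)| + `|Im (A a b)|) + \sum_b (`|Re (A a b)| + `|Im (A a b)|))).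
move=> _ [v /= v1 <-]; apply: le_trans (cnorm_le_sum _) _.
apply: ler_sum => a _; rewrite mxE cRe_sum cIm_sum; apply: lerD.
  apply: le_trans (ler_norm_sum _ _ _) _; apply: ler_sum => b _.
  rewrite cReM (le_trans (ler_normB _ _))// !normrM.
  have [p q] := cnorm_entry v b.
  by rewrite lerD// ler_piMr// ?(le_trans p)// (le_trans q).
apply: le_trans (ler_norm_sum _ _ _) _; apply: ler_sum => b _.
rewrite cImM (le_trans (ler_normD _ _))// !normrM.
have [p q] := cnorm_entry v b.
by rewrite lerD// ler_piMr// ?(le_trans p)// (le_trans q).
Qed.

Lemma opnorm_ge0 A : 0 <= opnorm A.
Proof.
apply: (@le_trans _ _ (cnorm (A *m 0))); first exact: cnorm_ge0.
by apply: (sup_upper_bound (opnorm_bounded A)); exists 0 => //=; rewrite cnorm0.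
Qed.

Lemma opnorm_le A v : cnorm (A *m v) <= opnorm A * cnorm v.
Proof.
have [v0|v0] := eqVneq (cnorm v) 0.
  by rewrite (cnorm_eq0 v0) mulmx0 cnorm0 mulr0.
have vp : 0 < cnorm v by rewrite lt_def v0 cnorm_ge0.
rewrite -ler_pdivrMr// mulrC -[X in X * _]ger0_norm ?invr_ge0 ?cnorm_ge0//.
rewrite -cnormZ scalemxAr; apply: (sup_upper_bound (opnorm_bounded A)).
by exists ((cnorm v)^-1%:C *: v) => //=; rewrite cnormZ ger0_norm ?invr_ge0 ?cnorm_ge0// mulVf.
Qed.

End real_inner_product.

(** * Lebesgue measure on R^d *)

Section borel_rV.
Context {R : realType} (n : nat).

Lemma measurable_box (A : 'I_n -> set R) : (forall i, measurable (A i)) ->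
  measurable [set x : 'rV[R]_n | forall i, A i (x 0 i)].
Proof.
move=> mA.
rewrite (_ : [set x | _] = \bigcap_(i in [set: 'I_n])
    ((fun x : 'rV[R]_n => x 0 i) @^-1` A i)); last first.
  by apply/seteqP; split => [x Ax i _|x Ax i]; exact: Ax.
apply: fin_bigcap_measurable => [|i _]; first exact: finite_finset.
rewrite -[X in measurable X]setTI; exact: measurable_rV_coord.
Qed.

(** The sigma-algebra is generated by the coordinates, so U is written as the union of the countably
    many rational boxes that it contains. *)
Lemma open_measurable_rV (U : set 'rV[R]_n) : open U -> measurable U.
Proof.
move=> oU.
pose box (p : 'rV[rat]_n * nat) : set 'rV[R]_n :=
  [set x | forall i, ball (ratr (p.1 0 i) : R) p.2.+1%:R^-1 (x 0 i)].
rewrite (_ : U = \bigcup_p (if `[< box p `<=` U >] then box p else set0)).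
  apply: countable_bigcupT_measurable => [|p]; first exact: (countableP [set: _]%classic).
  case: ifP => _; last exact: measurable0.
  apply: (@measurable_box (fun i => ball (ratr (p.1 0 i) : R) p.2.+1%:R^-1)) => i.
  by rewrite ball_itv; exact: measurable_itv.
apply/seteqP; split => [x Ux|x [p _]]; last by case: ifPn => // /asboolP; exact.
have [e /= e0 xeU] : nbhs_ball x U by rewrite nbhs_ballE; exact: open_nbhs_nbhs.
(* Half of e, because two points of a box may be twice its radius apart. *)
have [k ke] : exists k : nat, k.+1%:R^-1 < e / 2.
  exists (Num.bound (e / 2)^-1).
  rewrite invf_plt ?posrE ?divr_gt0// (lt_le_trans (archi_boundP _))//.
    by rewrite invr_ge0 divr_ge0// ltW.
  by rewrite ler_nat.
have kp : 0 < k.+1%:R^-1 :> R by rewrite invr_gt0.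
have [q qx] : exists q : 'rV[rat]_n, box (q, k) x.
  have H i : exists r : rat, ball (ratr r : R) k.+1%:R^-1 (x 0 i).
    have /rat_in_itvoo[r] : x 0 i - k.+1%:R^-1 < x 0 i + k.+1%:R^-1.
      by rewrite ltrD2l gtrN.
    by rewrite in_itv /= => rx; exists r; rewrite /ball /= ltr_distl.
  exists (\row_i projT1 (cid (H i))) => i /=; rewrite mxE.
  by case: (cid (H i)).
exists (q, k) => //; rewrite ifT//; apply/asboolP => y qy.
apply: xeU; split => // i j; rewrite (ord1 i).
apply: (@le_ball _ _ _ (k.+1%:R^-1 + k.+1%:R^-1)); first by rewrite [leRHS]splitr lerD // ltW.
by apply: ball_triangle (qy j); apply: ball_sym; exact: qx.
Qed.

Lemma open_continuous_measurable_rV (D : set 'rV[R]_n) (f : 'rV[R]_n -> R) :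
  open D -> {in D, continuous f} -> measurable_fun D f.
Proof.
move=> oD cf mD; apply: (measurability _ (RGenOpens.measurableE R)) => //.
move=> _ [_ [a [b ->] <-]]; apply: open_measurable_rV.
rewrite openE => x [Dx /= fx]; apply: filterI; first exact: open_nbhs_nbhs.
apply: cf; first by rewrite inE.
by apply: open_nbhs_nbhs; split => //; exact: interval_open.
Qed.

Lemma continuous_measurable_rV (f : 'rV[R]_n -> R) :
  continuous f -> measurable_fun setT f.
Proof.
move=> cf; apply: open_continuous_measurable_rV; first exact: openT.
by move=> x _; exact: cf.
Qed.

End borel_rV.

(** * Lebesgue integrals under translations and dilations *)

Section affine_change_of_variables.
Context {R : realType}.
Local Open Scope ereal_scope.

Lemma measurable_affine (a t : R) :
  measurable_fun setT ((fun x => a * x + t)%R : measurableTypeR R -> measurableTypeR R).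
Proof. by apply: measurable_funD => //; exact: measurable_funM. Qed.

(** Lebesgue measure is a times its image under x -> a x + t: the two measures agree on half-open
    intervals, which determine them. *)
Lemma ge0_integral_affine (a t : R) (f : R -> \bar R) : (0 < a)%R ->
  measurable_fun setT f -> (forall x, 0 <= f x) ->
  \int[@lebesgue_measure R]_x f (a * x + t)%R =
  (a^-1)%:E * \int[@lebesgue_measure R]_x f x.
Proof.
move=> a0 mf f0; have an0 : a != 0%R by rewrite gt_eqF.
pose phi : measurableTypeR R -> measurableTypeR R := (fun x => a * x + t)%R.
have mphi : measurable_fun setT phi := measurable_affine a t.
have a_ge0 : (0 <= a)%R := ltW a0.
pose scaled_pushforward : {measure set (measurableTypeR R) -> \bar R} :=
  mscale (NngNum a_ge0) (pushforward (@lebesgue_measure R) phi).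
pose mu' := scaled_pushforward mphi.
have mu'E A : measurable A -> lebesgue_measure A = mu' A.
  apply: lebesgue_measure_unique => _ [[p q]] _ <-.
  rewrite /mu' /scaled_pushforward /= /mscale /= /pushforward.
  have -> : phi @^-1` `]p, q]%classic = `] ((p - t) / a)%R, ((q - t) / a)%R]%classic.
    apply/seteqP; split => x /=; rewrite !in_itv /= /phi.
      by rewrite ltr_pdivrMr// ler_pdivlMr// (mulrC x) ltrBlDr lerBrDr.
    by rewrite ltr_pdivrMr// ler_pdivlMr// (mulrC x) ltrBlDr lerBrDr.
  rewrite !lebesgue_measure_itv /= !lte_fin ltr_pM2r ?invr_gt0// ltrD2r.
  case: ifPn => _; last by rewrite mule0.
  by rewrite -!EFinD -EFinM; congr EFin; field.
have -> : \int[@lebesgue_measure R]_x f x = \int[mu']_x f x.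
  by apply: eq_measure_integral => A mA _; exact: mu'E.
rewrite ge0_integral_mscale//= muleA -EFinM mulVf// mul1e.
by rewrite (ge0_integral_pushforward mphi)//= => y _; exact: f0.
Qed.


Lemma ge0_integral_lebesgue_rVS n (f : 'rV[R]_n.+1 -> \bar R) :
  measurable_fun setT f -> (forall x, 0 <= f x) ->
  \int[lebesgue_rV R n.+1]_x f x =
  \int[@lebesgue_measure R]_r \int[lebesgue_rV R n]_v f (cons_rV (r, v)).
Proof.
move=> mf f0.
have mfc : measurable_fun setT (f \o @cons_rV R n).
  by apply: measurableT_comp => //; exact: measurable_cons_rV.
transitivity (\int[(@lebesgue_measure R \x lebesgue_rV R n)%E]_p (f \o @cons_rV R n) p).
  have mc : measurable_fun setT (@cons_rV R n : measurableTypeR R * 'rV[R]_n -> _).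
    exact: measurable_cons_rV.
  have := ge0_integral_pushforward mc
    (lebesgue_measure \x lebesgue_rV R n)%E measurableT mf (fun y _ => f0 y).
  by rewrite preimage_setT.
by rewrite fubini_tonelli1// => p; exact: f0.
Qed.

Lemma measurable_affine_rV n (a : R) (t : 'rV[R]_n) :
  measurable_fun setT (fun x : 'rV[R]_n => a *: x + t)%R.
Proof.
apply: measurable_fun_rV => i; under eq_fun do rewrite !mxE.
by apply: measurable_funD => //; apply: measurable_funM => //; exact: measurable_rV_coord.
Qed.

(** Tonelli splits off one coordinate and with it one factor a^-1. The induction is over all t and
    f, since the remaining coordinates are translated by the tail of t. *)
Lemma ge0_integral_affine_rV n (a : R) (t : 'rV[R]_n) (f : 'rV[R]_n -> \bar R) :
  (0 < a)%R -> measurable_fun setT f -> (forall x, 0 <= f x) ->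
  \int[lebesgue_rV R n]_x f (a *: x + t)%R =
  ((a ^- n)%R)%:E * \int[lebesgue_rV R n]_x f x.
Proof.
move=> a0; elim: n t f => [|n ih] t f mf f0.
  rewrite expr0 invr1 mul1e; apply: eq_integral => x _; congr f.
  by apply/rowP => -[].
have maf : measurable_fun setT (fun x : 'rV[R]_n.+1 => f (a *: x + t)%R).
  by apply: measurableT_comp => //; exact: measurable_affine_rV.
have cE r v : (a *: cons_rV (r, v) + t =
    cons_rV (a * r + t 0 0, a *: v + (uncons_rV t).2))%R.
  rewrite -[t in LHS]uncons_rVK; apply/rowP => j.
  have [->|] := eqVneq j ord0; first by rewrite 2!mxE !cons_rV0.
  by rewrite eq_sym => /unlift_some[k -> _]; rewrite 2!mxE !cons_rVS/= !mxE.
rewrite !ge0_integral_lebesgue_rVS//.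
have mfc : measurable_fun setT (f \o @cons_rV R n).
  by apply: measurableT_comp => //; exact: measurable_cons_rV.
pose F (r : R) := \int[lebesgue_rV R n]_v f (cons_rV (r, v)).
have mF : measurable_fun setT F.
  by apply: (measurable_fun_fubini_tonelli_F (f \o @cons_rV R n)) => // p; exact: f0.
have F0 r : 0 <= F r by exact: integral_ge0.
have an_ge0 : 0 <= ((a ^- n)%R)%:E by rewrite lee_fin invr_ge0 exprn_ge0// ltW.
transitivity (\int[@lebesgue_measure R]_r (((a ^- n)%R)%:E * F (a * r + t 0 0)%R)).
  apply: eq_integral => r _.
  under eq_integral => v _ do rewrite cE.
  rewrite (ih _ (fun v => f (cons_rV ((a * r + t 0 0)%R, v))))//.
  by move: (measurableT_comp mfc (pair1_measurable (a * r + t 0 0)%R)).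
have mFa : measurable_fun setT (fun r => F (a * r + t 0 0)%R).
  by apply: (measurableT_comp mF); exact: measurable_affine.
transitivity (((a ^- n)%R)%:E * \int[@lebesgue_measure R]_r F (a * r + t 0 0)%R).
  exact: (ge0_integralZl (@lebesgue_measure R) measurableT mFa (fun r _ => F0 _) an_ge0).
by rewrite (ge0_integral_affine _ a0 mF)// muleA -EFinM -invfM exprSr.
Qed.

Lemma lebesgue_rV_set0 n (x : 'rV[R]_n) : (0 < n)%N -> lebesgue_rV R n [set x] = 0.
Proof.
case: n x => // n x _.
have -> : [set x] = [set y | forall i, [set x 0%R i] (y 0%R i)].
  by apply/seteqP; split => [y -> //|y /= xy]; apply/rowP.
rewrite (@lebesgue_rV_box R n.+1 (fun i => [set x 0%R i])) => [|i]; last exact: measurable_set1.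
by rewrite big_ord_recl lebesgue_measure_set1 mul0e.
Qed.

End affine_change_of_variables.

(** * Square-integrable spinors *)

Section square_integrable.
Context disp (T : measurableType disp) {R : realType}.
Variable mu : {measure set T -> \bar R}.
Context {N : nat}.
Local Notation spinor := (T -> 'cV[R[i]]_N).
Implicit Types (u v w : spinor).

Definition measurable_spinor u := forall k,
  measurable_fun setT (fun x => complex.Re (u x k 0)) /\
  measurable_fun setT (fun x => complex.Im (u x k 0)).

(** For the Lebesgue measure on R^d this unfolds to [L2], and the two are used interchangeably. *)
Definition sqint u :=
  measurable_spinor u /\ (\int[mu]_x (cnorm (u x) ^+ 2)%:E < +oo)%E.

Definition ip u v : R := (\int[mu]_x rdot (u x) (v x))%R.

Lemma measurable_rdot u v : measurable_spinor u -> measurable_spinor v ->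
  measurable_fun setT (fun x => rdot (u x) (v x)).
Proof.
move=> mu_ mv; apply: measurable_sum => k.
have [? ?] := mu_ k; have [? ?] := mv k.
by apply: measurable_funD; apply: measurable_funM.
Qed.

Lemma measurable_spinorD u v : measurable_spinor u -> measurable_spinor v ->
  measurable_spinor (u \+ v).
Proof.
move=> hu hv k; have [? ?] := hu k; have [? ?] := hv k.
split; [under eq_fun do rewrite mxE cReD | under eq_fun do rewrite mxE cImD];
  exact: measurable_funD.
Qed.

Lemma measurable_spinor_mulmx (A : T -> 'M[R[i]]_N) u :
  (forall a b, measurable_fun setT (fun x => complex.Re (A x a b)) /\
               measurable_fun setT (fun x => complex.Im (A x a b))) ->
  measurable_spinor u -> measurable_spinor (fun x => A x *m u x).
Proof.
move=> hA hu k; split.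
  under eq_fun do rewrite mxE cRe_sum; apply: measurable_sum => b.
  have [? ?] := hA k b; have [? ?] := hu b.
  by under eq_fun do rewrite cReM; apply: measurable_funB; exact: measurable_funM.
under eq_fun do rewrite mxE cIm_sum; apply: measurable_sum => b.
have [? ?] := hA k b; have [? ?] := hu b.
by under eq_fun do rewrite cImM; apply: measurable_funD; exact: measurable_funM.
Qed.

Lemma measurable_spinorM (A : 'M[R[i]]_N) u :
  measurable_spinor u -> measurable_spinor (fun x => A *m u x).
Proof. by move=> hu; apply: measurable_spinor_mulmx hu => a b; split; exact: measurable_cst. Qed.

Lemma measurable_spinorZ (c : R[i]) u :
  measurable_spinor u -> measurable_spinor (fun x => c *: u x).
Proof. by under eq_fun do rewrite -mul_scalar_mx; exact: measurable_spinorM. Qed.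

Lemma measurable_spinorZf (r : T -> R) u : measurable_fun setT r ->
  measurable_spinor u -> measurable_spinor (fun x => (r x)%:C *: u x).
Proof.
move=> mr hu k; have [? ?] := hu k; split.
  by under eq_fun do rewrite mxE cReM /= mul0r subr0; exact: measurable_funM.
by under eq_fun do rewrite mxE cImM /= mul0r addr0; exact: measurable_funM.
Qed.

Lemma measurable_spinorN u : measurable_spinor u -> measurable_spinor (\- u).
Proof.
move=> hu; have -> : \- u = (fun x => (-1) *: u x).
  by apply/funext => x; rewrite /= scaleN1r.
exact: measurable_spinorZ.
Qed.

Lemma measurable_spinorB u v : measurable_spinor u -> measurable_spinor v ->
  measurable_spinor (u \- v).
Proof. by move=> hu /measurable_spinorN; exact: measurable_spinorD. Qed.

Lemma measurable_sqr_cnorm u : measurable_spinor u ->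
  measurable_fun setT (fun x => (cnorm (u x) ^+ 2)%:E).
Proof.
move=> hu; apply/measurable_EFinP; under eq_fun do rewrite cnorm_sqr.
exact: measurable_rdot.
Qed.

Lemma sqint_integrable u : sqint u -> mu.-integrable setT (fun x => (cnorm (u x) ^+ 2)%:E).
Proof.
move=> [hu fu]; apply/integrableP; split; first exact: measurable_sqr_cnorm.
by under eq_integral => x _ do rewrite gee0_abs ?lee_fin ?sqr_ge0//.
Qed.

Lemma integrable_sqint u : measurable_spinor u ->
  mu.-integrable setT (fun x => (cnorm (u x) ^+ 2)%:E) -> sqint u.
Proof.
move=> hu /integrableP[_]; under eq_integral => x _ do rewrite gee0_abs ?lee_fin ?sqr_ge0//.
by split.
Qed.

Lemma integrable_rdot u v : sqint u -> sqint v ->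
  mu.-integrable setT (EFin \o (fun x => rdot (u x) (v x))).
Proof.
move=> su sv; have [hu _] := su; have [hv _] := sv.
apply: (le_integrable measurableT _ _ (integrableD measurableT (sqint_integrable su) (sqint_integrable sv))).
  exact/measurable_EFinP/measurable_rdot.
move=> x _ /=; rewrite lee_fin (le_trans (rdot_cauchy_schwarz _ _))//.
rewrite (le_trans _ (ler_norm _))//.
have := sqr_ge0 (cnorm (u x) - cnorm (v x)); have := sqr_ge0 (cnorm (u x) + cnorm (v x)); nra.
Qed.

Lemma sqint_le (c : R) u v : measurable_spinor u -> sqint v ->
  (forall x, cnorm (u x) <= c * cnorm (v x)) -> sqint u.
Proof.
move=> hu sv uv; apply: integrable_sqint => //.
apply: (le_integrable measurableT _ _ (integrableZl measurableT (c ^+ 2) (sqint_integrable sv))).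
  exact: measurable_sqr_cnorm.
move=> x _ /=; rewrite lee_fin ger0_norm ?sqr_ge0// ger0_norm; last by rewrite mulr_ge0 ?sqr_ge0.
rewrite -exprMn; apply: lerXn2r; rewrite ?nnegrE ?cnorm_ge0//.
exact: le_trans (cnorm_ge0 _) (uv x).
Qed.

Lemma sqintD u v : sqint u -> sqint v -> sqint (u \+ v).
Proof.
move=> su sv; have [hu _] := su; have [hv _] := sv.
apply: integrable_sqint; first exact: measurable_spinorD.
apply: (le_integrable measurableT _ _ (integrableZl measurableT 2 (integrableD measurableT (sqint_integrable su) (sqint_integrable sv)))).
  by apply: measurable_sqr_cnorm; exact: measurable_spinorD.
move=> x _ /=; rewrite lee_fin ger0_norm ?sqr_ge0//.
rewrite (le_trans _ (ler_norm _))//.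
have := cnormD (u x) (v x); have := cnorm_ge0 (u x + v x).
have := sqr_ge0 (cnorm (u x) - cnorm (v x)); nra.
Qed.

Lemma sqintM (A : 'M[R[i]]_N) u : sqint u -> sqint (fun x => A *m u x).
Proof.
move=> su; apply: (@sqint_le (opnorm A) _ u) => //; last by move=> x; exact: opnorm_le.
by apply: measurable_spinorM; case: su.
Qed.

Lemma sqintZ (c : R[i]) u : sqint u -> sqint (fun x => c *: u x).
Proof. by under eq_fun do rewrite -mul_scalar_mx; exact: sqintM. Qed.

Lemma sqintN u : sqint u -> sqint (\- u).
Proof.
move=> hu; have -> : \- u = (fun x => (-1) *: u x).
  by apply/funext => x; rewrite /= scaleN1r.
exact: sqintZ.
Qed.

Lemma sqintB u v : sqint u -> sqint v -> sqint (u \- v).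
Proof. by move=> hu /sqintN; exact: sqintD. Qed.

Lemma sqint0 : sqint (fun=> 0).
Proof.
split; first by move=> k; split; exact: measurable_cst.
under eq_integral => x _ do rewrite cnorm0 expr0n /=.
by rewrite integral0.
Qed.

Lemma sqint_sum I (r : seq I) (f : I -> spinor) :
  (forall i, sqint (f i)) -> sqint (fun x => \sum_(i <- r) f i x).
Proof.
move=> sf; elim: r => [|i r ih]; first by under eq_fun do rewrite big_nil; exact: sqint0.
by under eq_fun do rewrite big_cons; exact: (@sqintD (f i) (fun x => \sum_(j <- r) f j x)).
Qed.

Lemma ipC u v : ip u v = ip v u.
Proof. by apply: eq_Rintegral => x _; rewrite rdotC. Qed.

Lemma ipDl u v w : sqint u -> sqint v -> sqint w -> ip (u \+ v) w = ip u w + ip v w.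
Proof.
move=> su sv sw; rewrite -RintegralD//; [|exact: integrable_rdot..].
by apply: eq_Rintegral => x _; rewrite rdotDl.
Qed.

Lemma ipDr u v w : sqint u -> sqint v -> sqint w -> ip w (u \+ v) = ip w u + ip w v.
Proof. by move=> *; rewrite ipC ipDl// !(ipC w). Qed.

Lemma ipZl (r : R) u w : sqint u -> sqint w -> ip (fun x => r%:C *: u x) w = r * ip u w.
Proof.
move=> su sw; rewrite -RintegralZl//; last exact: integrable_rdot.
by apply: eq_Rintegral => x _; rewrite rdotZl.
Qed.

Lemma ipZr (r : R) u w : sqint u -> sqint w -> ip w (fun x => r%:C *: u x) = r * ip w u.
Proof. by move=> *; rewrite ipC ipZl// (ipC w). Qed.

Lemma ipBl u v w : sqint u -> sqint v -> sqint w -> ip (u \- v) w = ip u w - ip v w.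
Proof.
move=> su sv sw; rewrite -RintegralB//; [|exact: integrable_rdot..].
by apply: eq_Rintegral => x _; rewrite rdotBl.
Qed.

Lemma ipBr u v w : sqint u -> sqint v -> sqint w -> ip w (u \- v) = ip w u - ip w v.
Proof. by move=> *; rewrite ipC ipBl// !(ipC w). Qed.

Lemma ip_suml I (r : seq I) (f : I -> spinor) w : (forall i, sqint (f i)) -> sqint w ->
  ip (fun x => \sum_(i <- r) f i x) w = \sum_(i <- r) ip (f i) w.
Proof.
move=> sf sw; elim: r => [|i r ih].
  rewrite big_nil /ip; under eq_Rintegral => x _ do rewrite big_nil rdot0l.
  by rewrite Rintegral_cst// mul0r.
under [in LHS]eq_fun do rewrite big_cons.
rewrite big_cons -ih -(@ipDl (f i))//; exact: sqint_sum.
Qed.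

Lemma ip_ge0 u : 0 <= ip u u.
Proof. by apply: Rintegral_ge0 => x _; exact: rdot_ge0. Qed.

Lemma ip_le u v : sqint u -> sqint v -> (forall x, cnorm (u x) <= cnorm (v x)) ->
  ip u u <= ip v v.
Proof.
move=> su sv uv; apply: le_Rintegral => //; [exact: integrable_rdot..|move=> x _].
by rewrite -!cnorm_sqr lerXn2r ?nnegrE ?cnorm_ge0.
Qed.

Lemma ip_cauchy_schwarz_sqr u v : sqint u -> sqint v -> ip u v ^+ 2 <= ip u u * ip v v.
Proof.
move=> su sv; have H (a b : R) : 0 <= a ^+ 2 * ip u u - 2 * a * b * ip u v + b ^+ 2 * ip v v.
  have := ip_ge0 ((fun x => a%:C *: u x) \- (fun x => b%:C *: v x)).
  have sau := sqintZ a%:C su; have sbv := sqintZ b%:C sv.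
  rewrite (ipBl sau sbv (sqintB sau sbv)) (ipBr sau sbv sau) (ipBr sau sbv sbv).
  rewrite (ipZl a su sau) (ipZl a su sbv) (ipZl b sv sau) (ipZl b sv sbv).
  rewrite (ipZr a su su) (ipZr b sv su) (ipZr a su sv) (ipZr b sv sv) (ipC v u).
  by move: (ip u u) (ip u v) (ip v v) => p q r; congr (0 <= _); ring.
have [v0|v0] := eqVneq (ip v v) 0.
  have [->|uv0] := eqVneq (ip u v) 0; first by rewrite expr0n mulr_ge0 ?ip_ge0.
  (* When |v| = 0 the quadratic form is affine in b; this b gives it the value -1. *)
  have := H 1 ((ip u u + 1) / (2 * ip u v)); rewrite v0.
  have -> : 2 * 1 * ((ip u u + 1) / (2 * ip u v)) * ip u v = ip u u + 1 by field.
  by lra.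
have vp : 0 < ip v v by rewrite lt_def v0 ip_ge0.
rewrite -(ler_pM2l vp) -subr_ge0; have := H (ip v v) (ip u v).
by congr (0 <= _); ring.
Qed.

Lemma ip_cauchy_schwarz u v : sqint u -> sqint v ->
  `|ip u v| <= Num.sqrt (ip u u) * Num.sqrt (ip v v).
Proof.
move=> su sv; rewrite -ler_sqr ?nnegrE ?mulr_ge0 ?sqrtr_ge0//.
by rewrite exprMn !sqr_sqrtr ?ip_ge0// real_normK ?num_real// ip_cauchy_schwarz_sqr.
Qed.

Lemma ip_eq0 u : sqint u -> ip u u = 0 -> {ae mu, forall x, u x = 0}.
Proof.
move=> su u0; have [hu _] := su.
have : (\int[mu]_x `|(rdot (u x) (u x))%:E| = 0)%E.
  under eq_integral => x _ do rewrite gee0_abs ?lee_fin ?rdot_ge0//.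
  rewrite -[LHS]fineK ?[X in X%:E]u0//.
  exact: integrable_fin_num (integrable_rdot su su).
have mf : measurable_fun setT (fun x => (rdot (u x) (u x))%:E).
  exact/measurable_EFinP/measurable_rdot.
move/(ae_eq_integral_abs mu measurableT mf); apply: filterS => x /(_ I) /= [].
exact: rdot_eq0.
Qed.

Lemma eq_ip_ae u u' v : measurable_spinor u -> measurable_spinor u' -> measurable_spinor v ->
  {ae mu, forall x, u x = u' x} -> ip u v = ip u' v.
Proof.
move=> hu hu' hv uu'; congr fine; apply: ae_eq_integral => //.
- exact/measurable_EFinP/measurable_rdot.
- exact/measurable_EFinP/measurable_rdot.
by apply: filterS uu' => x -> _.
Qed.

End square_integrable.

(** * Convergence in mean square *)

Section mean_square_convergence.
Context disp (T : measurableType disp) {R : realType}.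
Variable mu : {measure set T -> \bar R}.
Context {N : nat}.
Local Notation spinor := (T -> 'cV[R[i]]_N).
Local Notation ip := (ip mu).
Local Notation sqint := (sqint mu).
Implicit Types (u v w : spinor).

Definition l2cvg (u_ : nat -> spinor) u := ip (u_ n \- u) (u_ n \- u) @[n --> \oo] --> 0.

Lemma ip_le_scaled (c : R) u v : 0 <= c -> sqint u -> sqint v ->
  (forall x, cnorm (u x) <= c * cnorm (v x)) -> ip u u <= c ^+ 2 * ip v v.
Proof.
move=> c0 su sv uv; have scv : sqint (fun x => c%:C *: v x) := sqintZ c%:C sv.
rewrite expr2 -mulrA -(ipZr c sv sv) -(ipZl c sv scv).
by apply: ip_le => // x; rewrite cnormZ ger0_norm.
Qed.

Lemma ipDD_le u v : sqint u -> sqint v ->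
  ip (u \+ v) (u \+ v) <= 2 * (ip u u + ip v v).
Proof.
move=> su sv; have := ip_ge0 mu (u \- v).
rewrite (ipBl su sv (sqintB su sv)) (ipBr su sv su) (ipBr su sv sv).
rewrite (ipDl su sv (sqintD su sv)) (ipDr su sv su) (ipDr su sv sv) (ipC mu v u).
by move: (ip u u) (ip u v) (ip v v) => a b c; lra.
Qed.

Lemma ip_cvg0l (w_ : nat -> spinor) v : (forall n, sqint (w_ n)) -> sqint v ->
  ip (w_ n) (w_ n) @[n --> \oo] --> 0 -> ip (w_ n) v @[n --> \oo] --> 0.
Proof.
move=> sw sv w0; apply/norm_cvg0P.
apply: (@squeeze_cvgr _ _ _ _ (fun=> 0) (fun n => Num.sqrt (ip (w_ n) (w_ n)) * Num.sqrt (ip v v))).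
- by near=> n; rewrite normr_ge0 ip_cauchy_schwarz.
- exact: cvg_cst.
- rewrite -[X in _ --> X](mul0r (Num.sqrt (ip v v))); apply: cvgMl.
  by rewrite -[X in _ --> X]sqrtr0; apply: continuous_cvg => //; exact: sqrt_continuous.
Unshelve. all: by end_near. Qed.

Lemma ip_cvg00 (w_ z_ : nat -> spinor) : (forall n, sqint (w_ n)) -> (forall n, sqint (z_ n)) ->
  ip (w_ n) (w_ n) @[n --> \oo] --> 0 -> ip (z_ n) (z_ n) @[n --> \oo] --> 0 ->
  ip (w_ n) (z_ n) @[n --> \oo] --> 0.
Proof.
move=> sw sz w0 z0; apply/norm_cvg0P.
apply: (@squeeze_cvgr _ _ _ _ (fun=> 0) (fun n => Num.sqrt (ip (w_ n) (w_ n)) * Num.sqrt (ip (z_ n) (z_ n)))).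
- by near=> n; rewrite normr_ge0 ip_cauchy_schwarz.
- exact: cvg_cst.
- rewrite -[X in _ --> X](mul0r 0); apply: cvgM.
    by rewrite -[X in _ --> X]sqrtr0; apply: continuous_cvg => //; exact: sqrt_continuous.
  by rewrite -[X in _ --> X]sqrtr0; apply: continuous_cvg => //; exact: sqrt_continuous.
Unshelve. all: by end_near. Qed.

Lemma l2cvg_ip (u_ v_ : nat -> spinor) u v :
  (forall n, sqint (u_ n)) -> (forall n, sqint (v_ n)) -> sqint u -> sqint v ->
  l2cvg u_ u -> l2cvg v_ v -> ip (u_ n) (v_ n) @[n --> \oo] --> ip u v.
Proof.
move=> su_ sv_ su sv uu vv.
have sd n : sqint (u_ n \- u) by exact: sqintB.
have se n : sqint (v_ n \- v) by exact: sqintB.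
have -> : (fun n => ip (u_ n) (v_ n)) =
    (fun n => ip (u_ n \- u) (v_ n \- v) + ip (u_ n \- u) v + ip (v_ n \- v) u + ip u v).
  apply/funext => n; rewrite (ipBl (su_ n) su (se n)) (ipBl (su_ n) su sv) (ipBl (sv_ n) sv su).
  rewrite (ipBr (sv_ n) sv (su_ n)) (ipBr (sv_ n) sv su) (ipC mu v u) (ipC mu (v_ n) u).
  by move: (ip (u_ n) (v_ n)) (ip (u_ n) v) (ip u (v_ n)) (ip u v) => p q r t; ring.
rewrite -[X in _ --> X]add0r; apply: cvgD; last exact: cvg_cst.
rewrite -[X in _ --> X](addr0 0); apply: cvgD; last exact: (ip_cvg0l se su vv).
rewrite -[X in _ --> X](addr0 0); apply: cvgD; last exact: (ip_cvg0l sd sv uu).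
exact: (ip_cvg00 sd se uu vv).
Qed.

Lemma l2cvg_le (c : R) (u_ v_ : nat -> spinor) u v : 0 <= c ->
  (forall n, sqint (u_ n)) -> (forall n, sqint (v_ n)) -> sqint u -> sqint v ->
  (forall n x, cnorm (v_ n x - v x) <= c * cnorm (u_ n x - u x)) ->
  l2cvg u_ u -> l2cvg v_ v.
Proof.
move=> c0 su_ sv_ su sv uv uu.
apply: (@squeeze_cvgr _ _ _ _ (fun=> 0) (fun n => c ^+ 2 * ip (u_ n \- u) (u_ n \- u))).
- near=> n; rewrite ip_ge0 /=; apply: ip_le_scaled => //; [exact: sqintB..|].
  by move=> x; exact: uv.
- exact: cvg_cst.
- by rewrite -[X in _ --> X](mulr0 (c ^+ 2)); apply: cvgMr.
Unshelve. all: by end_near. Qed.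

Lemma l2cvgM (A : 'M[R[i]]_N) (u_ : nat -> spinor) u :
  (forall n, sqint (u_ n)) -> sqint u -> l2cvg u_ u ->
  l2cvg (fun n x => A *m u_ n x) (fun x => A *m u x).
Proof.
move=> su_ su; apply: (@l2cvg_le (opnorm A)) => //.
- exact: opnorm_ge0.
- by move=> n; exact: sqintM.
- exact: sqintM.
- by move=> n x; rewrite -mulmxBr; exact: opnorm_le.
Qed.

Lemma l2cvgZ (c : R[i]) (u_ : nat -> spinor) u :
  (forall n, sqint (u_ n)) -> sqint u -> l2cvg u_ u ->
  l2cvg (fun n x => c *: u_ n x) (fun x => c *: u x).
Proof.
move=> su_ su uu; have := l2cvgM c%:M su_ su uu.
by under eq_fun do under eq_fun do rewrite mul_scalar_mx; under [X in l2cvg _ X]eq_fun do rewrite mul_scalar_mx.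
Qed.

Lemma l2cvgD (u_ v_ : nat -> spinor) u v :
  (forall n, sqint (u_ n)) -> (forall n, sqint (v_ n)) -> sqint u -> sqint v ->
  l2cvg u_ u -> l2cvg v_ v -> l2cvg (fun n => u_ n \+ v_ n) (u \+ v).
Proof.
move=> su_ sv_ su sv uu vv.
apply: (@squeeze_cvgr _ _ _ _ (fun=> 0)
  (fun n => 2 * (ip (u_ n \- u) (u_ n \- u) + ip (v_ n \- v) (v_ n \- v)))).
- near=> n; rewrite ip_ge0 /=.
  have -> : (u_ n \+ v_ n) \- (u \+ v) = (u_ n \- u) \+ (v_ n \- v).
    by apply/funext => x /=; rewrite opprD addrACA.
  by apply: ipDD_le; exact: sqintB.
- exact: cvg_cst.
- rewrite -[X in _ --> X](mulr0 2); apply: cvgMr.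
  by rewrite -[X in _ --> X](addr0 0); exact: cvgD.
Unshelve. all: by end_near. Qed.

Lemma l2cvg_cst u : l2cvg (fun=> u) u.
Proof.
rewrite /l2cvg (_ : (fun _ => _) = (fun=> 0)); first exact: cvg_cst.
apply/funext => n; rewrite /ip (_ : (fun _ => _) = (fun=> 0)); last first.
  by apply/funext => x /=; rewrite subrr rdot0l.
by rewrite Rintegral_cst// mul0r.
Qed.

Lemma l2cvg_sum I (r : seq I) (u_ : I -> nat -> spinor) (u : I -> spinor) :
  (forall i n, sqint (u_ i n)) -> (forall i, sqint (u i)) ->
  (forall i, l2cvg (u_ i) (u i)) ->
  l2cvg (fun n x => \sum_(i <- r) u_ i n x) (fun x => \sum_(i <- r) u i x).
Proof.
move=> su_ su uu; elim: r => [|i r ih].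
  rewrite (_ : (fun _ _ => _) = (fun _ _ => 0)); last first.
    by apply/funext => n; apply/funext => x; rewrite big_nil.
  rewrite (_ : (fun _ => \sum_(_ <- _) _) = (fun=> 0)); first exact: l2cvg_cst.
  by apply/funext => x; rewrite big_nil.
rewrite (_ : (fun _ _ => _) = (fun n => u_ i n \+ (fun x => \sum_(j <- r) u_ j n x))); last first.
  by apply/funext => n; apply/funext => x; rewrite big_cons.
rewrite (_ : (fun _ => \sum_(_ <- _ :: _) _) = (u i \+ (fun x => \sum_(j <- r) u j x))); last first.
  by apply/funext => x; rewrite big_cons.
by apply: (@l2cvgD (u_ i) (fun n x => \sum_(j <- r) u_ j n x) (u i)) => //;
  [move=> n; exact: sqint_sum | exact: sqint_sum].
Qed.

Lemma l2cvg_dominated (u_ : nat -> spinor) u (g : T -> R) :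
  (forall n, measurable_spinor (u_ n)) -> measurable_spinor u ->
  mu.-integrable setT (EFin \o g) ->
  (forall n x, cnorm (u_ n x - u x) ^+ 2 <= g x) ->
  (forall x, cnorm (u_ n x - u x) @[n --> \oo] --> 0) ->
  l2cvg u_ u.
Proof.
move=> mu_ mu' ig ug uu.
have md n : measurable_spinor (u_ n \- u) by exact: measurable_spinorB.
have [] := @dominated_convergence _ _ _ mu setT measurableT
  (fun n x => (rdot ((u_ n \- u) x) ((u_ n \- u) x))%:E) (fun=> 0%E) (EFin \o g).
- by move=> n; exact/measurable_EFinP/measurable_rdot.
- exact: measurable_cst.
- apply: aeW => x _; apply: (@cvg_EFin _ _ _ _ _ 0); first exact: nearW.
  have -> : fine \o (fun n => (rdot ((u_ n \- u) x) ((u_ n \- u) x))%:E) =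
    (fun n => cnorm (u_ n x - u x) * cnorm (u_ n x - u x)).
    by apply/funext => n /=; rewrite -cnorm_sqr expr2.
  by rewrite -(mulr0 0); exact: cvgM.
- exact: ig.
- apply: aeW => x n _ /=; rewrite lee_fin ger0_norm ?rdot_ge0//.
  by rewrite -cnorm_sqr.
move=> _ _; rewrite integral0; move=> /fine_cvg.
by rewrite /l2cvg /ip.
Qed.

End mean_square_convergence.

(** * Integration by parts for test functions *)

Section directional_mean_value.
Context {R : realType} {d : nat}.
Implicit Types (f : 'rV[R]_d -> R) (x v : 'rV[R]_d).

Lemma is_derive_line f x v (s : R) (df : R) :
  is_derive (x + s *: v) v f df -> is_derive s 1 (fun r => f (x + r *: v)) df.
Proof.
have E : (fun h => h^-1 *: (((fun r => f (x + r *: v)) \o shift s) (h *: 1) - f (x + s *: v))) =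
         (fun h : R => h^-1 *: ((f \o shift (x + s *: v)) (h *: v) - f (x + s *: v))).
  apply/funext => h /=; congr (_ *: (f _ - _)).
  by rewrite /shift /= scalerDl addrCA scaler1.
by case=> fd dfE; split; rewrite /derivable /derive E.
Qed.

Lemma mean_value_line f x v (t : R) :
  (forall s : R, `|s| <= `|t| -> derivable f (x + s *: v) v) ->
  exists2 th, `|th| <= `|t| & f (x + t *: v) - f x = t * 'D_v f (x + th *: v).
Proof.
move=> df; pose phi s := f (x + s *: v).
have dphi (s : R) : `|s| <= `|t| -> is_derive s 1 phi ('D_v f (x + s *: v)).
  by move=> st; apply: is_derive_line; apply: derivableP; exact: df.
have phi0 : phi 0 = f x by rewrite /phi scale0r addr0.
have [t0|t0] := leP 0 t.
  have in_t s : s \in `[0, t] -> `|s| <= `|t|.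
    by rewrite in_itv /= => /andP[s0 st]; rewrite !ger0_norm.
  have [c ct] : exists2 c, c \in `[0, t] & phi t - phi 0 = 'D_v f (x + c *: v) * (t - 0).
    apply: (MVT_segment t0) => [s s0t|].
      by apply: dphi; apply: in_t; exact: subset_itv_oo_cc s0t.
    by apply: derivable_within_continuous => s /in_t /dphi[].
  by rewrite phi0 subr0 mulrC => e; exists c => //; exact: in_t.
have in_t s : s \in `[t, 0] -> `|s| <= `|t|.
  rewrite in_itv /= => /andP[ts s0]; rewrite (ltr0_norm t0) ler0_norm//.
  by rewrite lerN2.
have [c ct] : exists2 c, c \in `[t, 0] & phi 0 - phi t = 'D_v f (x + c *: v) * (0 - t).
  apply: (MVT_segment (ltW t0)) => [s s0t|].
    by apply: dphi; apply: in_t; exact: subset_itv_oo_cc s0t.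
  by apply: derivable_within_continuous => s /in_t /dphi[].
rewrite phi0 => e; exists c; first exact: in_t.
by rewrite -opprB e; ring.
Qed.

Lemma entry_le_norm x i : `|x 0 i| <= `|x|.
Proof. by rewrite [leRHS]/Num.norm /= mx_normrE; exact: (le_bigmax _ (fun ij => `|x ij.1 ij.2|) (0, i)). Qed.

Lemma norm_delta_mx (j : 'I_d) : `|delta_mx 0 j : 'rV[R]_d| <= 1.
Proof.
rewrite /Num.norm /= mx_normrE; apply/bigmax_leP; split => // ij _.
by rewrite mxE; case: (_ && _); rewrite ?normr1// normr0.
Qed.

Lemma compact_norm_ball (M : R) : compact [set x : 'rV[R]_d | `|x| <= M].
Proof.
apply: bounded_closed_compact; last first.
  apply: (@closed_comp _ _ (fun x : 'rV[R]_d => `|x|) [set r | r <= M]); last exact: closed_le.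
  by move=> x _; exact: norm_continuous.
by exists M; split; [exact: num_real | move=> r Mr x /= /le_trans; apply; exact: ltW].
Qed.

Lemma bounded_of_support f (M : R) : continuous f -> (forall x, M < `|x| -> f x = 0) ->
  exists2 B, 0 <= B & forall x, `|f x| <= B.
Proof.
move=> cf f0.
have /compact_bounded[B [_ HB]] : compact (f @` [set x : 'rV[R]_d | `|x| <= M]).
  apply: continuous_compact; last exact: compact_norm_ball.
  exact: continuous_subspaceT.
exists (`|B| + 1); first by rewrite addr_ge0.
move=> x; have [xM|xM] := leP `|x| M; last by rewrite f0// normr0 addr_ge0.
by apply: HB; [rewrite ltr_pwDr// ler_norm | exists x].
Qed.

End directional_mean_value.

Section lebesgue_integral_rV.
Context {R : realType} {d : nat}.
Local Notation mu := (lebesgue_rV R d).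

Lemma integrable_affine (a : R) (t : 'rV[R]_d) (f : 'rV[R]_d -> \bar R) : 0 < a ->
  mu.-integrable setT f -> mu.-integrable setT (fun x => f (a *: x + t)).
Proof.
move=> a0 /integrableP[mf ff]; apply/integrableP; split.
  by apply: (measurableT_comp mf); exact: measurable_affine_rV.
have mf' : measurable_fun setT (fun x => `|f x|%E) by exact: measurableT_comp.
have -> := ge0_integral_affine_rV t a0 mf' (fun x => abse_ge0 (f x)).
by rewrite lte_mul_pinfty// lee_fin invr_ge0 exprn_ge0// ltW.
Qed.

Lemma Rintegral_affine (a : R) (t : 'rV[R]_d) (f : 'rV[R]_d -> R) : 0 < a ->
  mu.-integrable setT (EFin \o f) ->
  (\int[mu]_x f (a *: x + t))%R = a ^- d * (\int[mu]_x f x)%R.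
Proof.
move=> a0 If; have mf := measurable_int _ If.
have Ip := integrable_pos_fin_num measurableT If.
have In := integrable_neg_fin_num measurableT If.
rewrite /Rintegral integralE [in RHS]integralE.
have -> : (\int[mu]_x (fun x => (f (a *: x + t))%:E)^\+ x =
           (a ^- d)%:E * \int[mu]_x (EFin \o f)^\+ x)%E.
  rewrite -(ge0_integral_affine_rV t)//; first by apply: eq_integral => x _; rewrite ?funeposE ?funenegE.
  exact: measurable_funepos.
have -> : (\int[mu]_x (fun x => (f (a *: x + t))%:E)^\- x =
           (a ^- d)%:E * \int[mu]_x (EFin \o f)^\- x)%E.
  rewrite -(ge0_integral_affine_rV t)//; first by apply: eq_integral => x _; rewrite ?funeposE ?funenegE.
  exact: measurable_funeneg.
rewrite -muleBr//; last by rewrite fin_num_adde_defl// fin_numN.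
by rewrite fineM// fin_numB Ip In.
Qed.

Lemma lebesgue_rV_norm_ball (M : R) :
  exists A : set 'rV[R]_d, [/\ measurable A, (mu A < +oo)%E & forall x, `|x| <= M -> A x].
Proof.
exists [set x | forall i, `[- M, M]%classic (x 0 i)]; split.
- by apply: (@measurable_box _ _ (fun=> `[- M, M]%classic)).
- rewrite (@lebesgue_rV_box R d (fun=> `[- M, M]%classic))//.
  rewrite ltey_eq; apply/orP; left.
  elim/big_ind : _ => // [x y|i _]; first exact: fin_numM.
  by rewrite lebesgue_measure_itv /=; case: ifP.
- by move=> x xM i; rewrite /= in_itv /= -ler_norml (le_trans (entry_le_norm _ _)).
Qed.

(** The function g is chosen before the values y that it dominates, as dominated convergence
    requires: it is B on a box containing the ball of radius M. *)
Lemma integrable_bound (B M : R) : exists2 g : 'rV[R]_d -> R,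
  mu.-integrable setT (EFin \o g) &
  forall (y : R) x, `|y| <= B -> (M < `|x| -> y = 0) -> `|y| <= g x.
Proof.
have [A [mA fA MA]] := lebesgue_rV_norm_ball M.
exists ((cst B) \_ A).
  have := (integrable_mkcond (EFin \o cst B) mA).1.
  rewrite restrict_EFin; apply.
  apply: measurable_bounded_integrable => //.
  exists `|B|; split; first exact: num_real.
  by move=> r Br x _ /=; exact: ltW.
move=> y x yB y0; rewrite patchE; case: ifPn => // xA.
rewrite y0 ?normr0// ltNge; apply: contraNN xA => xM.
by rewrite inE; exact: MA.
Qed.

End lebesgue_integral_rV.

Lemma ex2_and (T : Type) (P Q : T -> Prop) : (exists2 x, P x & Q x) -> exists x, P x /\ Q x.
Proof. by case=> x Px Qx; exists x. Qed.

(** * Directional derivatives, their integrals and their symmetry *)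

Section directional_calculus.
Context {R : realType} {d : nat}.
Implicit Types (f : 'rV[R]_d -> R) (x v : 'rV[R]_d).
Local Notation e j := (delta_mx 0 j : 'rV[R]_d).

Lemma cvg_norm_sub0 (y_ : nat -> 'rV[R]_d) x (c_ : nat -> R) :
  (forall n, `|y_ n - x| <= c_ n) -> c_ n @[n --> \oo] --> 0 -> y_ n @[n --> \oo] --> x.
Proof.
move=> yc c0; apply/subr_cvg0; apply/norm_cvg0P.
apply: (squeeze_cvgr _ (cvg_cst 0) c0); near=> n.
by rewrite normr_ge0 yc.
Unshelve. all: by end_near. Qed.

(** By translation invariance every difference quotient of f has integral zero. The mean value
    theorem bounds the quotients uniformly, so the limit may be taken under the integral. *)
Lemma Rintegral_derive_eq0 f (j : 'I_d) (M : R) :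
  continuous f -> (forall x, derivable f x (e j)) ->
  continuous (fun x => 'D_(e j) f x) -> (forall x, M < `|x| -> f x = 0) ->
  (\int[lebesgue_rV R d]_x 'D_(e j) f x)%R = 0.
Proof.
move=> cf df cdf f0; set mu := lebesgue_rV R d.
have D0 x : M < `|x| -> 'D_(e j) f x = 0.
  move=> Mx; rewrite (@near_eq_derive _ _ _ f (cst 0)) ?derive_cst//.
  have /cvgr_gt/(_ _ Mx) : (fun y : 'rV[R]_d => `|y|) @ x --> `|x| by exact: norm_continuous.
  by apply: filterS => y; exact: f0.
have [B B0 DB] := bounded_of_support cdf D0.
have [Bf Bf0 fB] := bounded_of_support cf f0.
have If : mu.-integrable setT (EFin \o f).
  have [g ig fg] := @integrable_bound R d Bf M.
  apply: (le_integrable measurableT _ _ ig).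
    by apply/measurable_EFinP; exact: continuous_measurable_rV.
  move=> x _ /=; rewrite lee_fin (le_trans (fg _ x (fB x) _)) ?ler_norm//.
  exact: f0.
pose t n : R := n.+1%:R^-1.
have t0 n : 0 < t n by rewrite invr_gt0.
have t1 n : t n <= 1 by rewrite invf_le1 ?ler1n.
pose q n x := n.+1%:R * (f (1 *: x + t n *: e j) - f x).
have qE n x : exists2 th, `|th| <= t n & q n x = 'D_(e j) f (x + th *: e j).
  have [th tht E] := @mean_value_line R d f x (e j) (t n) (fun s _ => df _).
  exists th; first by rewrite -[t n]gtr0_norm.
  by rewrite /q scale1r E /t mulrA mulfV ?mul1r// pnatr_eq0.
have If' n : mu.-integrable setT (EFin \o (fun x => f (1 *: x + t n *: e j))).
  exact: (integrable_affine _ ltr01 If).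
have q0 n : (\int[mu]_x q n x)%R = 0.
  rewrite RintegralZl//; last exact: (integrableB measurableT (If' n) If).
  rewrite RintegralB// (Rintegral_affine _ ltr01 If) expr1n invr1 mul1r subrr.
  by rewrite mulr0.
have mq n : measurable_fun setT (q n).
  apply: measurable_funM => //; apply: measurable_funB.
    by have /measurable_EFinP := measurable_int _ (If' n).
  exact: continuous_measurable_rV.
(* The steps are at most 1, so all quotients vanish outside the ball of radius M + 1. *)
have [g ig Dg] := @integrable_bound R d B (M + 1).
have [] := @dominated_convergence _ _ _ mu setT measurableT
  (fun n => EFin \o q n) (EFin \o (fun x => 'D_(e j) f x)) (EFin \o g).
- by move=> n; exact/measurable_EFinP.
- by apply/measurable_EFinP; exact: continuous_measurable_rV.
- apply: aeW => x _; apply: cvg_EFin; first exact: nearW.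
  pose th n := projT1 (cid2 (qE n x)).
  have thP n : `|th n| <= t n /\ q n x = 'D_(e j) f (x + th n *: e j).
    by rewrite /th; case: cid2.
  have -> : fine \o (fun n => (EFin \o q n) x) = (fun n => 'D_(e j) f (x + th n *: e j)).
    by apply/funext => n /=; rewrite (thP n).2.
  apply: (@cvg_comp _ _ _ (fun n => x + th n *: e j) (fun y => 'D_(e j) f y) _ (nbhs x)); last exact: cdf.
  apply: (@cvg_norm_sub0 _ _ t); last exact: cvg_harmonic.
  move=> n; rewrite addrC addKr normrZ.
  rewrite -[leRHS]mulr1 ler_pM// ?norm_delta_mx//.
  by have [] := thP n.
- exact: ig.
- apply: aeW => x n _ /=; rewrite lee_fin; apply: Dg.
    by have [th _ ->] := qE n x.
  move=> Mx; have [th tht ->] := qE n x; apply: D0.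
  rewrite -ltrBrDr in Mx; apply: (lt_le_trans Mx).
  rewrite lerBlDr -[x in leLHS](addrK (th *: e j)).
  rewrite (le_trans (ler_normB _ _))// lerD2l normrZ.
  rewrite -[leRHS]mulr1 ler_pM ?norm_delta_mx//.
  exact: le_trans tht (t1 n).
move=> ID _; rewrite -[X in _ --> X]fineK; last exact: integrable_fin_num ID.
move=> /fine_cvg.
have -> : fine \o [sequence (\int[mu]_x (q n x)%:E)%E]_n = (fun=> 0).
  by apply/funext => n; exact: q0.
by move=> L; apply: esym; exact: (cvg_unique _ (cvg_cst 0) L).
Qed.

(** Strict differentiability: the base point y moves too. Unlike the plain directional derivative it
    is additive in v, and so passes from the coordinate directions to all directions. *)
Let strict_derivative f x v (l : R) := forall eps : R, 0 < eps ->
  exists2 del, 0 < del & forall y h, `|y - x| < del -> `|h| < del ->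
    `|f (y + h *: v) - f y - h * l| <= eps * `|h|.

Let strict_derivative0 f x : strict_derivative f x 0 0.
Proof.
move=> eps e0; exists 1 => // y h _ _.
by rewrite scaler0 addr0 subrr mulr0 subrr normr0 mulr_ge0// ltW.
Qed.

Let strict_derivativeD f x v w l k :
  strict_derivative f x v l -> strict_derivative f x w k ->
  strict_derivative f x (v + w) (l + k).
Proof.
move=> fv fw eps e0; have e2 : 0 < eps / 2 by rewrite divr_gt0.
have [a a0 fa] := fv _ e2; have [b b0 fb] := fw _ e2.
pose c := Num.min (Num.min a (b / 2)) (b / 2 / (`|v| + 1)).
have v1 : 0 < `|v| + 1 by rewrite ltr_wpDl.
have c0 : 0 < c by rewrite !lt_min a0 !divr_gt0.
exists c => // y h; rewrite !lt_min => /andP[/andP[ya yb] _] /andP[/andP[ha hb] hv].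
have := fa y h ya ha; have := fb (y + h *: v) h; rewrite -(addrA y _ (h *: w)) -scalerDr.
have -> : `|y + h *: v - x| < b.
  rewrite addrAC (le_lt_trans (ler_normD _ _))// [ltRHS]splitr ltrD// normrZ.
  apply: le_lt_trans (_ : `|h| * (`|v| + 1) < b / 2); first by rewrite ler_wpM2l// lerDl.
  by rewrite -ltr_pdivlMr.
have -> : `|h| < b by rewrite (lt_trans hb)// ltr_pdivrMr// ltr_pMr// ltr1n.
move=> /(_ isT isT) H1 H2.
have -> : f (y + h *: (v + w)) - f y - h * (l + k) =
  (f (y + h *: (v + w)) - f (y + h *: v) - h * k) + (f (y + h *: v) - f y - h * l) by ring.
rewrite (le_trans (ler_normD _ _))// (le_trans (lerD H1 H2))//.
by rewrite -mulrDl -splitr.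
Qed.

Let strict_derivative_coordinate f x (j : 'I_d) (c : R) :
  (\forall y \near x, derivable f y (e j)) -> {for x, continuous (fun y => 'D_(e j) f y)} ->
  strict_derivative f x (c *: e j) (c * 'D_(e j) f x).
Proof.
move=> df cf eps e0.
have c1 : 0 < `|c| + 1 by rewrite ltr_wpDl.
have ec0 : 0 < eps / (`|c| + 1) by rewrite divr_gt0.
have /nbhs_ballP[a /= a0 fa] : \forall y \near x, derivable f y (e j) /\
    `|'D_(e j) f x - 'D_(e j) f y| < eps / (`|c| + 1).
  have /cvgr_dist_lt/(_ _ ec0) cf' : (fun y => 'D_(e j) f y) @ x --> 'D_(e j) f x := cf.
  exact: filterI df cf'.
pose b := Num.min (a / 2) (a / 2 / (`|c| + 1)).
have b0 : 0 < b by rewrite lt_min !divr_gt0.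
exists b => // y h; rewrite !lt_min => /andP[ya _] /andP[_ ha].
have hc : `|h * c| < a / 2.
  rewrite normrM; apply: le_lt_trans (_ : `|h| * (`|c| + 1) < a / 2).
    by rewrite ler_wpM2l// lerDl.
  by rewrite -ltr_pdivlMr.
have near_x s : `|s| <= `|h * c| -> ball x a (y + s *: e j).
  move=> sh; rewrite -ball_normE /ball_ /= distrC addrAC (le_lt_trans (ler_normD _ _))//.
  rewrite [ltRHS]splitr ltrD// normrZ (le_lt_trans _ hc)// -[leRHS]mulr1 ler_pM//.
  exact: norm_delta_mx.
have [th tht E] := @mean_value_line R d f y (e j) (h * c) (fun s sh => (fa _ (near_x s sh)).1).
rewrite scalerA E mulrA -mulrBr normrM distrC.
have [_ /ltW H] := fa _ (near_x th tht).
apply: (le_trans (ler_wpM2l (normr_ge0 _) H)); rewrite normrM.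
have K : `|c| * (eps / (`|c| + 1)) <= eps.
  by rewrite mulrCA ler_piMr ?(ltW e0)// ler_pdivrMr// mul1r lerDl.
by rewrite -mulrA [leRHS]mulrC ler_wpM2l.
Qed.

(** Smoothness is expressed by partial derivatives, whereas rays and segments need derivatives in
    arbitrary directions. *)
Lemma is_derive_C1 f x v :
  (forall j, \forall y \near x, derivable f y (e j)) ->
  (forall j, {for x, continuous (fun y => 'D_(e j) f y)}) ->
  is_derive x v f (\sum_j v 0 j * 'D_(e j) f x).
Proof.
move=> df cf; set l := \sum_j _.
have S : strict_derivative f x v l.
  rewrite [v]row_sum_delta /l.
  apply: (big_ind2 (fun w k => strict_derivative f x w k)).
  - exact: strict_derivative0.
  - by move=> *; exact: strict_derivativeD.
  - by move=> j _; exact: strict_derivative_coordinate.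
suff L : (fun h : R => h^-1 *: ((f \o shift x) (h *: v) - f x)) @ 0^' --> l.
  by split; [apply/cvg_ex; exists l | exact: cvg_lim].
apply/cvgrPdist_le => eps e0; have [del del0 H] := S eps e0.
near=> h; have h0 : h != 0 by near: h; exact: nbhs_dnbhs_neq.
have hd : `|h| < del.
  by near: h; apply: nbhs_dnbhs; apply/nbhs_ballP; exists del => //= h; rewrite -ball_normE /= sub0r normrN.
have := H x h; rewrite subrr normr0 => /(_ del0 hd).
move=> {}H; rewrite distrC (_ : _ - l = h^-1 * (f (x + h *: v) - f x - h * l)); last first.
  by rewrite [RHS]mulrBr mulrA mulVf// mul1r /= (addrC x).
by rewrite normrM normfV mulrC ler_pdivrMr ?normr_gt0.
Unshelve. all: by end_near. Qed.

Lemma is_derive_translate f x v w (df : R) :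
  is_derive (x + w) v f df -> is_derive x v (fun y => f (y + w)) df.
Proof.
have E : (fun h => h^-1 *: (((fun y => f (y + w)) \o shift x) (h *: v) - f (x + w))) =
         (fun h : R => h^-1 *: ((f \o shift (x + w)) (h *: v) - f (x + w))).
  by apply/funext => h /=; rewrite /shift /= addrA.
by case=> fd dfE; split; rewrite /derivable /derive E.
Qed.

(** The second difference of f over a square of side h is symmetric in j and k. By two mean value
    theorems it is h^2 times either mixed derivative at a point within 2 h of x. *)
Lemma derive_comm f (j k : 'I_d) :
  (forall x, derivable f x (e j)) -> (forall x, derivable f x (e k)) ->
  (forall x, derivable ('D_(e j) f) x (e k)) -> (forall x, derivable ('D_(e k) f) x (e j)) ->
  continuous ('D_(e k) ('D_(e j) f)) -> continuous ('D_(e j) ('D_(e k) f)) ->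
  'D_(e k) ('D_(e j) f) = 'D_(e j) ('D_(e k) f).
Proof.
move=> dj dk djk dkj cjk ckj; apply/funext => x.
have second_difference (a b : 'I_d) (h : R) : (forall x, derivable f x (e a)) ->
    (forall x, derivable ('D_(e a) f) x (e b)) ->
    exists2 y, `|y - x| <= 2 * `|h| &
    f (x + h *: e a + h *: e b) - f (x + h *: e a) - (f (x + h *: e b) - f x) =
    h * h * 'D_(e b) ('D_(e a) f) y.
  move=> da dab; pose phi y := f (y + h *: e b) - f y.
  have dphi y : is_derive y (e a) phi ('D_(e a) f (y + h *: e b) - 'D_(e a) f y).
    apply: is_deriveB; last exact/derivableP.
    by apply: is_derive_translate; exact/derivableP.
  have [s sh E] := @mean_value_line R d phi x (e a) h (fun s _ => @ex_derive _ _ _ _ _ _ _ (dphi _)).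
  have [r rh E'] := @mean_value_line R d ('D_(e a) f) (x + s *: e a) (e b) h (fun s _ => dab _).
  exists (x + s *: e a + r *: e b); last first.
    by rewrite -/(phi (x + h *: e a)) -/(phi x) E (@derive_val _ _ _ _ _ _ _ (dphi _)) E' mulrA.
  rewrite -(addrA x) addrAC subrr add0r (le_trans (ler_normD _ _))// !normrZ mulr2n mulrDl mul1r.
  by apply: lerD; rewrite -[leRHS]mulr1 ler_pM ?norm_delta_mx.
pose t n : R := n.+1%:R^-1.
have t0 : (fun n => 2 * `|t n|) @ \oo --> 0.
  rewrite -(mulr0 2); apply: cvgMr; rewrite -(normr0 R); apply: cvg_norm.
  exact: cvg_harmonic.
have Y n := second_difference j k (t n) dj djk.
have Z n := second_difference k j (t n) dk dkj.
have [y /all_and2[yx yE]] := choice (fun n => ex2_and (Y n)).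
have [z /all_and2[zx zE]] := choice (fun n => ex2_and (Z n)).
have {}yx : y n @[n --> \oo] --> x := cvg_norm_sub0 yx t0.
have {}zx : z n @[n --> \oo] --> x := cvg_norm_sub0 zx t0.
have yz n : 'D_(e k) ('D_(e j) f) (y n) = 'D_(e j) ('D_(e k) f) (z n).
  have tt : t n * t n != 0 by rewrite mulf_neq0// invr_eq0 pnatr_eq0.
  apply: (mulfI tt); rewrite -(yE n) -(zE n) (addrAC x).
  move: (f (_ + _ + _)) (f (x + t n *: e j)) (f (x + t n *: e k)) (f x) => a b c g.
  by ring.
have Ly : 'D_(e k) ('D_(e j) f) (y n) @[n --> \oo] --> 'D_(e k) ('D_(e j) f) x.
  exact: (@cvg_comp _ _ _ y ('D_(e k) ('D_(e j) f)) _ (nbhs x) _ yx (cjk x)).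
have Lz : 'D_(e j) ('D_(e k) f) (z n) @[n --> \oo] --> 'D_(e j) ('D_(e k) f) x.
  exact: (@cvg_comp _ _ _ z ('D_(e j) ('D_(e k) f)) _ (nbhs x) _ zx (ckj x)).
move: Lz; rewrite (_ : (fun _ => _) = (fun n => 'D_(e k) ('D_(e j) f) (y n))); last first.
  by apply/funext => n; rewrite yz.
exact: cvg_unique Ly.
Qed.

End directional_calculus.

Section smooth_spinors.
Context {R : realType} {d N : nat}.
Local Notation spinor := ('rV[R]_d -> 'cV[R[i]]_N).
Local Notation e j := (delta_mx 0 j : 'rV[R]_d).
Local Notation mu := (lebesgue_rV R d).
Implicit Types (F G u v phi : spinor) (x : 'rV[R]_d) (j : 'I_d).

Lemma re_entry_pderiv F j a b : re_entry (pderiv j F) a b = 'D_(e j) (re_entry F a b).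
Proof. by apply/funext => x; rewrite /re_entry mxE. Qed.

Lemma im_entry_pderiv F j a b : im_entry (pderiv j F) a b = 'D_(e j) (im_entry F a b).
Proof. by apply/funext => x; rewrite /im_entry mxE. Qed.

Lemma smooth_foldr F s : smooth_on setT F -> smooth_on setT (foldr (@pderiv R d N 1) F s).
Proof. by move=> sF s' x a b _; rewrite -foldr_cat; exact: sF. Qed.

Lemma smooth_pderiv F j : smooth_on setT F -> smooth_on setT (pderiv j F).
Proof. exact: (@smooth_foldr F [:: j]). Qed.

Lemma smooth_continuous F : smooth_on setT F -> forall k,
  continuous (re_entry F k 0) /\ continuous (im_entry F k 0).
Proof. by move=> sF k; split=> x; have [] := sF [::] x k 0 I. Qed.

Lemma smooth_derivable F : smooth_on setT F -> forall k x j,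
  derivable (re_entry F k 0) x (e j) /\ derivable (im_entry F k 0) x (e j).
Proof. by move=> sF k x j; have [_ _] := sF [::] x k 0 I; exact. Qed.

Lemma is_derive_sum (T : Type) (r : seq T) (f : T -> 'rV[R]_d -> R) (df : T -> R) x w :
  (forall i, is_derive x w (f i) (df i)) ->
  is_derive x w (fun y => \sum_(i <- r) f i y) (\sum_(i <- r) df i).
Proof.
move=> H; elim: r => [|i r ih].
  rewrite big_nil (_ : (fun _ => _) = cst 0); first exact: is_derive_cst.
  by apply/funext => y; rewrite big_nil.
rewrite big_cons (_ : (fun _ => _) = f i + (fun y => \sum_(j <- r) f j y)); first exact: is_deriveD.
by apply/funext => y; rewrite big_cons.
Qed.

Lemma is_derive_mul (f g : 'rV[R]_d -> R) (df dg : R) x w :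
  is_derive x w f df -> is_derive x w g dg ->
  is_derive x w (fun y => f y * g y) (df * g x + f x * dg).
Proof.
move=> Df Dg; apply: (@is_derive_eq _ _ _ _ _ _ _ _ (is_deriveM Df Dg)).
by rewrite addrC [g x *: _]mulrC.
Qed.

Lemma pderivE F j x k : (forall k, derivable (re_entry F k 0) x (e j) /\ derivable (im_entry F k 0) x (e j)) ->
  is_derive x (e j) (re_entry F k 0) (complex.Re (pderiv j F x k 0)) /\
  is_derive x (e j) (im_entry F k 0) (complex.Im (pderiv j F x k 0)).
Proof. by move=> H; have [? ?] := H k; rewrite !mxE /=; split; exact/derivableP. Qed.

(** The single combination from which the rules for differences, scalar multiples and constant
    matrices are all derived. *)
Lemma pderiv_comb (A : 'M[R[i]]_N) F G j : smooth_on setT F -> smooth_on setT G ->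
  pderiv j (fun x => A *m F x + G x) = (fun x => A *m pderiv j F x + pderiv j G x).
Proof.
move=> sF sG; apply/funext => x; apply/matrixP => a b; rewrite (ord1 b).
have dF k := @pderivE F j x k (fun k => smooth_derivable sF k x j).
have dG k := @pderivE G j x k (fun k => smooth_derivable sG k x j).
have [Ga Ga'] := dG a.
have Dre : is_derive x (e j) (re_entry (fun x => A *m F x + G x) a 0)
    (complex.Re ((A *m pderiv j F x + pderiv j G x) a 0)).
  rewrite !mxE cReD cRe_sum.
  have -> : re_entry (fun x => A *m F x + G x) a 0 =
      (fun y => \sum_k (complex.Re (A a k) * re_entry F k 0 y - complex.Im (A a k) * im_entry F k 0 y)) + re_entry G a 0.
    apply/funext => y; rewrite /re_entry !mxE cReD cRe_sum; congr (_ + _).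
    by apply: eq_bigr => k _; rewrite cReM.
  apply: is_deriveD => //.
  apply: (@is_derive_sum _ _ (fun k y => complex.Re (A a k) * re_entry F k 0 y - complex.Im (A a k) * im_entry F k 0 y)) => k.
  rewrite cReM.
  have [Fk Fk'] := dF k.
  by apply: is_deriveB; apply: is_deriveZ.
have Dim : is_derive x (e j) (im_entry (fun x => A *m F x + G x) a 0)
    (complex.Im ((A *m pderiv j F x + pderiv j G x) a 0)).
  rewrite !mxE cImD cIm_sum.
  have -> : im_entry (fun x => A *m F x + G x) a 0 =
      (fun y => \sum_k (complex.Re (A a k) * im_entry F k 0 y + complex.Im (A a k) * re_entry F k 0 y)) + im_entry G a 0.
    apply/funext => y; rewrite /im_entry !mxE cImD cIm_sum; congr (_ + _).
    by apply: eq_bigr => k _; rewrite cImM.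
  apply: is_deriveD => //.
  apply: (@is_derive_sum _ _ (fun k y => complex.Re (A a k) * im_entry F k 0 y + complex.Im (A a k) * re_entry F k 0 y)) => k.
  rewrite cImM.
  have [Fk Fk'] := dF k.
  by apply: is_deriveD; apply: is_deriveZ.
rewrite [LHS]mxE (@derive_val _ _ _ _ _ _ _ Dre) (@derive_val _ _ _ _ _ _ _ Dim).
by case: (_ a 0).
Qed.

Lemma foldr_pderiv_comb (A : 'M[R[i]]_N) F G s : smooth_on setT F -> smooth_on setT G ->
  foldr (@pderiv R d N 1) (fun x => A *m F x + G x) s =
  (fun x => A *m foldr (@pderiv R d N 1) F s x + foldr (@pderiv R d N 1) G s x).
Proof.
move=> sF sG; elim: s => //= j s ->.
by apply: pderiv_comb; exact: smooth_foldr.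
Qed.

Lemma continuous_sum (T : Type) (r : seq T) (f : T -> 'rV[R]_d -> R) :
  (forall i, continuous (f i)) -> continuous (fun y => \sum_(i <- r) f i y).
Proof.
move=> cf; elim: r => [|i r ih].
  rewrite (_ : (fun _ => _) = cst 0); first exact: cst_continuous.
  by apply/funext => y; rewrite big_nil.
rewrite (_ : (fun _ => _) = f i + (fun y => \sum_(j <- r) f j y)).
  by move=> x; apply: continuousD; [exact: cf | exact: ih].
by apply/funext => y; rewrite big_cons.
Qed.

Lemma continuous_addf (f g : 'rV[R]_d -> R) :
  continuous f -> continuous g -> continuous (fun y => f y + g y).
Proof. by move=> cf cg x; have := continuousD (cf x) (cg x). Qed.

Lemma continuous_subf (f g : 'rV[R]_d -> R) :
  continuous f -> continuous g -> continuous (fun y => f y - g y).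
Proof. by move=> cf cg x; have := continuousB (cf x) (cg x). Qed.

Lemma continuous_mulf (f g : 'rV[R]_d -> R) :
  continuous f -> continuous g -> continuous (fun y => f y * g y).
Proof. by move=> cf cg x; have := continuousM (cf x) (cg x). Qed.

Lemma continuous_mulr (c : R) (f : 'rV[R]_d -> R) :
  continuous f -> continuous (fun y => c * f y).
Proof.
move=> cf x; apply: (@continuousM _ _ (cst c) f); [exact: cst_continuous | exact: cf].
Qed.

Lemma smooth_comb (A : 'M[R[i]]_N) F G : smooth_on setT F -> smooth_on setT G ->
  smooth_on setT (fun x => A *m F x + G x).
Proof.
move=> sF sG s x a b _; rewrite /= foldr_pderiv_comb// (ord1 b).
move: (smooth_foldr s sF) (smooth_foldr s sG) => {sF sG}.
move: (foldr _ F s) (foldr _ G s) => {}F {}G sF sG.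
have cF k := smooth_continuous sF k; have cG k := smooth_continuous sG k.
have dF k j := @pderivE F j x k (fun k => smooth_derivable sF k x j).
have dG k j := @pderivE G j x k (fun k => smooth_derivable sG k x j).
have reE : re_entry (fun x => A *m F x + G x) a 0 =
    (fun y => \sum_k (complex.Re (A a k) * re_entry F k 0 y - complex.Im (A a k) * im_entry F k 0 y)) + re_entry G a 0.
  apply/funext => y; rewrite /re_entry !mxE cReD cRe_sum; congr (_ + _).
  by apply: eq_bigr => k _; rewrite cReM.
have imE : im_entry (fun x => A *m F x + G x) a 0 =
    (fun y => \sum_k (complex.Re (A a k) * im_entry F k 0 y + complex.Im (A a k) * re_entry F k 0 y)) + im_entry G a 0.
  apply/funext => y; rewrite /im_entry !mxE cImD cIm_sum; congr (_ + _).
  by apply: eq_bigr => k _; rewrite cImM.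
rewrite reE imE; split.
- apply: continuousD; last by have [+ _] := cG a; exact.
  apply: (@continuous_sum _ _ (fun k y => _ * re_entry F k 0 y - _ * im_entry F k 0 y)) => k y.
  by have [c1 c2] := cF k; apply: continuous_subf; exact: continuous_mulr.
- apply: continuousD; last by have [_ +] := cG a; exact.
  apply: (@continuous_sum _ _ (fun k y => _ * im_entry F k 0 y + _ * re_entry F k 0 y)) => k y.
  by have [c1 c2] := cF k; apply: continuous_addf; exact: continuous_mulr.
- move=> j; have [Ga Ga'] := dG a j; split.
    apply: derivableD; last by case: Ga.
    apply: ex_derive; apply: (@is_derive_sum _ _ (fun k y => _ * re_entry F k 0 y - _ * im_entry F k 0 y)) => k.
    by have [Fk Fk'] := dF k j; apply: is_deriveB; apply: is_deriveZ.
  apply: derivableD; last by case: Ga'.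
  apply: ex_derive; apply: (@is_derive_sum _ _ (fun k y => _ * im_entry F k 0 y + _ * re_entry F k 0 y)) => k.
  by have [Fk Fk'] := dF k j; apply: is_deriveD; apply: is_deriveZ.
Qed.

End smooth_spinors.

Section test_functions.
Context {R : realType} {d N : nat}.
Local Notation spinor := ('rV[R]_d -> 'cV[R[i]]_N).
Local Notation e j := (delta_mx 0 j : 'rV[R]_d).
Local Notation mu := (lebesgue_rV R d).
Local Notation ip := (ip mu).
Local Notation sqint := (sqint mu).
Implicit Types (F G u v phi chi : spinor) (x : 'rV[R]_d) (j : 'I_d).

Lemma continuous_rdot u v : smooth_on setT u -> smooth_on setT v ->
  continuous (fun x => rdot (u x) (v x)).
Proof.
move=> su sv; apply: (@continuous_sum _ _ _ _ (fun k x =>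
  re_entry u k 0 x * re_entry v k 0 x + im_entry u k 0 x * im_entry v k 0 x)) => k.
have [? ?] := smooth_continuous su k; have [? ?] := smooth_continuous sv k.
by apply: continuous_addf; exact: continuous_mulf.
Qed.

Lemma is_derive_rdot u v x j : smooth_on setT u -> smooth_on setT v ->
  is_derive x (e j) (fun y => rdot (u y) (v y)) (rdot (pderiv j u x) (v x) + rdot (u x) (pderiv j v x)).
Proof.
move=> su sv.
rewrite (_ : _ + _ = \sum_k ((complex.Re (pderiv j u x k 0) * re_entry v k 0 x +
     re_entry u k 0 x * complex.Re (pderiv j v x k 0)) +
   (complex.Im (pderiv j u x k 0) * im_entry v k 0 x +
     im_entry u k 0 x * complex.Im (pderiv j v x k 0)))); last first.
  by rewrite /rdot -big_split; apply: eq_bigr => k _; rewrite /re_entry /im_entry /=; ring.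
apply: (@is_derive_sum _ _ _ _ (fun k x =>
  re_entry u k 0 x * re_entry v k 0 x + im_entry u k 0 x * im_entry v k 0 x)) => k.
have [? ?] := pderivE k (fun k => smooth_derivable su k x j).
have [? ?] := pderivE k (fun k => smooth_derivable sv k x j).
by apply: is_deriveD; exact: is_derive_mul.
Qed.

Lemma test_smooth phi : test_functions phi -> smooth_on setT phi. Proof. by case. Qed.

Lemma test_support phi : test_functions phi -> exists M : R, forall x, M < `|x| -> phi x = 0.
Proof.
case=> _ /compact_bounded[M [_ HM]]; exists (`|M| + 1) => x Mx.
apply: contrapT => px0; move: Mx; apply/negP; rewrite -leNgt.
apply: HM; first by rewrite ltr_pwDr// ler_norm.
exact: subset_closure.
Qed.

Lemma test_intro phi (M : R) : smooth_on setT phi ->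
  (forall x, M < `|x| -> phi x = 0) -> test_functions phi.
Proof.
move=> sphi phi0; split => //.
apply: (@subclosed_compact _ _ [set x : 'rV[R]_d | `|x| <= M]).
- exact: closed_closure.
- exact: compact_norm_ball.
have -> : [set x : 'rV[R]_d | `|x| <= M] = closure [set x : 'rV[R]_d | `|x| <= M].
  apply/closure_id; apply: (compact_closed (@norm_hausdorff _ _)); exact: compact_norm_ball.
apply: closureS => x /= px0; rewrite leNgt; apply/negP => /phi0; exact: px0.
Qed.

Lemma test_comb (A : 'M[R[i]]_N) phi chi : test_functions phi -> test_functions chi ->
  test_functions (fun x => A *m phi x + chi x).
Proof.
move=> tp tc; have [M HM] := test_support tp; have [L HL] := test_support tc.
apply: (@test_intro _ (Num.max M L)); first by apply: smooth_comb; exact: test_smooth.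
by move=> x; rewrite gt_max => /andP[/HM -> /HL ->]; rewrite mulmx0 addr0.
Qed.

Lemma re_entry_cst0 a b : re_entry (fun=> 0 : 'cV[R[i]]_N) a b = cst 0 :> ('rV[R]_d -> R).
Proof. by apply/funext => y; rewrite /re_entry mxE. Qed.

Lemma im_entry_cst0 a b : im_entry (fun=> 0 : 'cV[R[i]]_N) a b = cst 0 :> ('rV[R]_d -> R).
Proof. by apply/funext => y; rewrite /im_entry mxE. Qed.

Lemma pderiv_cst0 j : pderiv j ((fun=> 0) : spinor) = (fun=> 0).
Proof.
apply/funext => x; apply/matrixP => a b.
by rewrite !mxE re_entry_cst0 im_entry_cst0 !derive_cst.
Qed.

Lemma test0 : test_functions ((fun=> 0) : spinor).
Proof.
apply: (@test_intro _ 0) => // s x a b _.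
have -> : foldr (@pderiv R d N 1) (fun=> 0) s = (fun=> 0).
  by elim: s => //= j s ->; exact: pderiv_cst0.
rewrite /= re_entry_cst0 im_entry_cst0.
by split; [exact: cst_continuous | exact: cst_continuous |
  move=> j; split; exact: derivable_cst].
Qed.

Lemma test_mulmx (A : 'M[R[i]]_N) phi : test_functions phi ->
  test_functions (fun x => A *m phi x).
Proof.
by move=> tp; have := test_comb A tp test0; under eq_fun do rewrite addr0.
Qed.

Lemma test_scale (c : R[i]) phi : test_functions phi -> test_functions (fun x => c *: phi x).
Proof. by move=> /(test_mulmx c%:M); under eq_fun do rewrite mul_scalar_mx. Qed.

Lemma test_sub phi chi : test_functions phi -> test_functions chi -> test_functions (phi \- chi).
Proof.
move=> tp tc; have := test_comb (-1)%:M tc tp.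
by under eq_fun do rewrite mul_scalar_mx scaleN1r addrC.
Qed.

Lemma pderiv_mulmx (A : 'M[R[i]]_N) F j : smooth_on setT F ->
  pderiv j (fun x => A *m F x) = (fun x => A *m pderiv j F x).
Proof.
move=> sF; have := pderiv_comb A j sF (test_smooth test0); rewrite pderiv_cst0.
by under eq_fun do rewrite addr0; under [X in _ = X -> _]eq_fun do rewrite addr0.
Qed.

Lemma pderiv_scale (c : R[i]) F j : smooth_on setT F ->
  pderiv j (fun x => c *: F x) = (fun x => c *: pderiv j F x).
Proof.
move=> /(pderiv_mulmx c%:M j).
by under eq_fun do rewrite mul_scalar_mx; under [X in _ = X -> _]eq_fun do rewrite mul_scalar_mx.
Qed.

Lemma pderiv_sub F G j : smooth_on setT F -> smooth_on setT G ->
  pderiv j (F \- G) = pderiv j F \- pderiv j G.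
Proof.
move=> sF sG; have := pderiv_comb (-1)%:M j sG sF.
under eq_fun do rewrite mul_scalar_mx scaleN1r addrC.
by under [X in _ = X -> _]eq_fun do rewrite mul_scalar_mx scaleN1r addrC.
Qed.

Lemma derive_support0 (f : 'rV[R]_d -> R) (M : R) x j :
  (forall y, M < `|y| -> f y = 0) -> M < `|x| -> 'D_(e j) f x = 0.
Proof.
move=> f0 Mx; rewrite (@near_eq_derive _ _ _ f (cst 0)) ?derive_cst//.
have /cvgr_gt/(_ _ Mx) : (fun y : 'rV[R]_d => `|y|) @ x --> `|x| by exact: norm_continuous.
by apply: filterS => y; exact: f0.
Qed.

Lemma test_pderiv phi j : test_functions phi -> test_functions (pderiv j phi).
Proof.
move=> tp; have [M HM] := test_support tp.
apply: (@test_intro _ M); first exact/smooth_pderiv/test_smooth.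
move=> x Mx; apply/matrixP => a b; rewrite !mxE.
have -> : 'D_(e j) (re_entry phi a b) x = 0.
  by apply: derive_support0 Mx => y My; rewrite /re_entry HM// mxE.
have -> // : 'D_(e j) (im_entry phi a b) x = 0.
by apply: derive_support0 Mx => y My; rewrite /im_entry HM// mxE.
Qed.

Lemma smooth_measurable F : smooth_on setT F -> measurable_spinor F.
Proof.
by move=> sF k; have [? ?] := smooth_continuous sF k; split; exact: continuous_measurable_rV.
Qed.

Lemma sqint_test phi : test_functions phi -> sqint phi.
Proof.
move=> tp; have sp := test_smooth tp; have mp := smooth_measurable sp.
have [M HM] := test_support tp.
have H0 x : M < `|x| -> rdot (phi x) (phi x) = 0 by move=> /HM ->; rewrite rdot0l.
have [B B0 HB] := bounded_of_support (continuous_rdot sp sp) H0.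
have [g ig Hg] := @integrable_bound R d B M.
apply: integrable_sqint => //; apply: (le_integrable measurableT _ _ ig).
  exact: measurable_sqr_cnorm.
move=> x _ /=; rewrite lee_fin cnorm_sqr (le_trans _ (ler_norm _))//.
by apply: Hg; [exact: HB | exact: H0].
Qed.

Lemma ip_pderiv phi chi j : test_functions phi -> test_functions chi ->
  ip (pderiv j phi) chi = - ip phi (pderiv j chi).
Proof.
move=> tp tc; have sp := test_smooth tp; have sc := test_smooth tc.
have i1 := integrable_rdot (sqint_test (test_pderiv j tp)) (sqint_test tc).
have i2 := integrable_rdot (sqint_test tp) (sqint_test (test_pderiv j tc)).
have E := RintegralD measurableT i1 i2.
suff D0 : (\int[mu]_x (rdot (pderiv j phi x) (chi x) + rdot (phi x) (pderiv j chi x)))%R = 0.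
  by apply/eqP; rewrite -addr_eq0 -[X in _ == X]D0 E.
have [M HM] := test_support tp.
pose h x := rdot (phi x) (chi x).
have dh x : is_derive x (e j) h (rdot (pderiv j phi x) (chi x) + rdot (phi x) (pderiv j chi x)).
  exact: is_derive_rdot.
have Dh : (fun x => 'D_(e j) h x) = (fun x => rdot (pderiv j phi x) (chi x) + rdot (phi x) (pderiv j chi x)).
  by apply/funext => x; rewrite (@derive_val _ _ _ _ _ _ _ (dh x)).
rewrite -Dh; apply: (@Rintegral_derive_eq0 _ _ _ _ M).
- exact: continuous_rdot.
- by move=> x; exact: ex_derive.
- rewrite Dh; exact: (continuous_addf (continuous_rdot (smooth_pderiv j sp) sc)
    (continuous_rdot sp (smooth_pderiv j sc))).
- by move=> x /HM; rewrite /h => ->; rewrite rdot0l.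
Qed.

Lemma derive_comm_eq (f fj fk fjk fkj : 'rV[R]_d -> R) j (k : 'I_d) :
  fj = 'D_(e j) f -> fk = 'D_(e k) f -> fjk = 'D_(e k) fj -> fkj = 'D_(e j) fk ->
  (forall x, derivable f x (e j)) -> (forall x, derivable f x (e k)) ->
  (forall x, derivable fj x (e k)) -> (forall x, derivable fk x (e j)) ->
  continuous fjk -> continuous fkj -> fkj = fjk.
Proof.
move=> -> -> -> -> dj dk djk dkj cjk ckj.
exact: esym (derive_comm dj dk djk dkj cjk ckj).
Qed.

Lemma pderiv_comm phi j (k : 'I_d) : smooth_on setT phi ->
  pderiv j (pderiv k phi) = pderiv k (pderiv j phi).
Proof.
move=> sp.
have d1 := smooth_derivable sp; have d2 i := smooth_derivable (smooth_pderiv i sp).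
have c2 i i' := smooth_continuous (smooth_pderiv i (smooth_pderiv i' sp)).
have re_comm a := @derive_comm_eq (re_entry phi a 0) _ _ _ _ j k
  (re_entry_pderiv _ _ _ _) (re_entry_pderiv _ _ _ _) (re_entry_pderiv _ _ _ _) (re_entry_pderiv _ _ _ _)
  (fun x => (d1 a x j).1) (fun x => (d1 a x k).1) (fun x => (d2 j a x k).1) (fun x => (d2 k a x j).1)
  (c2 k j a).1 (c2 j k a).1.
have im_comm a := @derive_comm_eq (im_entry phi a 0) _ _ _ _ j k
  (im_entry_pderiv _ _ _ _) (im_entry_pderiv _ _ _ _) (im_entry_pderiv _ _ _ _) (im_entry_pderiv _ _ _ _)
  (fun x => (d1 a x j).2) (fun x => (d1 a x k).2) (fun x => (d2 j a x k).2) (fun x => (d2 k a x j).2)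
  (c2 k j a).2 (c2 j k a).2.
apply/funext => x; apply/matrixP => a b; rewrite (ord1 b).
apply/eqP; rewrite eq_complex; apply/andP; split; apply/eqP.
  exact: (congr1 (@^~ x) (re_comm a)).
exact: (congr1 (@^~ x) (im_comm a)).
Qed.

End test_functions.

(** * The kinetic term *)

Section kinetic_term.
Context {R : realType} {d N : nat}.
Local Notation spinor := ('rV[R]_d -> 'cV[R[i]]_N).
Local Notation mu := (lebesgue_rV R d).
Local Notation ip := (ip mu).
Local Notation sqint := (sqint mu).
Variables (alpha : 'I_d -> 'M[R[i]]_N) (beta : 'M[R[i]]_N).
Implicit Types (u v phi chi : spinor) (A : 'M[R[i]]_N).

(** The argument is the gradient and not the function, so that classical and weak gradients are
    treated alike. *)
Definition kinetic (g : 'I_d -> spinor) : spinor :=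
  fun x => - 'i *: (\sum_j alpha j *m g j x).

Lemma rdotNii (v w : 'cV[R[i]]_N) : rdot (- 'i *: v) (- 'i *: w) = rdot v w.
Proof. by rewrite !scaleNr rdotNl rdotNr opprK rdotii. Qed.

Lemma rdot_iherm A (v w : 'cV[R[i]]_N) : A \is hermsymmx ->
  rdot (- 'i *: (A *m v)) w = - rdot v (- 'i *: (A *m w)).
Proof.
by move=> hA; rewrite !scaleNr rdotNl rdotNr rdotil rdot_herm// -scalemxAr.
Qed.

Lemma ip_herm A u v : A \is hermsymmx ->
  ip (fun x => A *m u x) v = ip u (fun x => A *m v x).
Proof. by move=> hA; apply: eq_Rintegral => x _; rewrite rdot_herm. Qed.

Hypothesis dm : dirac_matrices alpha beta.

Lemma alpha_herm j : alpha j \is hermsymmx. Proof. by case: dm. Qed.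
Lemma beta_herm : beta \is hermsymmx. Proof. by case: dm => _ []. Qed.

Lemma alphaC j k : j != k -> alpha j *m alpha k = - (alpha k *m alpha j).
Proof.
case: dm => _ [_ [aa _]] jk; have := aa j k; rewrite (negbTE jk) mulr0 raddf0.
by move/eqP; rewrite addr_eq0 => /eqP.
Qed.

Lemma alpha_sqr j : alpha j *m alpha j = 1%:M.
Proof.
case: dm => _ [_ [aa _]]; have := aa j j; rewrite eqxx mulr1 /anticommutator => E.
have {}E : (2 : R[i]) *: (alpha j *m alpha j) = 2 *: 1%:M.
  by rewrite scalemx1 -E -[2]/(1 + 1) scalerDl !scale1r.
by apply: (scalerI _ E); rewrite pnatr_eq0.
Qed.

Lemma beta_sqr : beta *m beta = 1%:M. Proof. by case: dm => _ [_ [_ []]]. Qed.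

Lemma alpha_betaC j : alpha j *m beta = - (beta *m alpha j).
Proof.
by case: dm => _ [_ [_ [ab _]]]; have := ab j => /eqP; rewrite addr_eq0 => /eqP.
Qed.

Lemma ip_sumr I (r : seq I) (f : I -> spinor) v :
  (forall i, sqint (f i)) -> sqint v ->
  ip v (fun x => \sum_(i <- r) f i x) = \sum_(i <- r) ip v (f i).
Proof. by move=> sf sv; rewrite ipC ip_suml//; apply: eq_bigr => i _; rewrite ipC. Qed.

(** Partial derivatives commute while alpha_j and alpha_k anticommute: exchanging them by two
    integrations by parts turns the product into its own opposite. *)
Lemma ip_alpha_pderiv phi j k : test_functions phi -> j != k ->
  ip (fun x => alpha j *m pderiv j phi x) (fun x => alpha k *m pderiv k phi x) = 0.
Proof.
move=> tp jk.
set a := ip _ _; suff : a = - a by lra.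
have tB : test_functions (fun x => alpha k *m (alpha j *m phi x)).
  by apply: test_mulmx; exact: test_mulmx.
have DB i : pderiv i (fun x => alpha k *m (alpha j *m phi x)) =
    (fun x => alpha k *m (alpha j *m pderiv i phi x)).
  rewrite (pderiv_mulmx (alpha k) i (test_smooth (test_mulmx (alpha j) tp))).
  by rewrite (pderiv_mulmx (alpha j) i (test_smooth tp)).
transitivity (ip (pderiv j (fun x => alpha k *m (alpha j *m phi x))) (pderiv k phi)).
  by rewrite /a -(ip_herm _ _ (alpha_herm k)) DB.
rewrite (ip_pderiv j tB (test_pderiv k tp)) (pderiv_comm j k (test_smooth tp)).
rewrite -(ip_pderiv k tB (test_pderiv j tp)) DB.
have -> : (fun x => alpha k *m (alpha j *m pderiv k phi x)) =
    (fun x => -1 *: (alpha j *m (alpha k *m pderiv k phi x))).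
  by apply/funext => x; rewrite !mulmxA alphaC 1?eq_sym// mulNmx scaleN1r.
have -> : -1 = (-1)%:C :> R[i] by rewrite rmorphN rmorph1.
have s1 : sqint (fun x => alpha k *m pderiv k phi x) by apply: sqint_test; apply: test_mulmx; exact: test_pderiv.
rewrite ipZl; [|exact: sqintM|by apply: sqint_test; exact: test_pderiv].
by rewrite mulN1r (ip_herm _ _ (alpha_herm j)) ipC.
Qed.

Lemma kinetic_test_norm phi : test_functions phi ->
  ip (kinetic (fun j => pderiv j phi)) (kinetic (fun j => pderiv j phi)) =
  \sum_j ip (pderiv j phi) (pderiv j phi).
Proof.
move=> tp; have s j : sqint (fun x => alpha j *m pderiv j phi x).
  by apply: sqint_test; apply: test_mulmx; exact: test_pderiv.
transitivity (ip (fun x => \sum_j alpha j *m pderiv j phi x) (fun x => \sum_j alpha j *m pderiv j phi x)).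
  by apply: eq_Rintegral => x _; rewrite /kinetic rdotNii.
rewrite ip_suml//; last exact: sqint_sum.
apply: eq_bigr => j _; rewrite ip_sumr// (bigD1 j)//= big1 ?addr0 => [|k kj].
  rewrite -(ip_herm _ _ (alpha_herm j)).
  by under [X in ip X _]eq_fun do rewrite mulmxA alpha_sqr mul1mx.
by apply: ip_alpha_pderiv => //; rewrite eq_sym.
Qed.

(** Each -i alpha_j d_j is symmetric and anticommutes with beta, so every summand equals its
    opposite. *)
Lemma ip_beta_kinetic_test phi : test_functions phi ->
  ip (fun x => beta *m phi x) (kinetic (fun j => pderiv j phi)) = 0.
Proof.
move=> tp; have tb : test_functions (fun x => beta *m phi x) by exact: test_mulmx.
pose C j u : spinor := fun x => - 'i *: (alpha j *m u x).
have tC j u : test_functions u -> test_functions (C j u).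
  by move=> tu; apply: test_scale; exact: test_mulmx.
have -> : kinetic (fun j => pderiv j phi) = (fun x => \sum_j C j (pderiv j phi) x).
  by apply/funext => x; rewrite /kinetic scaler_sumr.
rewrite ip_sumr; [|by move=> j; apply/sqint_test/tC/test_pderiv|exact: sqint_test].
rewrite big1// => j _; set b := ip _ _; suff : b = - b by lra.
have C_anti u v : test_functions u -> test_functions v -> ip u (C j v) = - ip (C j u) v.
  move=> tu tv; have -> : ip (C j u) v = ip (fun x => (-1)%:C *: u x) (C j v).
    by apply: eq_Rintegral => x _; rewrite /C rdot_iherm ?alpha_herm// rdotZl mulN1r.
  by rewrite ipZl ?mulN1r ?opprK//; apply: sqint_test => //; exact: tC.
rewrite {1}/b C_anti//; last exact: test_pderiv.
have -> : C j (fun x => beta *m phi x) = (fun x => (- 'i *: (alpha j *m beta)) *m phi x).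
  by apply/funext => x; rewrite /C -scalemxAl mulmxA.
rewrite ipC (ip_pderiv j tp (test_mulmx _ tp)) opprK (pderiv_mulmx _ j (test_smooth tp)).
have -> : (fun x => (- 'i *: (alpha j *m beta)) *m pderiv j phi x) =
    (fun x => (-1)%:C *: (beta *m C j (pderiv j phi) x)).
  apply/funext => x; rewrite /C alpha_betaC scalerN mulNmx -scalemxAl -mulmxA -scalemxAr.
  by rewrite rmorphN rmorph1 scaleN1r.
have s1 : sqint (C j (pderiv j phi)) by apply: sqint_test; apply: tC; exact: test_pderiv.
rewrite ipZr; [|exact: sqintM|exact: sqint_test].
by rewrite mulN1r -(ip_herm _ _ beta_herm).
Qed.

End kinetic_term.

(** * Hardy's inequality *)

Section hardy.
Context {R : realType} {d N : nat}.
Local Notation spinor := ('rV[R]_d -> 'cV[R[i]]_N).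
Local Notation e j := (delta_mx 0 j : 'rV[R]_d).
Local Notation mu := (lebesgue_rV R d).
Local Notation ip := (ip mu).
Local Notation sqint := (sqint mu).
Implicit Types (phi : spinor) (x v : 'rV[R]_d) (j : 'I_d).

Lemma enorm_sqr x : enorm x ^+ 2 = \sum_i x 0 i ^+ 2.
Proof. by rewrite sqr_sqrtr// sumr_ge0// => i _; rewrite sqr_ge0. Qed.

Lemma enorm_ge0 x : 0 <= enorm x. Proof. exact: sqrtr_ge0. Qed.

Lemma continuous_coord (i : 'I_d) : continuous (fun x : 'rV[R]_d => x 0 i).
Proof. by move=> x; exact: coord_continuous. Qed.

Lemma is_derive_coord x v (i : 'I_d) : is_derive x v (fun y : 'rV[R]_d => y 0 i) (v 0 i).
Proof.
have L : (fun h : R => h^-1 *: (((fun y : 'rV[R]_d => y 0 i) \o shift x) (h *: v) - x 0 i)) @ 0^' --> v 0 i.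
  apply: cvg_near_cst; near=> h; have h0 : h != 0 by near: h; exact: nbhs_dnbhs_neq.
  by rewrite /= /shift /= !mxE addrK scalerA mulVf// scale1r.
by split; [apply/cvg_ex; exists (v 0 i) | exact: cvg_lim].
Unshelve. all: by end_near. Qed.

Lemma continuous_enorm_sqr : continuous (fun x : 'rV[R]_d => enorm x ^+ 2).
Proof.
rewrite (_ : (fun _ => _) = (fun x => \sum_i x 0 i * x 0 i)).
  apply: (@continuous_sum _ _ _ _ (fun i x => x 0 i * x 0 i)) => i.
  by apply: continuous_mulf; exact: continuous_coord.
by apply/funext => x; rewrite enorm_sqr.
Qed.

Lemma is_derive_enorm_sqr x v : is_derive x v (fun y : 'rV[R]_d => enorm y ^+ 2) (2 * \sum_i v 0 i * x 0 i).
Proof.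
rewrite (_ : (fun _ => _) = (fun x => \sum_i x 0 i * x 0 i)); last first.
  by apply/funext => y; rewrite enorm_sqr.
rewrite mulr_sumr (eq_bigr (fun i => v 0 i * x 0 i + x 0 i * v 0 i)); last first.
  by move=> i _; ring.
apply: (@is_derive_sum _ _ _ _ (fun i x => x 0 i * x 0 i)) => i.
by apply: is_derive_mul; exact: is_derive_coord.
Qed.

Definition hardy_weight (eps : R) x : R := (enorm x ^+ 2 + eps)^-1.

Section regularized_weight.
Variable eps : R.
Hypothesis eps0 : 0 < eps.
Local Notation w := (hardy_weight eps).

Lemma hardy_weight_neq0 x : enorm x ^+ 2 + eps != 0.
Proof. by rewrite gt_eqF// ltr_wpDl// sqr_ge0. Qed.

Lemma hardy_weight_gt0 x : 0 < w x.
Proof. by rewrite invr_gt0 ltr_wpDl// sqr_ge0. Qed.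

Lemma hardy_weight_le x : w x <= eps^-1.
Proof. by rewrite lef_pV2 ?posrE// ?ltr_wpDl ?sqr_ge0// lerDr sqr_ge0. Qed.

Lemma continuous_hardy_weight : continuous w.
Proof.
move=> x; apply: (@continuousV _ _ (fun y => enorm y ^+ 2 + eps)).
  exact: hardy_weight_neq0.
apply: continuous_addf; first exact: continuous_enorm_sqr.
exact: cst_continuous.
Qed.

Lemma is_derive_hardy_weight x v :
  is_derive x v w (- (w x) ^+ 2 * (2 * \sum_i v 0 i * x 0 i)).
Proof.
have H : is_derive x v (fun y : 'rV[R]_d => enorm y ^+ 2 + eps) (2 * \sum_i v 0 i * x 0 i + 0).
  by apply: is_deriveD; exact: is_derive_enorm_sqr.
case: H => H HE; split.
  by apply: (@derivableV _ _ (fun y : 'rV[R]_d => enorm y ^+ 2 + eps)) => //; exact: hardy_weight_neq0.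
have := @deriveV _ _ (fun y : 'rV[R]_d => enorm y ^+ 2 + eps) x v (hardy_weight_neq0 x) H.
by rewrite HE addr0 => E; rewrite [LHS]E /GRing.scale /= /hardy_weight exprVn.
Qed.

End regularized_weight.

Lemma integrable_continuous_support (f : 'rV[R]_d -> R) (M : R) :
  continuous f -> (forall x, M < `|x| -> f x = 0) -> mu.-integrable setT (EFin \o f).
Proof.
move=> cf f0; have [B B0 fB] := bounded_of_support cf f0.
have [g ig fg] := @integrable_bound R d B M.
apply: (le_integrable measurableT _ _ ig).
  by apply/measurable_EFinP; exact: continuous_measurable_rV.
move=> x _ /=; rewrite lee_fin (le_trans (fg _ x (fB x) _)) ?ler_norm//.
exact: f0.
Qed.

Lemma integrable_sum_fin (f : 'I_d -> 'rV[R]_d -> R) (r : seq 'I_d) :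
  (forall i, mu.-integrable setT (EFin \o f i)) ->
  mu.-integrable setT (EFin \o (fun x => \sum_(i <- r) f i x)) /\
  (\int[mu]_x (\sum_(i <- r) f i x))%R = \sum_(i <- r) (\int[mu]_x f i x)%R.
Proof.
move=> If; elim: r => [|i r [I1 E]].
  rewrite big_nil (_ : (fun _ => _) = cst 0); last by apply/funext => x; rewrite big_nil.
  split; first exact: integrable0.
  by rewrite Rintegral_cst// mul0r.
rewrite big_cons (_ : (fun _ => _) = (fun x => f i x + \sum_(j <- r) f j x)); last first.
  by apply/funext => x; rewrite big_cons.
split; first exact: (integrableD measurableT (If i) I1).
by rewrite (RintegralD measurableT (If i) I1) E.
Qed.

(* The divergence of x w |phi|^2 integrates to zero, and completing the square bounds the cross
   term; the weight w = 1/(|x|^2 + eps) avoids the singularity at the origin. *)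
Lemma hardy_test phi (eps : R) : (2 < d)%N -> 0 < eps -> test_functions phi ->
  ip (fun x => (hardy_weight eps x)%:C *: phi x) phi <=
  (2 / (d%:R - 2)) ^+ 2 * \sum_j ip (pderiv j phi) (pderiv j phi).
Proof.
move=> d2 eps0 tp; have sp := test_smooth tp; have [M HM] := test_support tp.
set w := hardy_weight eps; pose r x := rdot (phi x) (phi x).
pose q j x := ((1 * w x + x 0 j * (- (w x) ^+ 2 * (2 * x 0 j))) * r x +
  x 0 j * w x * (rdot (pderiv j phi x) (phi x) + rdot (phi x) (pderiv j phi x))).
have dq j x : is_derive x (e j) (fun y : 'rV[R]_d => y 0 j * w y * r y) (q j x).
  apply: is_derive_mul; last exact: is_derive_rdot.
  apply: is_derive_mul.
    by have := is_derive_coord x (e j) j; rewrite mxE !eqxx.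
  have := is_derive_hardy_weight eps0 x (e j).
  rewrite (bigD1 j)//= big1 ?addr0 => [|i ij]; last by rewrite mxE (negbTE ij) mul0r.
  by rewrite mxE !eqxx mul1r.
have cw := continuous_hardy_weight eps0.
have cr := continuous_rdot sp sp.
have cpr j := continuous_rdot (smooth_pderiv j sp) sp.
have crp j := continuous_rdot sp (smooth_pderiv j sp).
have cq j : continuous (q j).
  have cj := @continuous_coord j.
  apply: continuous_addf; apply: continuous_mulf => //.
  - apply: continuous_addf; first by apply: continuous_mulr.
    apply: continuous_mulf => //; apply: continuous_mulf; last exact: continuous_mulr.
    rewrite (_ : (fun _ => _) = (fun y => -1 * (w y * w y))); last first.
      by apply/funext => y; rewrite mulN1r expr2.
    by apply: continuous_mulr; exact: continuous_mulf.
  - exact: continuous_mulf.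
  - exact: continuous_addf.
have q0 j x : M < `|x| -> q j x = 0.
  by move=> Mx; rewrite /q /r HM// !rdot0l !rdot0r addr0 !mulr0 addr0.
have Dq j : (fun x => 'D_(e j) (fun y : 'rV[R]_d => y 0 j * w y * r y) x) = q j.
  by apply/funext => x; rewrite (@derive_val _ _ _ _ _ _ _ (dq j x)).
have Iq j : (\int[mu]_x q j x)%R = 0.
  have ch : continuous (fun y : 'rV[R]_d => y 0 j * w y * r y).
    by apply: continuous_mulf => //; apply: continuous_mulf => //; exact: continuous_coord.
  have h0 x : M < `|x| -> x 0 j * w x * r x = 0 by move=> Mx; rewrite /r HM// rdot0l mulr0.
  have cDh : continuous (fun x => 'D_(e j) (fun y : 'rV[R]_d => y 0 j * w y * r y) x).
    by rewrite Dq.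
  by have := Rintegral_derive_eq0 ch (fun x => let: DeriveDef H _ := dq j x in H) cDh h0; rewrite Dq.
have [IQ Q0] := integrable_sum_fin (index_enum 'I_d) (fun j => integrable_continuous_support (cq j) (q0 j)).
have {}Q0 : (\int[mu]_x (\sum_j q j x))%R = 0 by rewrite Q0 big1.
have sphi := sqint_test tp.
have swphi : sqint (fun x => (w x)%:C *: phi x).
  apply: (@sqint_le _ _ _ _ _ eps^-1 _ phi) => //.
    apply: measurable_spinorZf; last exact: smooth_measurable.
    exact: continuous_measurable_rV.
  move=> x; rewrite cnormZ ger0_norm; last by rewrite ltW// hardy_weight_gt0.
  by rewrite ler_wpM2r ?cnorm_ge0// hardy_weight_le.
have sD j : sqint (pderiv j phi) by apply: sqint_test; exact: test_pderiv.
have [IG G0] := integrable_sum_fin (index_enum 'I_d) (fun j => integrable_rdot (sD j) (sD j)).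
have IW := integrable_rdot swphi sphi.
have d20 : 0 < d%:R - 2 :> R by rewrite subr_gt0 ltr_nat.
(* Since |x|^2 w <= 1, the divergence is at least (d - 2 - k) w |phi|^2 - |grad phi|^2 / k for any k
   > 0. The product k (d - 2 - k) is largest when k = d - 2 - k, which yields the constant
   2/(d-2). *)
pose k : R := (d%:R - 2) / 2; have k0 : 0 < k by rewrite divr_gt0.
have kIW := integrableZl measurableT k IW; have kIG := integrableZl measurableT (k^-1) IG.
have kW := RintegralZl k measurableT IW; have kG := RintegralZl k^-1 measurableT IG.
have E := RintegralB measurableT kIW kIG.
have : k * ip (fun x => (w x)%:C *: phi x) phi - k^-1 * (\sum_j ip (pderiv j phi) (pderiv j phi)) <= 0.
  have I1 : mu.-integrable setT (EFin \o (fun x => k * rdot ((w x)%:C *: phi x) (phi x) -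
      k^-1 * \sum_j rdot (pderiv j phi x) (pderiv j phi x))) := integrableB measurableT kIW kIG.
  have -> : k * ip (fun x => (w x)%:C *: phi x) phi - k^-1 * (\sum_j ip (pderiv j phi) (pderiv j phi)) =
      (\int[mu]_x (k * rdot ((w x)%:C *: phi x) (phi x) -
      k^-1 * \sum_j rdot (pderiv j phi x) (pderiv j phi x)))%R.
    by rewrite E kW kG G0.
  have := le_Rintegral measurableT I1 IQ; rewrite Q0; apply.
  move=> x _; rewrite rdotZl -/(r x).
  have r0 : 0 <= r x by exact: rdot_ge0.
  have w0 : 0 < w x by exact: hardy_weight_gt0.
  (* The difference of the two sides is |k x_j w phi + d_j phi|^2 / k. *)
  have step j : (w x - (2 + k) * x 0 j ^+ 2 * w x ^+ 2) * r x - k^-1 * rdot (pderiv j phi x) (pderiv j phi x) <= q j x.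
    have := rdot_ge0 ((k * x 0 j * w x)%:C *: phi x + pderiv j phi x).
    rewrite rdotDl !rdotDr !rdotZl !rdotZr -/(r x) (rdotC (pderiv j phi x) (phi x)) => H.
    rewrite /q (rdotC (pderiv j phi x) (phi x)) -(ler_pM2l k0) -subr_ge0; move: H; congr (0 <= _).
    by field; rewrite gt_eqF.
  apply: le_trans (ler_sum _ (fun j _ => step j)).
  rewrite sumrB -mulr_suml -mulr_sumr sumrB -mulr_suml -mulr_sumr sumr_const card_ord -enorm_sqr lerD2r.
  rewrite mulrA ler_wpM2r//.
  have Sw : enorm x ^+ 2 * w x ^+ 2 <= w x.
    rewrite expr2 mulrA ler_piMl ?(ltW w0)// ler_pdivrMr; last by rewrite ltr_wpDl ?sqr_ge0.
    by rewrite mul1r lerDl ltW.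
  have k2 : 0 <= 2 + k by rewrite addr_ge0// ltW.
  have := ler_wpM2l k2 Sw; rewrite -mulr_natl /k mulrA; lra.
rewrite subr_le0 -ler_pdivlMl// => /le_trans; apply.
by rewrite mulrA ler_wpM2r ?sumr_ge0// => [i _|]; [exact: ip_ge0 | rewrite /k !expr2 invf_div].
Qed.

End hardy.

(** * The potential along rays and at infinity *)

Section mean_value_bound.
Context {R : realType}.

Lemma mean_value_bound (f df : R -> R) (c a b : R) :
  (forall s, Num.min a b <= s <= Num.max a b -> is_derive s 1 f (df s)) ->
  (forall s, Num.min a b <= s <= Num.max a b -> `|df s| <= c) ->
  `|f b - f a| <= c * `|b - a|.
Proof.
wlog ab : a b / a <= b => [H|].
  have [ab|ba] := orP (le_total a b); first exact: H.
  by move=> df' bf; rewrite distrC (distrC b a); apply: (H b a ba) => s; rewrite minC maxC; [exact: df' | exact: bf].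
rewrite (min_idPl ab) (max_idPr ab) => df' bf.
have [s] : exists2 s, s \in `[a, b] & f b - f a = df s * (b - a).
  apply: MVT_segment => // [s|].
    by rewrite in_itv /= => /andP[as_ sb]; apply: df'; rewrite !ltW.
  apply: derivable_within_continuous => s; rewrite in_itv /= => sab.
  by case: (df' s sab).
by rewrite in_itv /= => sab ->; rewrite normrM ler_wpM2r// bf.
Qed.

Lemma is_derive_inv (s : R) : s != 0 -> is_derive s 1 (fun r : R => r^-1) (- s ^- 2).
Proof.
move=> s0; split; first by apply: (@derivableV _ _ id) => //; exact: derivable_id.
have := @deriveV _ _ (id : R -> R) s 1 s0 (@derivable_id _ _ _ _).
by rewrite derive_id => E; rewrite [LHS]E /GRing.scale /= mulr1.
Qed.

End mean_value_bound.

Section vector_limits.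
Context {R : realType} {N : nat}.
Implicit Types (v w : 'cV[R[i]]_N).

Lemma cvg_sum_seq (I : Type) (r : seq I) (f : I -> nat -> R) (l : I -> R) :
  (forall i, f i n @[n --> \oo] --> l i) ->
  (\sum_(i <- r) f i n) @[n --> \oo] --> \sum_(i <- r) l i.
Proof.
move=> fl; elim: r => [|i r ih].
  rewrite big_nil (_ : (fun _ => _) = (fun=> 0)); first exact: cvg_cst.
  by apply/funext => n; rewrite big_nil.
rewrite big_cons (_ : (fun _ => _) = (fun n => f i n + \sum_(j <- r) f j n)).
  exact: cvgD.
by apply/funext => n; rewrite big_cons.
Qed.

Lemma rdot_mulmx_cvg (A_ : nat -> 'M[R[i]]_N) (A : 'M[R[i]]_N) v w :
  (forall a b, complex.Re (A_ n a b) @[n --> \oo] --> complex.Re (A a b)) ->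
  (forall a b, complex.Im (A_ n a b) @[n --> \oo] --> complex.Im (A a b)) ->
  rdot (A_ n *m v) w @[n --> \oo] --> rdot (A *m v) w.
Proof.
move=> cRe cIm; rewrite rdot_mulmxE (_ : (fun _ => _) = (fun n => \sum_a \sum_b
  (complex.Re (A_ n a b) * rdot_coef_re v w a b + complex.Im (A_ n a b) * rdot_coef_im v w a b))).
  apply: (@cvg_sum_seq _ _ (fun a n => \sum_b _)) => a.
  apply: (@cvg_sum_seq _ _ (fun b n => _ + _)) => b.
  by apply: cvgD; apply: cvgMl; [exact: cRe | exact: cIm].
by apply/funext => n; rewrite rdot_mulmxE.
Qed.

Lemma rdot_delta v k : rdot v (delta_mx k 0) = complex.Re (v k 0) /\
  rdot v ('i *: delta_mx k 0) = complex.Im (v k 0).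
Proof.
split; rewrite /rdot (bigD1 k)//= big1 ?addr0 => [|i ik].
- by rewrite !mxE !eqxx /=; ring.
- by rewrite !mxE (negbTE ik) /=; ring.
- by rewrite !mxE !eqxx cReM cImM /=; ring.
- by rewrite !mxE (negbTE ik) cReM cImM /=; ring.
Qed.

Lemma cnorm_cvg0 (z_ : nat -> 'cV[R[i]]_N) :
  (forall w, rdot (z_ n) w @[n --> \oo] --> 0) -> cnorm (z_ n) @[n --> \oo] --> 0.
Proof.
move=> z0; have abs0 w : `|rdot (z_ n) w| @[n --> \oo] --> 0.
  by rewrite -(normr0 R); apply: cvg_norm; exact: z0.
apply: (@squeeze_cvgr _ _ _ _ (fun=> 0) (fun n => \sum_k
  (`|rdot (z_ n) (delta_mx k 0)| + `|rdot (z_ n) ('i *: delta_mx k 0)|))).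
- near=> n; rewrite cnorm_ge0 /= (le_trans (cnorm_le_sum _))//.
  by apply: ler_sum => k _; have [-> ->] := rdot_delta (z_ n) k.
- exact: cvg_cst.
- rewrite [X in _ --> X](_ : 0 = \sum_(k < N) 0); last by rewrite big1.
  apply: (@cvg_sum_seq _ _ (fun k n => `|_| + `|_|)) => k.
  by rewrite -[X in _ --> X](addr0 0); apply: cvgD; exact: abs0.
Unshelve. all: by end_near. Qed.

Lemma mulmx_eq0_rdot (A : 'M[R[i]]_N) : (forall v w, rdot (A *m v) w = 0) -> A = 0.
Proof.
move=> A0; apply/matrixP => a b.
have /rdot_eq0 := A0 (delta_mx b 0) (A *m delta_mx b 0).
by rewrite -colE => /matrixP/(_ a 0); rewrite !mxE.
Qed.

End vector_limits.

Section potential.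
Context {R : realType} {d N : nat}.
Local Notation e j := (delta_mx 0 j : 'rV[R]_d).
Variables (V : 'rV[R]_d -> 'M[R[i]]_N) (C1 : R).
Hypothesis smoothV : smooth_on [set x | x != 0] V.
Hypothesis gradV : forall x, x != 0 -> grad_norm V x <= C1 / enorm x ^+ 2.
Hypothesis C1_ge0 : 0 <= C1.
Implicit Types (x y z : 'rV[R]_d) (v w : 'cV[R[i]]_N).

(** For z = y this is [radial_deriv V y]. *)
Definition directional_deriv (z y : 'rV[R]_d) : 'M[R[i]]_N :=
  \sum_j (z 0 j)%:C *: pderiv j V y.

Lemma neq0_near y : y != 0 -> \forall t \near y, t != 0.
Proof.
move=> y0; have oP : open [set t : 'rV[R]_d | t != 0].
  rewrite (_ : [set t | _] = ~` [set 0]).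
    by apply: closed_openC; apply: accessible_closed_set1; exact/hausdorff_accessible/norm_hausdorff.
  by apply/seteqP; split => t /=; [move/eqP | move=> h; exact/eqP].
exact: (open_nbhs_nbhs (conj oP y0)).
Qed.

Lemma re_directional_deriv z y a b :
  complex.Re (directional_deriv z y a b) = \sum_j z 0 j * 'D_(e j) (re_entry V a b) y.
Proof.
rewrite /directional_deriv summxE cRe_sum; apply: eq_bigr => j _.
by rewrite !mxE cReM /= mul0r subr0.
Qed.

Lemma im_directional_deriv z y a b :
  complex.Im (directional_deriv z y a b) = \sum_j z 0 j * 'D_(e j) (im_entry V a b) y.
Proof.
rewrite /directional_deriv summxE cIm_sum; apply: eq_bigr => j _.
by rewrite !mxE cImM /= mul0r addr0.
Qed.

Lemma is_derive_potential y z a b : y != 0 ->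
  is_derive y z (re_entry V a b) (complex.Re (directional_deriv z y a b)) /\
  is_derive y z (im_entry V a b) (complex.Im (directional_deriv z y a b)).
Proof.
move=> y0; rewrite re_directional_deriv im_directional_deriv.
have dV j : \forall t \near y, derivable (re_entry V a b) t (e j) /\ derivable (im_entry V a b) t (e j).
  by apply: filterS (neq0_near y0) => t t0; have [_ _] := smoothV [::] a b t0; exact.
have cV j : {for y, continuous (fun t => 'D_(e j) (re_entry V a b) t)} /\
    {for y, continuous (fun t => 'D_(e j) (im_entry V a b) t)}.
  have [c1 c2 _] := smoothV [:: j] a b y0.
  have E1 : re_entry (pderiv j V) a b = (fun t => 'D_(e j) (re_entry V a b) t).
    by apply/funext => t; rewrite /re_entry mxE.
  have E2 : im_entry (pderiv j V) a b = (fun t => 'D_(e j) (im_entry V a b) t).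
    by apply/funext => t; rewrite /im_entry mxE.
  by split; [rewrite -E1 | rewrite -E2].
split; apply: is_derive_C1 => j; try (by apply: filterS (dV j) => t []); by have [] := cV j.
Qed.

Lemma is_derive_rdot_potential y z v w : y != 0 ->
  is_derive y z (fun t => rdot (V t *m v) w) (rdot (directional_deriv z y *m v) w).
Proof.
move=> y0; rewrite rdot_mulmxE (_ : (fun _ => _) = (fun t => \sum_a \sum_b
  (re_entry V a b t * rdot_coef_re v w a b + im_entry V a b t * rdot_coef_im v w a b))); last first.
  by apply/funext => t; rewrite rdot_mulmxE.
apply: (@is_derive_sum _ _ _ _ (fun a t => \sum_b _)) => a.
apply: (@is_derive_sum _ _ _ _ (fun b t => _ + _)) => b.
have [d1 d2] := is_derive_potential z a b y0.
have c1 := @is_derive_cst R _ _ (rdot_coef_re v w a b) y z.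
have c2 := @is_derive_cst R _ _ (rdot_coef_im v w a b) y z.
have := is_deriveD (is_derive_mul d1 c1) (is_derive_mul d2 c2).
by rewrite !mulr0 !addr0.
Qed.

Lemma sum_sqr_cauchy_schwarz (f g : 'I_d -> R) : (forall j, 0 <= g j) ->
  \sum_j `|f j| * g j <= Num.sqrt (\sum_j f j ^+ 2) * Num.sqrt (\sum_j g j ^+ 2).
Proof.
move=> g0; set F := \sum_j f j ^+ 2; set G := \sum_j g j ^+ 2.
have F0 : 0 <= F by apply: sumr_ge0 => j _; exact: sqr_ge0.
have G0 : 0 <= G by apply: sumr_ge0 => j _; exact: sqr_ge0.
set S := \sum_j _.
have H (a b : R) : 2 * a * b * S <= a ^+ 2 * F + b ^+ 2 * G.
  rewrite /S /F /G !mulr_sumr -big_split; apply: ler_sum => j _ /=.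
  have := sqr_ge0 (a * `|f j| - b * g j); rewrite -(real_normK (num_real (f j))); nra.
have [F00|F1] := eqVneq F 0.
  suff -> : S = 0 by rewrite F00 sqrtr0 mul0r.
  rewrite /S big1// => j _; move/eqP: F00; rewrite psumr_eq0 => [/allP/(_ j)|i _]; last exact: sqr_ge0.
  by rewrite mem_index_enum => /(_ isT); rewrite sqrf_eq0 => /eqP ->; rewrite normr0 mul0r.
have [G00|G1] := eqVneq G 0.
  suff -> : S = 0 by rewrite G00 sqrtr0 mulr0.
  rewrite /S big1// => j _; move/eqP: G00; rewrite psumr_eq0 => [/allP/(_ j)|i _]; last exact: sqr_ge0.
  by rewrite mem_index_enum => /(_ isT); rewrite sqrf_eq0 => /eqP ->; rewrite mulr0.
have sF : 0 < Num.sqrt F by rewrite sqrtr_gt0 lt_def F1.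
have sG : 0 < Num.sqrt G by rewrite sqrtr_gt0 lt_def G1.
have := H (Num.sqrt G) (Num.sqrt F); rewrite !sqr_sqrtr//.
have -> : G * F + F * G = 2 * Num.sqrt G * Num.sqrt F * (Num.sqrt F * Num.sqrt G).
  by rewrite -[in LHS](sqr_sqrtr F0) -[in LHS](sqr_sqrtr G0); ring.
by rewrite ler_pM2l// !mulr_gt0.
Qed.

Lemma directional_deriv_bound z y v : y != 0 ->
  cnorm (directional_deriv z y *m v) <= enorm z * (C1 / enorm y ^+ 2) * cnorm v.
Proof.
move=> y0; rewrite /directional_deriv mulmx_suml.
apply: (le_trans (cnorm_sum _ _ _)).
apply: (@le_trans _ _ (\sum_j `|z 0 j| * opnorm (pderiv j V y) * cnorm v)).
  apply: ler_sum => j _; rewrite -scalemxAl cnormZ -mulrA ler_wpM2l//; exact: opnorm_le.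
rewrite -mulr_suml ler_wpM2r ?cnorm_ge0//.
apply: (le_trans (sum_sqr_cauchy_schwarz _ (fun j => opnorm_ge0 _))).
by rewrite ler_wpM2l ?sqrtr_ge0//; exact: gradV.
Qed.

Lemma enormZ (s : R) x : enorm (s *: x) = `|s| * enorm x.
Proof.
apply/eqP; rewrite -(@eqrXn2 _ 2) ?mulr_ge0 ?enorm_ge0//.
rewrite exprMn !enorm_sqr real_normK ?num_real// mulr_sumr; apply/eqP.
by apply: eq_bigr => i _; rewrite mxE exprMn.
Qed.

Lemma enorm_eq0 x : (enorm x == 0) = (x == 0).
Proof.
apply/idP/eqP => [|->]; last first.
  by rewrite -sqrf_eq0 enorm_sqr big1// => i _; rewrite mxE expr0n.
rewrite -sqrf_eq0 enorm_sqr psumr_eq0 => [/allP H|i _]; last exact: sqr_ge0.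
apply/rowP => i; rewrite mxE; have := H i; rewrite mem_index_enum => /(_ isT).
by rewrite sqrf_eq0 => /eqP.
Qed.

Lemma enorm_gt0 x : x != 0 -> 0 < enorm x.
Proof. by move=> x0; rewrite lt_def enorm_ge0 enorm_eq0 x0. Qed.

(** Along the ray r -> V (x/r) the derivative is r^-2 times the derivative of V along x at x/r, up
    to sign. That factor compensates the growth r^2 of the gradient bound, so the constant C1/|x|
    bounds it for all r, and the mean value inequality is applied between 1/s and 1. *)
Lemma potential_ray x v (s : R) : x != 0 -> 0 < s ->
  cnorm ((V (s *: x) - V x) *m v) <= C1 / enorm x * `|1 - s^-1| * cnorm v.
Proof.
move=> x0 s0; have nx := enorm_gt0 x0.
apply: cnorm_le => [|w]; first by rewrite !mulr_ge0 ?invr_ge0 ?cnorm_ge0// ltW.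
rewrite mulmxBl rdotBl.
pose h r := rdot (V (0 + r *: x) *m v) w.
have dh (r : R) : r != 0 -> is_derive r 1 h (rdot (directional_deriv x (0 + r *: x) *m v) w).
  move=> r0; apply: (@is_derive_line R d (fun t => rdot (V t *m v) w)).
  by apply: is_derive_rdot_potential; rewrite add0r scaler_eq0 negb_or r0.
have dhV (r : R) : 0 < r -> is_derive r 1 (fun q => h q^-1)
    (rdot (directional_deriv x (0 + r^-1 *: x) *m v) w * - r ^- 2).
  move=> r0; have rV : r^-1 != 0 by rewrite invr_eq0 gt_eqF.
  exact: (@is_derive1_comp _ h _ r _ _ (dh _ rV) (is_derive_inv (lt0r_neq0 r0))).
have pos (r : R) : Num.min s^-1 1 <= r -> 0 < r.
  by apply: lt_le_trans; rewrite lt_min invr_gt0 s0 ltr01.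
have := @mean_value_bound R _ _ (C1 / enorm x * cnorm v * cnorm w) s^-1 1
  (fun r rs => dhV r (pos r (proj1 (andP rs)))) _.
rewrite /h invrK invr1 !add0r scale1r distrC => H.
apply: (le_trans (ler_norm _)); apply: (le_trans (H _)); last by rewrite le_eqVlt; apply/orP; left; apply/eqP; ring.
move=> r /andP[/pos r0 _]; have rV : r^-1 != 0 by rewrite invr_eq0 gt_eqF.
have y0 : 0 + r^-1 *: x != 0 by rewrite add0r scaler_eq0 negb_or rV.
rewrite normrM normrN [X in _ * X]ger0_norm ?invr_ge0 ?sqr_ge0//.
apply: (le_trans (ler_wpM2r _ (rdot_cauchy_schwarz _ _))); first by rewrite invr_ge0 sqr_ge0.
rewrite mulrAC ler_wpM2r ?cnorm_ge0//.
apply: (le_trans (ler_wpM2r _ (directional_deriv_bound _ _ y0))); first by rewrite invr_ge0 sqr_ge0.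
rewrite mulrAC ler_wpM2r ?cnorm_ge0// add0r enormZ gtr0_norm ?invr_gt0//.
rewrite le_eqVlt; apply/orP; left; apply/eqP; field; rewrite !gt_eqF//.
Qed.

End potential.

Section harmonic_cauchy.
Context {R : realType}.

(** Adding c/(n+1) makes the sequence nonincreasing and bounded below. *)
Lemma cvg_harmonic_cauchy (a : nat -> R) (c : R) : 0 <= c ->
  (forall n m, `|a m - a n| <= c * `|n.+1%:R^-1 - m.+1%:R^-1|) -> cvgn a.
Proof.
move=> c0 H; pose b n := a n + c * n.+1%:R^-1.
have cvgb : cvgn b.
  apply: nonincreasing_is_cvgn.
    move=> n m nm; rewrite /b -lerBrDr -addrA -lerBlDl -mulrBr.
    apply: (le_trans (ler_norm _)); apply: (le_trans (H n m)).
    rewrite ger0_norm// subr_ge0 lef_pV2 ?posrE// ler_nat; exact: nm.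
  exists (a 0 - c) => _ [n _ <-]; rewrite /b.
  have n1 : n.+1%:R^-1 <= 1 :> R by rewrite invf_le1 ?ler1n.
  have n0 : 0 <= n.+1%:R^-1 :> R by rewrite invr_ge0.
  have := H 0 n; rewrite invr1 [X in c * X]ger0_norm ?subr_ge0// => /ler_normlP[+ _].
  have := mulr_ge0 c0 n0; rewrite mulrBr mulr1; move: (c * _) => t; lra.
have -> : a = (fun n => b n - c * n.+1%:R^-1) by apply/funext => n; rewrite /b addrK.
apply: is_cvgB => //; apply: is_cvgMr; apply/cvg_ex; exists 0; exact: cvg_harmonic.
Qed.

Lemma cvg_to_of_dist (a b : nat -> R) (l c : R) :
  (forall n, `|b n - a n| <= c * n.+1%:R^-1) -> a n @[n --> \oo] --> l -> b n @[n --> \oo] --> l.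
Proof.
move=> H al; have -> : b = (fun n => (b n - a n) + a n) by apply/funext => n; rewrite subrK.
rewrite -[l]add0r; apply: cvgD => //; apply/norm_cvg0P.
apply: (@squeeze_cvgr _ _ _ _ (fun=> 0) (fun n => c * n.+1%:R^-1)).
- by near=> n; rewrite normr_ge0 H.
- exact: cvg_cst.
- rewrite -[X in _ --> X](mulr0 c); apply: cvgMr; exact: cvg_harmonic.
Unshelve. all: by end_near. Qed.

End harmonic_cauchy.

Section potential_at_infinity.
Context {R : realType} {d N : nat}.
Local Notation e j := (delta_mx 0 j : 'rV[R]_d).
Variables (V : 'rV[R]_d -> 'M[R[i]]_N) (C1 : R).
Hypothesis smoothV : smooth_on [set x | x != 0] V.
Hypothesis gradV : forall x, x != 0 -> grad_norm V x <= C1 / enorm x ^+ 2.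
Hypothesis C1_ge0 : 0 <= C1.
Implicit Types (x y z : 'rV[R]_d) (v w : 'cV[R[i]]_N).

(* As the angle between x and y is not obtuse, the segment joining them stays away from the origin. *)
Lemma potential_segment x y v (s : R) : x != 0 -> y != 0 -> 0 <= \sum_i x 0 i * y 0 i -> 0 < s ->
  cnorm ((V (s *: y) - V (s *: x)) *m v) <=
  C1 * enorm (y - x) / (Num.min (enorm x ^+ 2) (enorm y ^+ 2) / 2) / s * cnorm v.
Proof.
move=> x0 y0 xy s0; set mu := _ / 2.
have mu0 : 0 < mu by rewrite divr_gt0// lt_min !exprn_gt0// enorm_gt0.
have mux : 2 * mu <= enorm x ^+ 2 by rewrite /mu mulrC divfK// ge_min lexx.
have muy : 2 * mu <= enorm y ^+ 2 by rewrite /mu mulrC divfK// ge_min lexx orbT.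
apply: cnorm_le => [|w].
  by rewrite !mulr_ge0 ?invr_ge0 ?cnorm_ge0 ?enorm_ge0 ?(ltW mu0)// ltW.
rewrite mulmxBl rdotBl.
pose p r := s *: x + r *: (s *: (y - x)).
have pE r : enorm (p r) ^+ 2 = s ^+ 2 * ((1 - r) ^+ 2 * enorm x ^+ 2 + r ^+ 2 * enorm y ^+ 2 +
    2 * r * (1 - r) * \sum_i x 0 i * y 0 i).
  rewrite !enorm_sqr !mulr_sumr -!big_split /= mulr_sumr; apply: eq_bigr => i _.
  by rewrite !mxE; ring.
(* The cross term is nonnegative and (1-r)^2 + r^2 >= 1/2, so at least half of the smaller of |x|^2
   and |y|^2 is left. *)
have p_lower r : 0 <= r <= 1 -> s ^+ 2 * mu <= enorm (p r) ^+ 2.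
  move=> /andP[r0 r1]; rewrite pE ler_wpM2l ?sqr_ge0//.
  have H1 : 0 <= (1 - r) ^+ 2 * (enorm x ^+ 2 - 2 * mu) by rewrite mulr_ge0 ?sqr_ge0 ?subr_ge0.
  have H2 : 0 <= r ^+ 2 * (enorm y ^+ 2 - 2 * mu) by rewrite mulr_ge0 ?sqr_ge0 ?subr_ge0.
  have H3 : 0 <= 2 * r * (1 - r) * \sum_i x 0 i * y 0 i by rewrite !mulr_ge0 ?subr_ge0.
  have H4 : 0 <= mu * (1 - 2 * r) ^+ 2 by rewrite mulr_ge0 ?sqr_ge0 ?(ltW mu0).
  have -> : mu = ((1 - r) ^+ 2 + r ^+ 2) * (2 * mu) - mu * (1 - 2 * r) ^+ 2 by ring.
  lra.
have p0 r : 0 <= r <= 1 -> p r != 0.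
  move=> /p_lower; apply: contraTneq => ->; rewrite -ltNge enorm_sqr big1 => [|i _].
    by rewrite mulr_gt0 ?exprn_gt0.
  by rewrite mxE expr0n.
pose h r := rdot (V (p r) *m v) w.
have dh (r : R) : 0 <= r <= 1 -> is_derive r 1 h (rdot (directional_deriv V (s *: (y - x)) (p r) *m v) w).
  move=> r01; apply: (@is_derive_line R d (fun t => rdot (V t *m v) w)).
  by apply: is_derive_rdot_potential => //; exact: p0.
have m01 : Num.min (0 : R) 1 = 0 by apply/min_idPl.
have M01 : Num.max (0 : R) 1 = 1 by apply/max_idPr.
have := @mean_value_bound R h _ (C1 * enorm (y - x) / mu / s * cnorm v * cnorm w) 0 1.
rewrite m01 M01 subr0 normr1 mulr1 => /(_ _ dh) H.
have -> : s *: y = p 1 by rewrite /p scale1r -scalerDr addrC subrK.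
have -> : s *: x = p 0 by rewrite /p scale0r addr0.
apply: (le_trans (ler_norm _)); apply: H => r r01.
apply: (le_trans (rdot_cauchy_schwarz _ _)); rewrite ler_wpM2r ?cnorm_ge0//.
apply: (le_trans (directional_deriv_bound gradV _ _ (p0 _ r01))).
rewrite ler_wpM2r ?cnorm_ge0// enormZ (gtr0_norm s0).
have -> : C1 * enorm (y - x) / mu / s = s * enorm (y - x) * (C1 / (s ^+ 2 * mu)).
  by field; rewrite !gt_eqF.
rewrite ler_wpM2l ?mulr_ge0 ?enorm_ge0 ?(ltW s0)// ler_wpM2l// lef_pV2 ?posrE.
- exact: p_lower.
- by rewrite exprn_gt0// enorm_gt0 ?p0.
- by rewrite mulr_gt0 ?exprn_gt0.
Qed.

Lemma cnorm_delta (b : 'I_N) : cnorm (delta_mx b 0 : 'cV[R[i]]_N) = 1.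
Proof.
apply/eqP; rewrite -(@eqrXn2 _ 2) ?cnorm_ge0// cnorm_sqr expr1n.
by rewrite (rdot_delta _ b).1 mxE !eqxx.
Qed.

Lemma entry_le_of_cnorm (A : 'M[R[i]]_N) (c : R) a b :
  (forall v, cnorm (A *m v) <= c * cnorm v) ->
  `|complex.Re (A a b)| <= c /\ `|complex.Im (A a b)| <= c.
Proof.
move=> /(_ (delta_mx b 0)); rewrite cnorm_delta mulr1 -colE => H.
have [] := cnorm_entry (col b A) a; rewrite !mxE => p q.
by split; [apply: le_trans p H | apply: le_trans q H].
Qed.

Definition potential_limit (E : 'M[R[i]]_N) x := forall a b,
  complex.Re (V (n.+1%:R *: x) a b) @[n --> \oo] --> complex.Re (E a b) /\
  complex.Im (V (n.+1%:R *: x) a b) @[n --> \oo] --> complex.Im (E a b).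

Lemma potential_limit_ray x : x != 0 -> exists E, potential_limit E x.
Proof.
move=> x0; have nx := enorm_gt0 x0.
have H a b n m : `|complex.Re (V (m.+1%:R *: x) a b) - complex.Re (V (n.+1%:R *: x) a b)| <=
      C1 / enorm x * `|n.+1%:R^-1 - m.+1%:R^-1| /\
    `|complex.Im (V (m.+1%:R *: x) a b) - complex.Im (V (n.+1%:R *: x) a b)| <=
      C1 / enorm x * `|n.+1%:R^-1 - m.+1%:R^-1|.
  have n0 : n.+1%:R != 0 :> R by rewrite pnatr_eq0.
  have m0 : m.+1%:R != 0 :> R by rewrite pnatr_eq0.
  have := @entry_le_of_cnorm (V (m.+1%:R *: x) - V (n.+1%:R *: x)) (C1 / enorm x * `|n.+1%:R^-1 - m.+1%:R^-1|) a b.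
  rewrite !mxE cReD cImD cReN cImN; apply => v.
  have xn0 : n.+1%:R *: x != 0 by rewrite scaler_eq0 negb_or n0.
  have s0 : 0 < m.+1%:R / n.+1%:R :> R by rewrite divr_gt0.
  have := potential_ray smoothV gradV C1_ge0 v xn0 s0.
  rewrite scalerA divfK// enormZ normr_nat invf_div => K; apply: (le_trans K).
  rewrite ler_wpM2r ?cnorm_ge0// le_eqVlt; apply/orP; left; apply/eqP.
  rewrite -[n.+1%:R^-1 - _](mulKf n0) mulrBr mulfV// normrM normfV normr_nat.
  by rewrite invfM; ring.
have C1x : 0 <= C1 / enorm x by rewrite divr_ge0// ltW.
exists (\matrix_(a, b) (limn (fun n => complex.Re (V (n.+1%:R *: x) a b)) +i*
                        limn (fun n => complex.Im (V (n.+1%:R *: x) a b)))) => a b.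
rewrite !mxE; split; apply: (cvg_harmonic_cauchy C1x) => n m.
  by have [] := H a b n m.
by have [] := H a b n m.
Qed.

(** The segment from (n+1) x to (n+1) y has length of order n, and on it the gradient of V is of
    order n^-2. *)
Lemma potential_limit_transport E x y : x != 0 -> y != 0 -> 0 <= \sum_i x 0 i * y 0 i ->
  potential_limit E x -> potential_limit E y.
Proof.
move=> x0 y0 xy Ex a b; have [Er Ei] := Ex a b.
set K := C1 * enorm (y - x) / (Num.min (enorm x ^+ 2) (enorm y ^+ 2) / 2).
have H n : `|complex.Re (V (n.+1%:R *: y) a b) - complex.Re (V (n.+1%:R *: x) a b)| <= K * n.+1%:R^-1 /\
    `|complex.Im (V (n.+1%:R *: y) a b) - complex.Im (V (n.+1%:R *: x) a b)| <= K * n.+1%:R^-1.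
  have := @entry_le_of_cnorm (V (n.+1%:R *: y) - V (n.+1%:R *: x)) (K * n.+1%:R^-1) a b.
  rewrite !mxE cReD cImD cReN cImN; apply => v.
  exact: potential_segment.
by split; [apply: cvg_to_of_dist Er | apply: cvg_to_of_dist Ei] => n; case: (H n); [move=> + _ | move=> _ +]; exact.
Qed.

(** Every direction y is reached from the first basis vector through non-obtuse angles: directly if
    the first coordinate of y is nonnegative, otherwise by way of plus or minus the second basis
    vector, with the sign of the second coordinate of y. *)
Lemma potential_limit_exists : (1 < d)%N -> exists E, forall x, x != 0 -> potential_limit E x.
Proof.
move=> d1; pose i0 : 'I_d := Ordinal (ltnW d1); pose i1 : 'I_d := Ordinal d1.
have delta0 i : e i != 0.
  by apply/eqP => /rowP/(_ i); rewrite !mxE !eqxx => /eqP; rewrite oner_eq0.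
have sum_delta i y (c : R) : \sum_k (c *: e i) 0 k * y 0 k = c * y 0 i.
  rewrite (bigD1 i)//= big1 ?addr0 => [|k ki]; first by rewrite !mxE !eqxx mulr1.
  by rewrite !mxE (negbTE ki) mulr0 mul0r.
have [E EE] := potential_limit_ray (delta0 i0); exists E => y y0.
have [y00|y00] := leP 0 (y 0 i0).
  by apply: (potential_limit_transport (delta0 i0)) => //; rewrite -[e i0]scale1r sum_delta mul1r.
pose c : R := if 0 <= y 0 i1 then 1 else -1.
have c0 : c != 0 by rewrite /c; case: ifP; rewrite ?oppr_eq0 oner_eq0.
have z0 : c *: e i1 != 0 by rewrite scaler_eq0 negb_or c0 delta0.
apply: (potential_limit_transport z0) => //.
  rewrite sum_delta /c; case: ifPn => [|]; first by rewrite mul1r.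
  by rewrite -ltNge mulN1r oppr_ge0 => /ltW.
apply: (potential_limit_transport (delta0 i0)) => //.
by rewrite -[e i0]scale1r sum_delta !mxE (_ : (i0 == i1) = false)// andbF mulr0 mulr0.
Qed.

Variable E : 'M[R[i]]_N.
Hypothesis limE : forall x, x != 0 -> potential_limit E x.
Hypothesis d_gt0 : (0 < d)%N.

Let x1 : 'rV[R]_d := e (Ordinal d_gt0).

Let x1_neq0 : x1 != 0.
Proof. by apply/eqP => /rowP/(_ (Ordinal d_gt0)); rewrite !mxE !eqxx => /eqP; rewrite oner_eq0. Qed.

Lemma rdot_potential_cvg x v w : x != 0 ->
  rdot (V (n.+1%:R *: x) *m v) w @[n --> \oo] --> rdot (E *m v) w.
Proof. by move=> x0; apply: rdot_mulmx_cvg => a b; have [] := limE x0 a b. Qed.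

Lemma potential_limit_herm : (forall x, x != 0 -> V x \is hermsymmx) -> E \is hermsymmx.
Proof.
move=> hV; have H v w : rdot (E *m v) w = rdot v (E *m w).
  have L2 := @rdot_potential_cvg x1 w v x1_neq0.
  rewrite (_ : (fun _ => _) = (fun n => rdot (V (n.+1%:R *: x1) *m v) w)) in L2.
    by rewrite [RHS]rdotC; exact: (cvg_unique _ (@rdot_potential_cvg x1 v w x1_neq0) L2).
  apply/funext => n; have nx : n.+1%:R *: x1 != 0 by rewrite scaler_eq0 negb_or pnatr_eq0.
  by rewrite (rdot_herm w v (hV _ nx)); exact: rdotC.
apply/is_hermitianmxP; rewrite expr0 scale1r; apply/matrixP => a b.
rewrite !mxE; apply/eqP; rewrite eq_complex; apply/andP; split; apply/eqP.
  have := H (delta_mx b 0) (delta_mx a 0).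
  by rewrite (rdot_delta _ _).1 rdotC (rdot_delta _ _).1 -!colE !mxE; case: (E b a).
have := H (delta_mx b 0) ('i *: delta_mx a 0).
rewrite (rdot_delta _ _).2 rdotC -scalemxAr rdotil (rdot_delta _ _).2 -!colE !mxE.
by case: (E b a).
Qed.

(** Any positive power of decay kills the commutator at infinity; the exponent is 1 for the alpha_j
    and 2 for beta. *)
Lemma potential_limit_commute (M : 'M[R[i]]_N) (C : R) k : (0 < k)%N -> M \is hermsymmx ->
  (forall x, x != 0 -> opnorm (commutator M (V x)) <= C / enorm x ^+ k) ->
  M *m E = E *m M.
Proof.
move=> k0 hM H; apply/eqP; rewrite -subr_eq0; apply/eqP; apply: mulmx_eq0_rdot => v w.
have L : rdot ((M *m V (n.+1%:R *: x1) - V (n.+1%:R *: x1) *m M) *m v) w @[n --> \oo] -->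
    rdot ((M *m E - E *m M) *m v) w.
  have split_rdot (A : 'M[R[i]]_N) : rdot ((M *m A - A *m M) *m v) w =
      rdot (A *m v) (M *m w) - rdot (A *m (M *m v)) w.
    by rewrite mulmxBl rdotBl -!mulmxA (rdot_herm _ _ hM).
  rewrite split_rdot; under eq_fun do rewrite split_rdot.
  by apply: cvgB; exact: rdot_potential_cvg.
suff L0 : rdot ((M *m V (n.+1%:R *: x1) - V (n.+1%:R *: x1) *m M) *m v) w @[n --> \oo] --> 0.
  exact: (cvg_unique _ L L0).
apply: (@cvg_to_of_dist _ (fun=> 0) _ 0 (`|C| / enorm x1 ^+ k * cnorm v * cnorm w)); last exact: cvg_cst.
move=> n; rewrite subr0; have nx : n.+1%:R *: x1 != 0 by rewrite scaler_eq0 negb_or pnatr_eq0.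
apply: (le_trans (rdot_cauchy_schwarz _ _)).
apply: (le_trans (ler_wpM2r (cnorm_ge0 _) (opnorm_le _ _))).
apply: (@le_trans _ _ (`|C| / enorm x1 ^+ k / n.+1%:R * cnorm v * cnorm w)); last first.
  by rewrite le_eqVlt; apply/orP; left; apply/eqP; ring.
rewrite !ler_wpM2r ?cnorm_ge0//; apply: (le_trans (H _ nx)).
have e1 := enorm_gt0 x1_neq0.
apply: (@le_trans _ _ (`|C| / enorm (n.+1%:R *: x1) ^+ k)).
  by rewrite ler_wpM2r ?ler_norm// invr_ge0 exprn_ge0// enorm_ge0.
rewrite -[leRHS]mulrA ler_wpM2l// enormZ normr_nat exprMn invfM mulrC.
rewrite ler_wpM2l ?invr_ge0 ?exprn_ge0 ?(ltW e1)//.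
by rewrite lef_pV2 ?posrE ?exprn_gt0// ler_eXnr ?ler1n.
Qed.

(** The bound of [potential_ray] at s = n+1 stays below C1/|x| while V((n+1) x) tends to E. *)
Lemma potential_decay x v : x != 0 ->
  cnorm ((V x - E) *m v) <= C1 / enorm x * cnorm v.
Proof.
move=> x0; have nx := enorm_gt0 x0.
apply: cnorm_le => [|w]; first by rewrite !mulr_ge0 ?invr_ge0 ?cnorm_ge0// ltW.
rewrite mulmxBl rdotBl.
have L : rdot (V x *m v) w - rdot (V (n.+1%:R *: x) *m v) w @[n --> \oo] -->
    rdot (V x *m v) w - rdot (E *m v) w.
  by apply: cvgB; [exact: cvg_cst | exact: rdot_potential_cvg].
rewrite -(cvg_lim _ L)//; apply: limr_le; first by apply/cvg_ex; eexists; exact: L.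
apply: nearW => n; rewrite -rdotBl -mulmxBl.
apply: (le_trans (ler_norm _)); apply: (le_trans (rdot_cauchy_schwarz _ _)).
rewrite ler_wpM2r ?cnorm_ge0// -cnormN -mulNmx opprB.
apply: (le_trans (potential_ray smoothV gradV C1_ge0 v x0 (ltr0Sn _ n))).
rewrite ler_wpM2r ?cnorm_ge0// ler_piMr ?divr_ge0 ?(ltW nx)//.
have n1 : n.+1%:R^-1 <= 1 :> R by rewrite invf_le1 ?ler1n.
rewrite ger0_norm ?subr_ge0// lerBlDr lerDl invr_ge0//.
Qed.

End potential_at_infinity.

(** * Matrices commuting with all Dirac matrices *)

Section dirac_commutant.
Context {R : realType} {d : nat}.

(** The commutant lemma wants an even number n of generators with N^2 = 2^n. For odd d these are the
    alpha_j together with beta, for even d the alpha_j alone. Hermiticity makes the scalar real. *)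
Lemma dirac_commutant (alpha : 'I_d -> 'M[R[i]]_(dirac_dim d)) (beta E : 'M[R[i]]_(dirac_dim d)) :
  dirac_matrices alpha beta -> E \is hermsymmx ->
  (forall j, alpha j *m E = E *m alpha j) -> beta *m E = E *m beta ->
  exists c : R, E = (c%:C)%:M.
Proof.
move=> dm hE aE bE.
have [c Ec] : exists c, E = c%:M.
  have [d_odd|d_even] := boolP (odd d).
    pose g (i : 'I_d.+1) : 'M[R[i]]_(dirac_dim d) := if unlift ord0 i is Some j then alpha j else beta.
    apply: (@clifford_commutant R[i] (dirac_dim d) d.+1 g).
    - by move=> i; rewrite /g; case: unliftP => [j _|_]; [exact: (alpha_sqr dm) | exact: (beta_sqr dm)].
    - move=> i j; rewrite /g; case: unliftP => [i' ->|->]; case: unliftP => [j' ->|->] ij.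
      + by apply: (alphaC dm); apply: contraNneq ij => ->.
      + exact: (alpha_betaC dm).
      + by apply/eqP; rewrite -[_ * _]/(beta *m alpha j') -[alpha j' * _]/(alpha j' *m beta) (alpha_betaC dm) opprK.
      + by rewrite eqxx in ij.
    - by rewrite /= d_odd.
    - rewrite -expnD addnn; congr (2 ^ _)%N; rewrite -[RHS]odd_double_half /= d_odd//.
    - move=> i; rewrite /g; case: unliftP => [j _|_]; apply: esym; [exact: aE | exact: bE].
  apply: (@clifford_commutant R[i] (dirac_dim d) d alpha) => //.
  - by move=> i; exact: (alpha_sqr dm).
  - by move=> i j ij; exact: (alphaC dm).
  - rewrite -expnD addnn; congr (2 ^ _)%N.
    by rewrite -[RHS]odd_double_half (negbTE d_even) /= uphalf_half (negbTE d_even).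
  - by move=> i; apply: esym; exact: aE.
exists (complex.Re c); rewrite Ec; congr (_%:M).
have N0 : (0 < dirac_dim d)%N by rewrite expn_gt0.
have := hermsymmx_entry hE (Ordinal N0) (Ordinal N0); rewrite Ec !mxE eqxx mulr1n.
case: (c) => x y /= [] y0; apply/eqP; rewrite eq_complex /= eqxx /=.
by have : y = - y := y0; lra.
Qed.

End dirac_commutant.

(** * Operators with a core *)

Section inverse_norm_weight.
Context {R : realType} {d N : nat}.
Local Notation spinor := ('rV[R]_d -> 'cV[R[i]]_N).
Local Notation mu := (lebesgue_rV R d).
Local Notation ip := (ip mu).
Local Notation sqint := (sqint mu).
Implicit Types (u v : spinor) (x : 'rV[R]_d).

Lemma open_neq0 : open [set x : 'rV[R]_d | x != 0].
Proof. by rewrite openE => x /= x0; exact: neq0_near. Qed.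

Lemma measurable_origin : measurable [set (0 : 'rV[R]_d)].
Proof.
have -> : [set 0] = ~` [set x : 'rV[R]_d | x != 0].
  by apply/seteqP; split => x /=; [move=> ->; rewrite eqxx | move/negP/negPn/eqP].
by apply: measurableC; apply: open_measurable_rV; exact: open_neq0.
Qed.

Lemma ae_neq0 : (0 < d)%N -> {ae lebesgue_rV R d, forall x : 'rV[R]_d, x <> 0}.
Proof.
move=> d0; exists [set 0]; split; first exact: measurable_origin.
  exact: lebesgue_rV_set0.
by move=> x /= /contrapT.
Qed.

Lemma measurable_off0 (f : 'rV[R]_d -> R) :
  (forall x, x != 0 -> {for x, continuous f}) -> measurable_fun setT f.
Proof.
move=> cf; have oP := open_neq0.
have -> : [set: 'rV[R]_d] = [set x | x != 0] `|` [set 0].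
  by apply/seteqP; split => // x _; have [->|x0] := eqVneq x 0; [right | left].
have m0 := measurable_origin.
apply/measurable_funU => //; first exact: open_measurable_rV.
split; last exact: measurable_fun_set1.
by apply: open_continuous_measurable_rV => // x; rewrite inE => /cf.
Qed.

(* Equal to 0 at the origin. *)
Definition inv_norm x : R := (enorm x)^-1.

Lemma inv_norm_ge0 x : 0 <= inv_norm x. Proof. by rewrite invr_ge0 enorm_ge0. Qed.

Lemma continuous_enorm : continuous (fun x : 'rV[R]_d => enorm x).
Proof.
rewrite (_ : (fun _ => _) = (fun x => Num.sqrt (enorm x ^+ 2))); last first.
  by apply/funext => x; rewrite sqrtr_sqr ger0_norm// enorm_ge0.
move=> x; apply: (@continuous_comp _ _ _ (fun x => enorm x ^+ 2) (@Num.sqrt R)).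
  exact: continuous_enorm_sqr.
exact: sqrt_continuous.
Qed.

Lemma measurable_inv_norm : measurable_fun setT inv_norm.
Proof.
apply: measurable_off0 => x x0; apply: (@continuousV _ _ (fun x => enorm x)).
  by rewrite enorm_eq0.
exact: continuous_enorm.
Qed.

Definition over_norm u : spinor := fun x => (inv_norm x)%:C *: u x.

Lemma measurable_over_norm u : measurable_spinor u -> measurable_spinor (over_norm u).
Proof. by apply: measurable_spinorZf; exact: measurable_inv_norm. Qed.

Lemma cnorm_over_norm u x : cnorm (over_norm u x) = inv_norm x * cnorm (u x).
Proof. by rewrite cnormZ ger0_norm// inv_norm_ge0. Qed.

Lemma sqint_hardy_weight (eps : R) u : 0 < eps -> sqint u ->
  sqint (fun x => (hardy_weight eps x)%:C *: u x).
Proof.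
move=> eps0 su; apply: (@sqint_le _ _ _ _ _ eps^-1 _ u) => //.
  apply: measurable_spinorZf; last by case: su.
  by apply: continuous_measurable_rV; exact: continuous_hardy_weight.
move=> x; rewrite cnormZ ger0_norm; last by rewrite ltW// hardy_weight_gt0.
by rewrite ler_wpM2r ?cnorm_ge0// hardy_weight_le.
Qed.

(** As eps decreases to 0 the regularized weights increase to |x|^-2, so monotone convergence gives
    both integrability and the bound. *)
Lemma hardy_limit u (G : R) : sqint u ->
  (forall eps, 0 < eps -> ip (fun x => (hardy_weight eps x)%:C *: u x) u <= G) ->
  sqint (over_norm u) /\ ip (over_norm u) (over_norm u) <= G.
Proof.
move=> su H; have [mu_ _] := su.
pose t n : R := n.+1%:R^-1; have t0 n : 0 < t n by rewrite invr_gt0.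
pose r x := rdot (u x) (u x); have r0 x : 0 <= r x by exact: rdot_ge0.
have mr : measurable_fun setT r by exact: measurable_rdot.
(* The factor [inv_norm x * enorm x] is 1 off the origin and 0 at it; it matches the value 0 of
   [inv_norm] at the origin, where the weights themselves diverge. *)
pose f n x : R := hardy_weight (t n) x * (inv_norm x * enorm x) * r x.
have w0 n x : 0 < hardy_weight (t n) x by exact: hardy_weight_gt0.
have q0 (x : 'rV[R]_d) : 0 <= inv_norm x * enorm x by rewrite mulr_ge0 ?inv_norm_ge0 ?enorm_ge0.
have q1 (x : 'rV[R]_d) : inv_norm x * enorm x <= 1.
  rewrite /inv_norm; have [->|e0] := eqVneq (enorm x) 0; first by rewrite mulr0.
  by rewrite mulVf.
have mf n : measurable_fun setT (f n).
  apply: measurable_funM => //; apply: measurable_funM.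
    by apply: continuous_measurable_rV; exact: continuous_hardy_weight.
  by apply: measurable_funM; [exact: measurable_inv_norm |
    apply: continuous_measurable_rV; exact: continuous_enorm].
have f0 n x : 0 <= f n x := mulr_ge0 (mulr_ge0 (ltW (w0 n x)) (q0 x)) (r0 x).
have ndf x : nondecreasing_seq (fun n => (f n x)%:E).
  move=> n m nm; rewrite lee_fin /f ler_wpM2r// ler_wpM2r// /hardy_weight.
  rewrite lef_pV2 ?posrE ?ltr_wpDl ?sqr_ge0// lerD2l lef_pV2 ?posrE// ler_nat.
  exact: nm.
have fE x : (f n x)%:E @[n --> \oo] --> (rdot (over_norm u x) (over_norm u x))%:E.
  apply: cvg_EFin; first exact: nearW.
  rewrite (_ : fine \o _ = f^~ x); last by apply/funext.
  rewrite rdotZl rdotZr mulrA.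
  have [x0|x0] := eqVneq x 0.
    have ex0 : inv_norm x = 0 by rewrite /inv_norm x0 (_ : enorm 0 = 0) ?invr0//; apply/eqP; rewrite enorm_eq0.
    rewrite ex0 mulr0 mul0r (_ : f^~ x = (fun=> 0)); first exact: cvg_cst.
    by apply/funext => n; rewrite /f ex0 mul0r mulr0 mul0r.
  have e0 : enorm x != 0 by rewrite enorm_eq0.
  apply: cvgMl; rewrite /inv_norm mulVf//.
  rewrite (_ : (fun _ => _) = (fun n => (enorm x ^+ 2 + t n)^-1)); last by apply/funext => n; rewrite mulr1.
  rewrite -invfM -expr2; apply: cvgV; first by rewrite sqrf_eq0.
  rewrite -[X in _ --> X]addr0; apply: cvgD; [exact: cvg_cst | exact: cvg_harmonic].
have mon := @monotone_convergence _ _ _ mu setT measurableT (fun n x => (f n x)%:E).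
have bound : (\int[mu]_x (rdot (over_norm u x) (over_norm u x))%:E <= G%:E)%E.
  have -> : (\int[mu]_x (rdot (over_norm u x) (over_norm u x))%:E =
      \int[mu]_x limn (fun n => (f n x)%:E))%E.
    by apply: eq_integral => x _; apply/esym/cvg_lim => //; exact: fE.
  rewrite mon.
  - apply: lime_le.
      apply: ereal_nondecreasing_is_cvgn => n m nm.
      by apply: ge0_le_integral => //; try (by move=> x _; rewrite lee_fin);
        try exact/measurable_EFinP; move=> x _; exact: ndf.
    apply: nearW => n; have Hn := H _ (t0 n).
    have I1 := integrable_rdot (sqint_hardy_weight (t0 n) su) su.
    apply: (@le_trans _ _ (\int[mu]_x (rdot ((hardy_weight (t n) x)%:C *: u x) (u x))%:E)%E).
      apply: ge0_le_integral => //.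
      + by move=> x _; rewrite lee_fin.
      + exact/measurable_EFinP.
      + by case/integrableP: I1.
      + move=> x _; rewrite lee_fin rdotZl /f ler_wpM2r// ler_piMr// ltW//.
    by rewrite -[leLHS]fineK ?lee_fin//; exact: (integrable_fin_num measurableT I1).
  - by move=> n; exact/measurable_EFinP.
  - by move=> n x _; rewrite lee_fin.
  - by move=> x _; exact: ndf.
have su' : sqint (over_norm u).
  split; first exact: measurable_over_norm.
  under eq_integral => x _ do rewrite cnorm_sqr.
  by apply: le_lt_trans bound _; rewrite ltry.
split=> //; rewrite -lee_fin /ip fineK//.
exact: (integrable_fin_num measurableT (integrable_rdot su' su')).
Qed.

End inverse_norm_weight.

(** * Graphs, adjoints and cores in terms of the real inner product *)

Section L2_real_form.
Context {R : realType} {d N : nat}.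
Local Notation spinor := ('rV[R]_d -> 'cV[R[i]]_N).
Local Notation mu := (lebesgue_rV R d).
Local Notation ip := (ip mu).
Local Notation sqint := (sqint mu).
Implicit Types (u v w : spinor) (T : set (spinor * spinor)).

Lemma L2dotE u v : L2dot u v = ip u v +i* ip u (fun x => 'i *: v x).
Proof.
rewrite /L2dot; congr (_ +i* _); apply: eq_Rintegral => x _.
  rewrite cRe_sum; apply: eq_bigr => k _; rewrite cReM.
  by case: (v x k 0) => a b /=; ring.
rewrite cIm_sum; apply: eq_bigr => k _; rewrite !mxE cImM cReM cImM /=.
by case: (v x k 0) => a b /=; ring.
Qed.

Lemma L2normE u : L2norm u = Num.sqrt (ip u u).
Proof. by congr Num.sqrt; apply: eq_Rintegral => x _; rewrite cnorm_sqr. Qed.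

Lemma weak_pderiv_ip j u g phi : weak_pderiv j u g -> test_functions phi ->
  ip u (pderiv j phi) = - ip g phi.
Proof. by move=> wu /wu; rewrite !L2dotE => -[]. Qed.

(** The real identity suffices: applied to i phi, again a test function, it gives the imaginary
    part. *)
Lemma ip_weak_pderiv j u g :
  (forall phi, test_functions phi -> ip u (pderiv j phi) = - ip g phi) -> weak_pderiv j u g.
Proof.
move=> H phi tp; rewrite !L2dotE; apply/eqP; rewrite eq_complex /= H// eqxx /=.
rewrite -H; last exact: test_scale.
by rewrite (pderiv_scale 'i j (test_smooth tp)).
Qed.

Lemma L2norm_lt_sqr u (e : R) : L2norm u < e -> ip u u <= e ^+ 2.
Proof.
rewrite L2normE => H; rewrite -[leLHS]sqr_sqrtr ?ip_ge0// lerXn2r ?nnegrE ?sqrtr_ge0//.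
  exact: le_trans (sqrtr_ge0 _) (ltW H).
exact: ltW.
Qed.

Lemma l2cvg_of_le (u_ : nat -> spinor) u (C : R) :
  (forall n, ip (u_ n \- u) (u_ n \- u) <= C * n.+1%:R^-1 ^+ 2) -> l2cvg mu u_ u.
Proof.
move=> H; apply: (@squeeze_cvgr _ _ _ _ (fun=> 0) (fun n => C * n.+1%:R^-1 ^+ 2)).
- by near=> n; rewrite ip_ge0 H.
- exact: cvg_cst.
- rewrite -[X in _ --> X](mulr0 C); apply: cvgMr.
  rewrite -[X in _ --> X](mulr0 0); apply: cvgM; exact: cvg_harmonic.
Unshelve. all: by end_near. Qed.

Lemma closure_seq T v w : op_closure T (v, w) ->
  exists u_ f_ : nat -> spinor, [/\ forall n, T (u_ n, f_ n), l2cvg mu u_ v & l2cvg mu f_ w].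
Proof.
case=> _ _ H.
have {}H n : exists p : spinor * spinor, [/\ T p, ip (p.1 \- v) (p.1 \- v) <= n.+1%:R^-1 ^+ 2 &
    ip (p.2 \- w) (p.2 \- w) <= n.+1%:R^-1 ^+ 2].
  have t0 : 0 < n.+1%:R^-1 :> R by rewrite invr_gt0.
  have [u [f [Tuf uv fw]]] := H _ t0.
  by exists (u, f); split; [exact: Tuf | exact: (L2norm_lt_sqr uv) | exact: (L2norm_lt_sqr fw)].
have [p Hp] := choice H.
exists (fst \o p), (snd \o p); split.
- by move=> n /=; have [] := Hp n; case: (p n).
- by apply: (@l2cvg_of_le _ _ 1) => n; rewrite mul1r; have [] := Hp n.
- by apply: (@l2cvg_of_le _ _ 1) => n; rewrite mul1r; have [] := Hp n.
Qed.

Lemma l2cvg_L2dot (u_ v_ : nat -> spinor) u v u' v' (f_ g_ : nat -> spinor) f g :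
  (forall n, sqint (u_ n)) -> (forall n, sqint (v_ n)) -> sqint u -> sqint v ->
  (forall n, sqint (f_ n)) -> (forall n, sqint (g_ n)) -> sqint f -> sqint g ->
  l2cvg mu u_ u -> l2cvg mu v_ v -> l2cvg mu f_ f -> l2cvg mu g_ g -> u' = u -> v' = v ->
  (forall n, L2dot (u_ n) (v_ n) = L2dot (f_ n) (g_ n)) -> L2dot u' v' = L2dot f g.
Proof.
move=> su_ sv_ su sv sf_ sg_ sf sg uu vv ff gg -> -> H.
rewrite !L2dotE; apply/eqP; rewrite eq_complex; apply/andP; split; apply/eqP => /=.
  have L1 := l2cvg_ip su_ sv_ su sv uu vv; have L2 := l2cvg_ip sf_ sg_ sf sg ff gg.
  rewrite (_ : (fun _ => _) = (fun n => ip (f_ n) (g_ n))) in L1.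
    exact: (cvg_unique _ L1 L2).
  by apply/funext => n; have := H n; rewrite !L2dotE => -[].
have siv_ n : sqint (fun x => 'i *: v_ n x) by exact: sqintZ.
have sig_ n : sqint (fun x => 'i *: g_ n x) by exact: sqintZ.
have L1 := l2cvg_ip su_ siv_ su (sqintZ 'i sv) uu (l2cvgZ 'i sv_ sv vv).
have L2 := l2cvg_ip sf_ sig_ sf (sqintZ 'i sg) ff (l2cvgZ 'i sg_ sg gg).
rewrite (_ : (fun _ => _) = (fun n => ip (f_ n) (fun x => 'i *: g_ n x))) in L1.
  exact: (cvg_unique _ L1 L2).
by apply/funext => n; have := H n; rewrite !L2dotE => -[].
Qed.

Section core.
Variables (T : set (spinor * spinor)) (D0 : set spinor).
Hypothesis TL2 : forall u f, T (u, f) -> sqint u /\ sqint f.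
Hypothesis saT : op_adjoint T = T.
Hypothesis saS : self_adjoint (op_closure (op_restrict T D0)).

Let S := op_closure (op_restrict T D0).

Let adjT u f v w : T (u, f) -> T (v, w) -> L2dot f v = L2dot u w.
Proof. by move=> Tuf; rewrite -{1}saT => -[_ _]; exact. Qed.

(** An adjoint is closed, so T contains the closure of its restriction. *)
Let ST v w : S (v, w) -> T (v, w).
Proof.
move=> Svw; have [sv sw _] := Svw; rewrite -saT; split; [exact: sv | exact: sw | move=> u f Tuf].
have [su sf] := TL2 Tuf.
have [v_ [w_ [Tn vv ww]]] := closure_seq Svw.
have sn n := TL2 (proj1 (Tn n)).
exact: (@l2cvg_L2dot (fun=> f) v_ f v f v (fun=> u) w_ u w (fun=> sf) (fun n => proj1 (sn n)) sf sv
  (fun=> su) (fun n => proj2 (sn n)) su sw (@l2cvg_cst _ _ _ mu _ f) vv (@l2cvg_cst _ _ _ mu _ u) ww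
  erefl erefl (fun n => adjT Tuf (proj1 (Tn n)))).
Qed.

(** A self-adjoint operator has no proper symmetric extension: S is contained in T, and the symmetry
    of T puts T inside the adjoint of S, which is S. *)
Lemma core_seq v w : T (v, w) -> exists v_ w_ : nat -> spinor,
  [/\ forall n, T (v_ n, w_ n), forall n, D0 (v_ n), l2cvg mu v_ v & l2cvg mu w_ w].
Proof.
move=> Tvw; have Svw : S (v, w).
  rewrite /S; case: saS => _ <-; have [sv sw] := TL2 Tvw.
  by split; [exact: sv | exact: sw | move=> u f /ST Tuf; exact: adjT Tuf Tvw].
have [v_ [w_ [Tn vv ww]]] := closure_seq Svw.
by exists v_, w_; split; [move=> n; exact: (proj1 (Tn n)) | move=> n; exact: (proj2 (Tn n)) | exact: vv | exact: ww].
Qed.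

(** The criterion by which functions are shown to lie in the domain: symmetry against the core
    extends to the whole graph by approximation. *)
Lemma core_adjoint v w : sqint v -> sqint w ->
  (forall u f, T (u, f) -> D0 u -> L2dot f v = L2dot u w) -> T (v, w).
Proof.
move=> sv sw H; rewrite -saT; split; [exact: sv | exact: sw | move=> u f Tuf]; have [su sf] := TL2 Tuf.
have [u_ [f_ [Tn Dn uu ff]]] := core_seq Tuf.
have sn n := TL2 (Tn n).
exact: (@l2cvg_L2dot f_ (fun=> v) f v f v u_ (fun=> w) u w (fun n => proj2 (sn n)) (fun=> sv) sf sv
  (fun n => proj1 (sn n)) (fun=> sw) su sw ff (@l2cvg_cst _ _ _ mu _ v) uu (@l2cvg_cst _ _ _ mu _ w)
  erefl erefl (fun n => H _ _ (Tn n) (Dn n))).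
Qed.

Lemma core_dense v : sqint v -> exists u_ : nat -> spinor,
  (forall n, D0 (u_ n) /\ sqint (u_ n)) /\ l2cvg mu u_ v.
Proof.
move=> sv; case: saS => dS _.
(* Two approximations with error 1/(n+1) each, from v into the domain of S and from there into [D0];
   [ipDD_le] doubles the sum of the squares, hence 4. *)
have H n : exists u, (D0 u /\ sqint u) /\ ip (u \- v) (u \- v) <= 4 * n.+1%:R^-1 ^+ 2.
  have t0 : 0 < n.+1%:R^-1 :> R by rewrite invr_gt0.
  have [u [f [su sf Suf]] uv] := dS v sv _ t0.
  have [p [q [[Tpq Dp] pu _]]] := Suf _ t0.
  have [sp _] := TL2 Tpq; exists p; split; first exact: (conj Dp sp).
  have -> : p \- v = (p \- u) \+ (u \- v) by apply/funext => x /=; rewrite addrA subrK.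
  apply: (le_trans (ipDD_le (sqintB sp su) (sqintB su sv))).
  have H1 := L2norm_lt_sqr pu; have H2 := L2norm_lt_sqr uv.
  have : ip (p \- u) (p \- u) + ip (u \- v) (u \- v) <= n.+1%:R^-1 ^+ 2 + n.+1%:R^-1 ^+ 2 := lerD H1 H2.
  by move: (_ + _) (_ ^+ 2) => a b; lra.
have [u_ Hu] := choice H; exists u_; split; first by move=> n; have [] := Hu n.
by apply: (@l2cvg_of_le _ _ 4) => n; have [] := Hu n.
Qed.

(** Duality: along elements of [D0] tending to w the hypothesis becomes |w|^2 <= B |w|. It yields
    uniqueness statements with B = 0, and strong from weak convergence of gradients. *)
Lemma ip_le_of_dense w (B : R) : 0 <= B -> sqint w ->
  (forall chi, D0 chi -> sqint chi -> ip w chi <= B * Num.sqrt (ip chi chi)) ->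
  ip w w <= B ^+ 2.
Proof.
move=> B0 sw H; have [chi [Dchi cw]] := core_dense sw.
have sc n : sqint (chi n) by have [] := Dchi n.
have L1 := l2cvg_ip (fun=> sw) sc sw sw (@l2cvg_cst _ _ _ mu _ w) cw.
have L2 : B * Num.sqrt (ip (chi n) (chi n)) @[n --> \oo] --> B * Num.sqrt (ip w w).
  apply: cvgMr; apply: continuous_cvg; first exact: sqrt_continuous.
  exact: l2cvg_ip.
have : ip w w <= B * Num.sqrt (ip w w).
  apply: (ler_cvg_to L1 L2); apply: nearW => n; apply: H => //.
  by have [] := Dchi n.
set s := Num.sqrt (ip w w); have -> : ip w w = s ^+ 2 by rewrite sqr_sqrtr// ip_ge0.
have s0 : 0 <= s by exact: sqrtr_ge0.
have [->|s1] := eqVneq s 0; first by rewrite expr0n sqr_ge0.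
rewrite expr2 ler_pM2r; last by rewrite lt_def s1.
by move=> sB; rewrite -expr2 lerXn2r// nnegrE.
Qed.

End core.

End L2_real_form.

(** * The a priori estimate *)

Section test_limits.
Context {R : realType} {d N : nat}.
Local Notation spinor := ('rV[R]_d -> 'cV[R[i]]_N).
Local Notation mu := (lebesgue_rV R d).
Local Notation ip := (ip mu).
Local Notation sqint := (sqint mu).
Implicit Types (u v w phi : spinor) (g : 'I_d -> spinor).
Variables (alpha : 'I_d -> 'M[R[i]]_N) (beta : 'M[R[i]]_N).
Hypothesis dm : dirac_matrices alpha beta.

(** The pair lies in the H^1 closure of the test functions. In this form Hardy's inequality and the
    identities for the kinetic term pass from test functions to eigenfunctions. *)
Definition test_limit u g := exists phi_ : nat -> spinor,
  [/\ forall n, test_functions (phi_ n), l2cvg mu phi_ u &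
      forall j, l2cvg mu (fun n => pderiv j (phi_ n)) (g j)].

Lemma sqint_kinetic g : (forall j, sqint (g j)) -> sqint (kinetic alpha g).
Proof.
move=> sg; apply: sqintZ.
by apply: (@sqint_sum _ _ _ mu _ _ _ (fun j x => alpha j *m g j x)) => j; exact: sqintM.
Qed.

Lemma l2cvg_kinetic (g_ : nat -> 'I_d -> spinor) g :
  (forall n j, sqint (g_ n j)) -> (forall j, sqint (g j)) ->
  (forall j, l2cvg mu (g_^~ j) (g j)) ->
  l2cvg mu (fun n => kinetic alpha (g_ n)) (kinetic alpha g).
Proof.
move=> sg_ sg gg; apply: (@l2cvgZ _ _ _ _ _ (- 'i) (fun n x => \sum_j alpha j *m g_ n j x)).
- by move=> n; apply: (@sqint_sum _ _ _ mu _ _ _ (fun j x => alpha j *m g_ n j x)) => j; exact: sqintM.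
- by apply: (@sqint_sum _ _ _ mu _ _ _ (fun j x => alpha j *m g j x)) => j; exact: sqintM.
- apply: (@l2cvg_sum _ _ _ _ _ _ _ (fun j n x => alpha j *m g_ n j x) (fun j x => alpha j *m g j x)).
  + by move=> j n; exact: sqintM.
  + by move=> j; exact: sqintM.
  + move=> j; exact: (l2cvgM (alpha j) (fun n => sg_ n j) (sg j) (gg j)).
Qed.

Section limit.
Variables (u : spinor) (g : 'I_d -> spinor).
Hypotheses (su : sqint u) (sg : forall j, sqint (g j)) (ug : test_limit u g).

(** For fixed eps the weight is bounded by 1/eps, so the inequality survives L^2 limits; only
    afterwards does eps tend to 0. *)
Lemma test_limit_hardy : (2 < d)%N -> sqint (over_norm u) /\
  ip (over_norm u) (over_norm u) <= (2 / (d%:R - 2)) ^+ 2 * \sum_j ip (g j) (g j).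
Proof.
move=> d2; have [phi_ [tp pu pg]] := ug; apply: hardy_limit => // eps eps0.
have sp n := sqint_test (tp n); have sD n j := sqint_test (test_pderiv j (tp n)).
have sw n := sqint_hardy_weight eps0 (sp n); have swu := sqint_hardy_weight eps0 su.
have e0 : 0 <= eps^-1 by rewrite invr_ge0 ltW.
have pw : l2cvg mu (fun n x => (hardy_weight eps x)%:C *: phi_ n x) (fun x => (hardy_weight eps x)%:C *: u x).
  apply: (l2cvg_le e0 sp sw su swu _ pu) => n x; rewrite -scalerBr cnormZ ger0_norm.
    by rewrite ler_wpM2r ?cnorm_ge0// hardy_weight_le.
  by rewrite ltW// hardy_weight_gt0.
have L1 := l2cvg_ip sw sp swu su pw pu.
have L2 : (2 / (d%:R - 2)) ^+ 2 * \sum_j ip (pderiv j (phi_ n)) (pderiv j (phi_ n)) @[n --> \oo] -->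
    (2 / (d%:R - 2)) ^+ 2 * \sum_j ip (g j) (g j).
  apply: cvgMr; apply: (@cvg_sum_seq _ _ _ (fun j n => ip (pderiv j (phi_ n)) (pderiv j (phi_ n)))) => j.
  exact: (l2cvg_ip (fun n => sD n j) (fun n => sD n j) (sg j) (sg j) (pg j) (pg j)).
by apply: (ler_cvg_to L1 L2); apply: nearW => n; exact: hardy_test.
Qed.

Lemma test_limit_kinetic : ip (kinetic alpha g) (kinetic alpha g) = \sum_j ip (g j) (g j).
Proof.
have [phi_ [tp pu pg]] := ug; have sD n j := sqint_test (test_pderiv j (tp n)).
have sK n := sqint_kinetic (sD n); have sKg := sqint_kinetic sg.
have pK := l2cvg_kinetic sD sg pg.
have L1 := l2cvg_ip sK sK sKg sKg pK pK.
have L2 : \sum_j ip (pderiv j (phi_ n)) (pderiv j (phi_ n)) @[n --> \oo] --> \sum_j ip (g j) (g j).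
  apply: (@cvg_sum_seq _ _ _ (fun j n => ip (pderiv j (phi_ n)) (pderiv j (phi_ n)))) => j.
  exact: (l2cvg_ip (fun n => sD n j) (fun n => sD n j) (sg j) (sg j) (pg j) (pg j)).
rewrite (_ : (fun _ => _) = (fun n => \sum_j ip (pderiv j (phi_ n)) (pderiv j (phi_ n)))) in L1.
  exact: (cvg_unique _ L1 L2).
by apply/funext => n; exact: (kinetic_test_norm dm (tp n)).
Qed.

Lemma test_limit_beta : ip (fun x => beta *m u x) (kinetic alpha g) = 0.
Proof.
have [phi_ [tp pu pg]] := ug; have sp n := sqint_test (tp n).
have sD n j := sqint_test (test_pderiv j (tp n)).
have L1 := l2cvg_ip (fun n => sqintM beta (sp n)) (fun n => sqint_kinetic (sD n)) (sqintM beta su)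
  (sqint_kinetic sg) (l2cvgM beta sp su pu) (l2cvg_kinetic sD sg pg).
rewrite (_ : (fun _ => _) = (fun=> 0)) in L1; first exact: (cvg_unique _ L1 (cvg_cst 0)).
by apply/funext => n; exact: (ip_beta_kinetic_test dm (tp n)).
Qed.

End limit.

Lemma test_limit_cst phi : test_functions phi -> test_limit phi (fun j => pderiv j phi).
Proof.
move=> tp; exists (fun=> phi); split; first by [].
  exact: l2cvg_cst.
by move=> j; exact: l2cvg_cst.
Qed.

Lemma ipBB_le u v : sqint u -> sqint v -> ip (u \- v) (u \- v) <= 2 * (ip u u + ip v v).
Proof.
move=> su sv; have H := ip_ge0 mu (u \+ v).
rewrite (ipDl su sv (sqintD su sv)) (ipDr su sv su) (ipDr su sv sv) (ipC mu v u) in H.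
rewrite (ipBl su sv (sqintB su sv)) (ipBr su sv su) (ipBr su sv sv) (ipC mu v u).
move: H; move: (ip u u) (ip v v) (ip u v) => a b c; lra.
Qed.

End test_limits.

Section dirac_core.
Context {R : realType} {d N : nat}.
Local Notation spinor := ('rV[R]_d -> 'cV[R[i]]_N).
Local Notation mu := (lebesgue_rV R d).
Local Notation ip := (ip mu).
Local Notation sqint := (sqint mu).
Implicit Types (u v w f phi psi : spinor) (g : 'I_d -> spinor).
Variables (alpha : 'I_d -> 'M[R[i]]_N) (beta : 'M[R[i]]_N) (m c C1 : R)
  (W : 'rV[R]_d -> 'M[R[i]]_N).
Hypothesis dm : dirac_matrices alpha beta.
Hypothesis d_gt2 : (2 < d)%N.
Hypothesis measurable_W : forall a b,
  measurable_fun setT (fun x => complex.Re (W x a b)) /\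
  measurable_fun setT (fun x => complex.Im (W x a b)).
Hypothesis C1_ge0 : 0 <= C1.
Hypothesis W_bound : forall x (v : 'cV[R[i]]_N), cnorm (W x *m v) <= C1 * (inv_norm x * cnorm v).
Hypothesis C1_small : 4 * C1 < d%:R - 2.

(** The differential expression with V split as W + c and with the gradient as a separate
    argument. *)
Definition dirac_formal u g : spinor := fun x =>
  kinetic alpha g x + m%:C *: (beta *m u x) + (W x *m u x + c%:C *: u x).

Lemma hardy_test_over_norm psi : test_functions psi -> sqint (over_norm psi) /\
  ip (over_norm psi) (over_norm psi) <=
  (2 / (d%:R - 2)) ^+ 2 * \sum_j ip (pderiv j psi) (pderiv j psi).
Proof.
move=> tp; apply: test_limit_hardy d_gt2; first exact: sqint_test.
  by move=> j; apply: sqint_test; exact: test_pderiv.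
exact: test_limit_cst.
Qed.

Lemma sqint_potential u : sqint u -> sqint (over_norm u) ->
  sqint (fun x => W x *m u x) /\
  ip (fun x => W x *m u x) (fun x => W x *m u x) <= C1 ^+ 2 * ip (over_norm u) (over_norm u).
Proof.
move=> [mu_ _] so; have H x : cnorm (W x *m u x) <= C1 * cnorm (over_norm u x).
  by rewrite cnorm_over_norm; exact: W_bound.
have sW : sqint (fun x => W x *m u x).
  by apply: (sqint_le (measurable_spinor_mulmx measurable_W mu_) so H).
by split; [exact: sW | exact: (ip_le_scaled C1_ge0 sW so H)].
Qed.

(** The matrix -(m beta + c): the kinetic term of psi is f plus this matrix applied to psi, minus W
    psi. *)
Definition shift_matrix : 'M[R[i]]_N := (- m)%:C *: beta + (- c%:C)%:M.

(** With o the squared operator norm, |K|^2 <= 2 (2 (|f|^2 + o |psi|^2) + |K|^2 / 4); absorbing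
    |K|^2 / 2 on the left leaves the factor 8. *)
Definition apriori_constant : R := 8 * (1 + opnorm shift_matrix ^+ 2).

(* By Hardy's inequality |W psi| <= 2 C1/(d-2) |grad psi| with 2 C1/(d-2) < 1/2, and |grad psi| is
   the norm of the kinetic term, which therefore absorbs W psi. *)
Lemma dirac_apriori psi f : test_functions psi -> sqint f ->
  {ae mu, forall x, f x = dirac_formal psi (fun j => pderiv j psi) x} ->
  \sum_j ip (pderiv j psi) (pderiv j psi) <= apriori_constant * (ip f f + ip psi psi).
Proof.
move=> tp sf fE; have sp := sqint_test tp; have sD j := sqint_test (test_pderiv j tp).
set P := \sum_j _; set K := kinetic alpha (fun j => pderiv j psi).
have sK : sqint K by exact: sqint_kinetic.
have KP : ip K K = P by exact: (kinetic_test_norm dm tp).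
have [so Ho] := hardy_test_over_norm tp; rewrite -/P in Ho.
have [sW HW] := sqint_potential sp so.
pose Wp x := W x *m psi x; pose B x := shift_matrix *m psi x.
have sB : sqint B by exact: sqintM.
have sA := sqintD sf sB.
have KE : {ae mu, forall x, K x = ((f \+ B) \- Wp) x}.
  apply: filterS fE => x /= ->; rewrite /dirac_formal -/K /B /Wp /shift_matrix.
  rewrite mulmxDl -scalemxAl mul_scalar_mx !rmorphN !scaleNr.
  move: (K x) (_ *: (beta *m _)) (W x *m _) (_ *: psi x) => k b0 w0 c0.
  by rewrite !addrA (addrAC _ c0) addrK (addrAC _ w0) addrK addrK.
have : ip K K <= 2 * (ip (f \+ B) (f \+ B) + ip Wp Wp).
  have sWp : sqint Wp := sW.
  have sAW := sqintB sA sWp.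
  have E1 := eq_ip_ae (proj1 sK) (proj1 sAW) (proj1 sK) KE.
  have E2 := eq_ip_ae (proj1 sK) (proj1 sAW) (proj1 sAW) KE.
  by rewrite E1 ipC E2; exact: (ipBB_le sA sWp).
have := ipDD_le sf sB.
have : ip B B <= opnorm shift_matrix ^+ 2 * ip psi psi.
  exact: (ip_le_scaled (opnorm_ge0 _) sB sp (fun x => opnorm_le _ _)).
have : ip Wp Wp <= 4^-1 * P.
  apply: (le_trans HW); apply: (le_trans (ler_wpM2l (sqr_ge0 _) Ho)).
  have P0 : 0 <= P by rewrite -KP ip_ge0.
  rewrite mulrA ler_wpM2r// -exprMn.
  have d20 : 0 < d%:R - 2 :> R by rewrite subr_gt0 ltr_nat.
  rewrite (_ : 4^-1 = (2^-1) ^+ 2 :> R); last by rewrite expr2 -invfM; congr _^-1; ring.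
  rewrite lerXn2r ?nnegrE ?mulr_ge0 ?invr_ge0 ?(ltW d20)//.
  rewrite mulrA ler_pdivrMr//; move: C1_small; move: (d%:R - 2) => D; lra.
have ff0 := ip_ge0 mu f; have pp0 := ip_ge0 mu psi.
rewrite KP /apriori_constant; move: (sqr_ge0 (opnorm shift_matrix)) ff0 pp0.
move: (opnorm _ ^+ 2) (ip f f) (ip psi psi) (ip (f \+ B) (f \+ B)) (ip Wp Wp) (ip B B).
move=> o F G X Y Z o0 F0 G0 H1 H2 H3 H4.
have := mulr_ge0 o0 F0; nra.
Qed.

End dirac_core.

(** * Dilations *)

Section dilations.
Context {R : realType} {d N : nat}.
Local Notation spinor := ('rV[R]_d -> 'cV[R[i]]_N).
Local Notation e j := (delta_mx 0 j : 'rV[R]_d).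
Local Notation mu := (lebesgue_rV R d).
Local Notation ip := (ip mu).
Local Notation sqint := (sqint mu).
Implicit Types (u v w phi : spinor) (s : R).

Definition dil s u : spinor := fun x => u (s *: x).

Lemma measurable_comp_dil s (f : 'rV[R]_d -> R) :
  measurable_fun setT f -> measurable_fun setT (fun x : 'rV[R]_d => f (s *: x)).
Proof.
move=> mf; have := measurableT_comp mf (@measurable_affine_rV R d s 0).
by congr measurable_fun; apply/funext => x /=; rewrite addr0.
Qed.

Lemma measurable_dil s u : measurable_spinor u -> measurable_spinor (dil s u).
Proof.
move=> mu_ k; have [m1 m2] := mu_ k.
by split; [exact: (measurable_comp_dil s m1) | exact: (measurable_comp_dil s m2)].
Qed.

Lemma integrable_dil s (f : 'rV[R]_d -> R) : 0 < s -> mu.-integrable setT (EFin \o f) ->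
  mu.-integrable setT (EFin \o (fun x => f (s *: x))).
Proof.
move=> s0 If; have := integrable_affine 0 s0 If.
by congr (mu.-integrable _ _); apply/funext => x /=; rewrite addr0.
Qed.

Lemma Rintegral_dil s (f : 'rV[R]_d -> R) : 0 < s -> mu.-integrable setT (EFin \o f) ->
  (\int[mu]_x f (s *: x))%R = s ^- d * (\int[mu]_x f x)%R.
Proof.
move=> s0 If; rewrite -(Rintegral_affine 0 s0 If).
by apply: eq_Rintegral => x _; rewrite addr0.
Qed.

Lemma sqint_dil s u : 0 < s -> sqint u -> sqint (dil s u).
Proof.
move=> s0 su; have [mu_ _] := su; apply: integrable_sqint; first exact: measurable_dil.
exact: (integrable_dil s0 (sqint_integrable su)).
Qed.

Lemma ip_dil s u v : 0 < s -> sqint u -> sqint v ->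
  ip (dil s u) (dil s v) = s ^- d * ip u v.
Proof. by move=> s0 su sv; exact: (Rintegral_dil s0 (integrable_rdot su sv)). Qed.

Lemma dilK s u : 0 < s -> dil s (dil s^-1 u) = u.
Proof.
by move=> s0; apply/funext => x; rewrite /dil scalerA mulVf ?gt_eqF// scale1r.
Qed.

Lemma is_derive_of_line (f : 'rV[R]_d -> R) (x v : 'rV[R]_d) (df : R) :
  is_derive (0 : R) 1 (fun r => f (x + r *: v)) df -> is_derive x v f df.
Proof.
have E : (fun h => h^-1 *: (((fun r => f (x + r *: v)) \o shift 0) (h *: 1) - f (x + 0 *: v))) =
         (fun h : R => h^-1 *: ((f \o shift x) (h *: v) - f x)).
  apply/funext => h /=; congr (_ *: (f _ - f _)); last by rewrite scale0r addr0.
  by rewrite /shift /= addr0 scaler1 addrC.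
by case=> fd dfE; split; move: fd dfE; rewrite /derivable /derive E.
Qed.

Lemma is_derive_dilation (f : 'rV[R]_d -> R) (x v : 'rV[R]_d) s (df : R) :
  is_derive (s *: x) v f df -> is_derive x v (fun y : 'rV[R]_d => f (s *: y)) (s * df).
Proof.
move=> H; apply: is_derive_of_line.
rewrite (_ : (fun _ => _) = (fun q => f (s *: x + q *: v)) \o (fun r : R => s * r)); last first.
  by apply/funext => r /=; rewrite scalerDr scalerA.
have H0 : is_derive (s * 0) 1 (fun q => f (s *: x + q *: v)) df.
  by apply: is_derive_line; rewrite mulr0 scale0r addr0.
have Hs : is_derive (0 : R) 1 (fun r : R => s * r) s.
  have := @is_deriveZ R R R id s 0 1 1 (@is_derive_id _ _ _ _).
  by rewrite /GRing.scale /= mulr1.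
by have := @is_derive1_comp _ _ _ _ _ _ H0 Hs; rewrite mulrC.
Qed.

Lemma pderiv_dil s phi j : smooth_on setT phi ->
  pderiv j (dil s phi) = (fun x => s%:C *: dil s (pderiv j phi) x).
Proof.
move=> sp; apply/funext => x; apply/matrixP => a b; rewrite (ord1 b).
have [Pa Pa'] := @pderivE _ _ _ phi j (s *: x) a (fun k => smooth_derivable sp k (s *: x) j).
have D1 := is_derive_dilation Pa; have D2 := is_derive_dilation Pa'.
apply/eqP; rewrite eq_complex; apply/andP; split; apply/eqP.
  rewrite [in LHS]mxE [in RHS]mxE cReM /= mul0r subr0.
  exact: (@derive_val _ _ _ _ _ _ _ D1).
rewrite [in LHS]mxE [in RHS]mxE cImM /= mul0r addr0.
exact: (@derive_val _ _ _ _ _ _ _ D2).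
Qed.

Lemma continuous_dil s (f : 'rV[R]_d -> R) : continuous f -> continuous (fun y : 'rV[R]_d => f (s *: y)).
Proof.
move=> cf x; have cs : {for x, continuous (fun y : 'rV[R]_d => s *: y)} by exact: scaler_continuous.
exact: (continuous_comp cs (cf _)).
Qed.

Lemma smooth_scale (c : R[i]) phi : smooth_on setT phi -> smooth_on setT (fun x => c *: phi x).
Proof.
move=> sp; have := smooth_comb c%:M sp (test_smooth (@test0 R d N)).
by congr smooth_on; apply/funext => z; rewrite addr0 mul_scalar_mx.
Qed.

Lemma foldr_pderiv_dil s phi l : smooth_on setT phi ->
  foldr (@pderiv R d N 1) (dil s phi) l =
  dil s (fun x => (s ^+ size l)%:C *: foldr (@pderiv R d N 1) phi l x).
Proof.
move=> sp; elim: l => [|j l ih].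
  by apply/funext => y; rewrite /dil /= expr0 rmorph1 scale1r.
rewrite [LHS]/= ih; have sl := smooth_foldr l sp.
rewrite (pderiv_dil s j (smooth_scale _ sl)) (pderiv_scale _ j sl).
by apply/funext => y; rewrite /dil /= scalerA exprS rmorphM.
Qed.

Lemma smooth_dil s phi : smooth_on setT phi -> smooth_on setT (dil s phi).
Proof.
move=> sp l x a b _; rewrite /= (foldr_pderiv_dil s l sp) (ord1 b).
move: (smooth_scale (s ^+ size l)%:C (smooth_foldr l sp)).
move: (fun x => _ *: _) => psi {}sp; have [c1 c2] := smooth_continuous sp a.
split; [exact: (@continuous_dil s (re_entry psi a 0) c1 x) | exact: (@continuous_dil s (im_entry psi a 0) c2 x) | move=> j].
have [Pa Pa'] := @pderivE _ _ _ psi j (s *: x) a (fun k => smooth_derivable sp k (s *: x) j).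
split; first by have [] := is_derive_dilation Pa.
by have [] := is_derive_dilation Pa'.
Qed.

Lemma test_dil s phi : 0 < s -> test_functions phi -> test_functions (dil s phi).
Proof.
move=> s0 tp; have [M HM] := test_support tp.
apply: (@test_intro _ _ _ _ (M / s)); first exact/smooth_dil/test_smooth.
by move=> x; rewrite ltr_pdivrMr// => Mx; apply: HM; rewrite normrZ gtr0_norm// mulrC.
Qed.

(** The test function is dilated back by 1/s, after which both sides carry the same power of s. *)
Lemma weak_pderiv_dil s j u g : 0 < s -> sqint u -> sqint g -> weak_pderiv j u g ->
  weak_pderiv j (dil s u) (fun x => s%:C *: dil s g x).
Proof.
move=> s0 su sg wu; apply: ip_weak_pderiv => phi tp.
have sV0 : 0 < s^-1 by rewrite invr_gt0.
have tq : test_functions (dil s^-1 phi) by exact: test_dil.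
have sq := sqint_test tq; have sDq := sqint_test (test_pderiv j tq).
have Dphi : pderiv j phi = (fun x => s%:C *: dil s (pderiv j (dil s^-1 phi)) x).
  by rewrite -(pderiv_dil s j (test_smooth tq)) dilK.
rewrite Dphi (ipZr s (sqint_dil s0 sDq) (sqint_dil s0 su)) (ip_dil s0 su sDq).
rewrite (weak_pderiv_ip wu tq) (ipZl s (sqint_dil s0 sg) (sqint_test tp)).
rewrite -[in RHS](dilK phi s0) (ip_dil s0 sg sq).
by rewrite !mulrN.
Qed.

Lemma over_norm_dil s u : 0 < s -> over_norm (dil s u) = (fun x => s%:C *: dil s (over_norm u) x).
Proof.
move=> s0; apply/funext => x; rewrite /over_norm /dil scalerA -rmorphM; congr (_%:C *: _).
by rewrite /inv_norm enormZ gtr0_norm// invfM mulrA mulfV ?mul1r// gt_eqF.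
Qed.

Lemma sqint_over_norm_dil s u : 0 < s -> sqint (over_norm u) -> sqint (over_norm (dil s u)).
Proof.
move=> s0 so; have := sqintZ s%:C (sqint_dil s0 so).
by rewrite -(over_norm_dil u s0).
Qed.

(** Scales tending to 1 from above: dilation by s >= 1 neither enlarges the radius of a support nor
    increases the L^2 norm. *)
Definition step (n : nat) : R := 1 + n.+1%:R^-1.

Lemma step_gt0 n : 0 < step n. Proof. by rewrite ltr_wpDr// invr_ge0. Qed.

Lemma step_ge1 n : 1 <= step n. Proof. by rewrite lerDl invr_ge0. Qed.

Lemma step_sub1 n : step n - 1 = n.+1%:R^-1.
Proof. by rewrite /step [1 + _]addrC addrK. Qed.

Lemma step_scale_cvg (x : 'rV[R]_d) : step n *: x @[n --> \oo] --> x.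
Proof.
apply: (@cvg_norm_sub0 _ _ _ _ (fun n => n.+1%:R^-1 * `|x|)).
  move=> n; rewrite /step scalerDl scale1r addrAC subrr add0r normrZ ger0_norm//.
rewrite -[X in _ --> X](mul0r `|x|); apply: cvgMl; exact: cvg_harmonic.
Qed.

Lemma step_comp_cvg (f : 'rV[R]_d -> R) (x : 'rV[R]_d) : continuous f ->
  f (step n *: x) @[n --> \oo] --> f x.
Proof. by move=> cf; apply: continuous_cvg (cf x) (@step_scale_cvg x). Qed.

Lemma rdot_entries_cvg0 (z_ : nat -> 'cV[R[i]]_N) (w : 'cV[R[i]]_N) :
  (forall k, complex.Re (z_ n k 0) @[n --> \oo] --> (0 : R)) ->
  (forall k, complex.Im (z_ n k 0) @[n --> \oo] --> (0 : R)) ->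
  rdot (z_ n) w @[n --> \oo] --> (0 : R).
Proof.
move=> zr zi; rewrite [X in _ --> X](_ : 0 = \sum_(k < N) 0 :> R); last by rewrite big1.
apply: (@cvg_sum_seq _ _ _ (fun k n => complex.Re (z_ n k 0) * complex.Re (w k 0) +
   complex.Im (z_ n k 0) * complex.Im (w k 0))) => k.
rewrite -[X in _ --> X](addr0 0); apply: cvgD.
  by rewrite -[X in _ --> X](mul0r (complex.Re (w k 0))); apply: cvgMl; exact: zr.
by rewrite -[X in _ --> X](mul0r (complex.Im (w k 0))); apply: cvgMl; exact: zi.
Qed.

Lemma dil_test_cvg phi : test_functions phi -> l2cvg mu (fun n => dil (step n) phi) phi.
Proof.
move=> tp; have sp := test_smooth tp; have [M HM] := test_support tp.
pose r x := rdot (phi x) (phi x).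
have r0 x : M < `|x| -> r x = 0 by move=> /HM; rewrite /r => ->; rewrite rdot0l.
have [B B0 HB] := bounded_of_support (continuous_rdot sp sp) r0.
(* Both values of phi have squared norm at most B, so their difference has squared norm at most 4
   B. *)
have [g ig Hg] := @integrable_bound R d (4 * B) M.
have mp := smooth_measurable sp.
apply: (@l2cvg_dominated _ _ _ mu _ _ _ g).
- by move=> n; exact: measurable_dil.
- exact: mp.
- exact: ig.
- move=> n x; rewrite /dil; apply: (le_trans (ler_norm _)); apply: Hg.
    rewrite ger0_norm ?sqr_ge0//.
    have H1 : cnorm (phi (step n *: x)) ^+ 2 <= B.
      by rewrite cnorm_sqr (le_trans (ler_norm _))//; exact: HB.
    have H2 : cnorm (phi x) ^+ 2 <= B.
      by rewrite cnorm_sqr (le_trans (ler_norm _))//; exact: HB.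
    have := cnormD (phi (step n *: x)) (- phi x); rewrite cnormN.
    have := cnorm_ge0 (phi (step n *: x) - phi x).
    move: H1 H2 (cnorm_ge0 (phi (step n *: x))) (cnorm_ge0 (phi x)).
    move: (cnorm (phi (step n *: x))) (cnorm (phi x)) (cnorm (phi (step n *: x) - phi x)) => a b c *.
    have := sqr_ge0 (a - b); nra.
  move=> Mx; have Ms : M < `|step n *: x|.
    by apply: (lt_le_trans Mx); rewrite normrZ gtr0_norm ?step_gt0// ler_peMl// step_ge1.
  by rewrite (HM x Mx) (HM _ Ms) subrr cnorm0 expr0n.
- move=> x; apply: cnorm_cvg0 => w; apply: rdot_entries_cvg0 => k.
    have [c1 _] := smooth_continuous sp k.
    have L : re_entry phi k 0 (step n *: x) @[n --> \oo] --> re_entry phi k 0 x.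
      exact: (@step_comp_cvg _ x c1).
    have -> : (fun n => complex.Re ((dil (step n) phi x - phi x) k 0)) =
        (fun n => re_entry phi k 0 (step n *: x) - re_entry phi k 0 x).
      by apply/funext => n; rewrite /dil !mxE cReD cReN.
    rewrite -[X in _ --> X](subrr (re_entry phi k 0 x)); exact: (cvgB L (@cvg_cst _ _ _ _ _)).
  have [_ c2] := smooth_continuous sp k.
  have L : im_entry phi k 0 (step n *: x) @[n --> \oo] --> im_entry phi k 0 x.
    exact: (@step_comp_cvg _ x c2).
  have -> : (fun n => complex.Im ((dil (step n) phi x - phi x) k 0)) =
      (fun n => im_entry phi k 0 (step n *: x) - im_entry phi k 0 x).
    by apply/funext => n; rewrite /dil !mxE cImD cImN.
  rewrite -[X in _ --> X](subrr (im_entry phi k 0 x)); exact: (cvgB L (@cvg_cst _ _ _ _ _)).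
Qed.

(** Continuity of dilations at scale 1, extended from test functions by density, since these
    dilations do not increase the norm. *)
Lemma dil_cvg v : sqint v ->
  (exists u_ : nat -> spinor, (forall n, test_functions (u_ n)) /\ l2cvg mu u_ v) ->
  l2cvg mu (fun n => dil (step n) v) v.
Proof.
move=> sv [u_ [tu uv]]; have su n := sqint_test (tu n).
(* The difference is (a + c) + b with |a| <= |c|; doubling twice gives 4 |a|^2 + 4 |c|^2 + 2 |b|^2,
   hence the constants 8 and 2. *)
have bound k n : ip (dil (step n) v \- v) (dil (step n) v \- v) <=
    8 * ip (u_ k \- v) (u_ k \- v) + 2 * ip (dil (step n) (u_ k) \- u_ k) (dil (step n) (u_ k) \- u_ k).
  pose a := dil (step n) (v \- u_ k); pose b := dil (step n) (u_ k) \- u_ k; pose c := u_ k \- v.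
  have sc : sqint c := sqintB (su k) sv.
  have sb : sqint b := sqintB (sqint_dil (step_gt0 n) (su k)) (su k).
  have svu := sqintB sv (su k).
  have sa : sqint a := sqint_dil (step_gt0 n) svu.
  have -> : dil (step n) v \- v = (a \+ c) \+ b.
    apply/funext => x; rewrite /a /b /c /dil /=.
    by rewrite addrAC !subrKA.
  have H1 := ipDD_le (sqintD sa sc) sb; have H2 := ipDD_le sa sc.
  have H3 : ip a a <= ip c c.
    rewrite /a (ip_dil (step_gt0 n) svu svu).
    have -> : ip c c = ip (v \- u_ k) (v \- u_ k).
      by apply: eq_Rintegral => x _; rewrite /c /= -[v x - _]opprB rdotNl rdotNr opprK.
    by rewrite ler_piMl ?ip_ge0// invf_le1 ?exprn_gt0 ?step_gt0// exprn_ege1// step_ge1.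
  rewrite -/c -/b; move: H1 H2 H3.
  move: (ip a a) (ip b b) (ip c c) (ip (a \+ c) (a \+ c)) (ip (a \+ c \+ b) (a \+ c \+ b)) => *; lra.
apply/cvgrPdist_le => eps eps0; have e16 : 0 < eps / 16 by rewrite divr_gt0.
have e8 : 0 < eps / 8 by rewrite divr_gt0.
move/cvgrPdist_le : uv => /(_ _ e16) [k _ /(_ k (leqnn k))] /=.
rewrite sub0r normrN ger0_norm ?ip_ge0// => Hk.
move/cvgrPdist_le : (dil_test_cvg (tu k)) => /(_ _ e8); apply: filterS => n.
rewrite !sub0r !normrN !ger0_norm ?ip_ge0// => Hn.
apply: (le_trans (bound k n)); move: Hk Hn.
move: (ip _ _) (ip (dil (step n) (u_ k) \- _) _) => *; lra.
Qed.

End dilations.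

(** * Regularity of the domain and invariance under dilations *)

Section dirac_realisation.
Context {R : realType} {d N : nat}.
Local Notation spinor := ('rV[R]_d -> 'cV[R[i]]_N).
Local Notation mu := (lebesgue_rV R d).
Local Notation ip := (ip mu).
Local Notation sqint := (sqint mu).
Implicit Types (u v w f phi psi chi : spinor) (g : 'I_d -> spinor) (s : R).
Variables (alpha : 'I_d -> 'M[R[i]]_N) (beta : 'M[R[i]]_N) (m c C1 : R)
  (W : 'rV[R]_d -> 'M[R[i]]_N).
Hypothesis dm : dirac_matrices alpha beta.
Hypothesis d_gt2 : (2 < d)%N.
Hypothesis measurable_W : forall a b,
  measurable_fun setT (fun x => complex.Re (W x a b)) /\
  measurable_fun setT (fun x => complex.Im (W x a b)).
Hypothesis C1_ge0 : 0 <= C1.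
Hypothesis W_bound : forall x (v : 'cV[R[i]]_N), cnorm (W x *m v) <= C1 * (inv_norm x * cnorm v).
Hypothesis C1_small : 4 * C1 < d%:R - 2.
Hypothesis W_herm : forall x, W x \is hermsymmx.

Local Notation formal := (dirac_formal alpha beta m c W).

(** The next hypothesis bounds the graph of T from above only. That the domain is large enough is
    extracted from self-adjointness, in [T_intro]. *)
Variable T : set (spinor * spinor).
Hypothesis TP : forall u f, T (u, f) -> [/\ sqint u, sqint f & exists g,
  (forall j, sqint (g j) /\ weak_pderiv j u (g j)) /\ {ae mu, forall x, f x = formal u g x}].
Hypothesis saT : op_adjoint T = T.
Hypothesis saS : self_adjoint (op_closure (op_restrict T test_functions)).

Let TL2 u f : T (u, f) -> sqint u /\ sqint f.
Proof. by case/TP. Qed.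

(** The density of the test functions in L^2 is read off from their being a core. *)
Lemma ae_eq_of_tests u v : sqint u -> sqint v ->
  (forall chi, test_functions chi -> ip u chi = ip v chi) -> {ae mu, forall x, u x = v x}.
Proof.
move=> su sv H; have suv := sqintB su sv.
have : ip (u \- v) (u \- v) <= 0 ^+ 2.
  apply: (ip_le_of_dense TL2 saS (lexx 0) suv) => chi tc sc.
  by rewrite (ipBl su sv sc) (H _ tc) subrr mul0r.
rewrite expr0n /= => H0; have E : ip (u \- v) (u \- v) = 0 by apply/le_anti; rewrite H0 ip_ge0.
by apply: filterS (ip_eq0 suv E) => x /= /eqP; rewrite subr_eq0 => /eqP.
Qed.

Lemma weak_pderiv_unique j u (g h : spinor) : sqint g -> sqint h ->
  weak_pderiv j u g -> weak_pderiv j u h -> {ae mu, forall x, g x = h x}.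
Proof.
move=> sg sh wg wh; apply: ae_eq_of_tests => // chi tc; apply: oppr_inj.
by rewrite -(weak_pderiv_ip wg tc) (weak_pderiv_ip wh tc).
Qed.

Lemma weak_pderiv_test j phi : test_functions phi -> weak_pderiv j phi (pderiv j phi).
Proof.
by move=> tp; apply: ip_weak_pderiv => chi tc; rewrite (ip_pderiv j tp tc) opprK.
Qed.

Lemma ae_all_fin (I : finType) (P : I -> 'rV[R]_d -> Prop) :
  (forall i, {ae mu, forall x, P i x}) -> {ae mu, forall x, forall i, P i x}.
Proof. by move=> H; apply: filter_forall. Qed.

Lemma T_weak u f g : T (u, f) -> (forall j, sqint (g j)) -> (forall j, weak_pderiv j u (g j)) ->
  {ae mu, forall x, f x = formal u g x}.
Proof.
move=> /TP[su sf [h [Hh fE]]] sg wg.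
have /ae_all_fin E : forall j, {ae mu, forall x, h j x = g j x}.
  by move=> j; have [sh wh] := Hh j; exact: (weak_pderiv_unique sh (sg j) wh (wg j)).
apply: filterS2 fE E => x -> Ex.
have S : \sum_j alpha j *m h j x = \sum_j alpha j *m g j x.
  by apply: eq_bigr => j _; rewrite Ex.
by rewrite /dirac_formal /kinetic S.
Qed.

Lemma T_test phi f : T (phi, f) -> test_functions phi ->
  {ae mu, forall x, f x = formal phi (fun j => pderiv j phi) x}.
Proof.
move=> Tf tp; apply: (T_weak Tf) => j.
  by apply: sqint_test; exact: test_pderiv.
exact: weak_pderiv_test.
Qed.

Lemma formal_sub phi psi g g' x :
  formal phi g x - formal psi g' x = formal (phi \- psi) (fun j => g j \- g' j) x.
Proof.
rewrite /dirac_formal /kinetic /=.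
have -> : \sum_j alpha j *m (g j x - g' j x) = \sum_j alpha j *m g j x - \sum_j alpha j *m g' j x.
  by rewrite -sumrB; apply: eq_bigr => j _; rewrite mulmxBr.
rewrite !mulmxBr !scalerBr.
set k := - 'i *: _; set k' := - 'i *: _; set b := m%:C *: _; set b' := m%:C *: _.
set w := W x *m _; set w' := W x *m _; set v := c%:C *: _; set v' := c%:C *: _.
move: k k' b b' w w' v v' => k k' b b' w w' v v'.
by rewrite !opprD addrACA (addrACA k) (addrACA w).
Qed.

(* Testing the weak derivatives against test functions turns the Cauchy bound on the gradients of the
   approximations into convergence, without using completeness of L^2. *)
Lemma h1_approx u f g : T (u, f) -> (forall j, sqint (g j)) -> (forall j, weak_pderiv j u (g j)) ->
  test_limit u g.
Proof.
move=> Tuf sg wg; have [su sf] := TL2 Tuf.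
have [p_ [f_ [Tn tp pu ff]]] := core_seq TL2 saT saS Tuf.
have sp n := sqint_test (tp n); have sfn n := proj2 (TL2 (Tn n)).
have sD n j := sqint_test (test_pderiv j (tp n)).
exists p_; split; [exact: tp | exact: pu | move=> j].
pose A := apriori_constant beta m c.
have A0 : 0 <= A by rewrite mulr_ge0// addr_ge0// sqr_ge0.
pose e n := ip (f_ n \- f) (f_ n \- f) + ip (p_ n \- u) (p_ n \- u).
have e0 : e n @[n --> \oo] --> 0 by rewrite -[X in _ --> X](addr0 0); exact: (cvgD ff pu).
have ege n : 0 <= e n by rewrite addr_ge0 ?ip_ge0.
(* The a priori estimate applies to the difference of two approximations, itself a test function
   whose image is controlled by the graph convergence. *)
have cauchy n k : ip (pderiv j (p_ n) \- pderiv j (p_ k)) (pderiv j (p_ n) \- pderiv j (p_ k)) <=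
    2 * A * (e n + e k).
  have tnk : test_functions (p_ n \- p_ k) := test_sub (tp n) (tp k).
  have sfnk := sqintB (sfn n) (sfn k).
  have fE : {ae mu, forall x, (f_ n \- f_ k) x = formal (p_ n \- p_ k) (fun j => pderiv j (p_ n \- p_ k)) x}.
    apply: filterS2 (T_test (Tn n) (tp n)) (T_test (Tn k) (tp k)) => x /= -> ->.
    rewrite formal_sub; congr (formal _ _ _); apply/funext => i.
    by rewrite (pderiv_sub i (test_smooth (tp n)) (test_smooth (tp k))).
  have H := dirac_apriori dm d_gt2 measurable_W C1_ge0 W_bound C1_small tnk sfnk fE.
  have sub3 (v_ : nat -> spinor) v : (forall n, sqint (v_ n)) -> sqint v ->
      ip (v_ n \- v_ k) (v_ n \- v_ k) <= 2 * (ip (v_ n \- v) (v_ n \- v) + ip (v_ k \- v) (v_ k \- v)).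
    move=> sv_ sv; have -> : v_ n \- v_ k = (v_ n \- v) \- (v_ k \- v).
      by apply/funext => x /=; rewrite opprB subrKA.
    exact: (ipBB_le (sqintB (sv_ n) sv) (sqintB (sv_ k) sv)).
  have Hf := sub3 _ _ sfn sf; have Hp := sub3 _ _ sp su.
  rewrite -(pderiv_sub j (test_smooth (tp n)) (test_smooth (tp k))).
  apply: (@le_trans _ _ (\sum_i ip (pderiv i (p_ n \- p_ k)) (pderiv i (p_ n \- p_ k)))).
    by rewrite (bigD1 j)//= lerDl; apply: sumr_ge0 => i _; exact: ip_ge0.
  apply: (le_trans H); rewrite -/A.
  have -> : 2 * A * (e n + e k) = A * (2 * (e n + e k)) by rewrite (mulrC 2 A) -mulrA.
  apply: (ler_wpM2l A0); rewrite /e.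
  move: Hf Hp; move: (ip _ _) (ip (p_ n \- p_ k) _) => a b.
  move: (ip _ _) (ip (f_ k \- f) _) (ip _ _) (ip (p_ k \- u) _) => *; lra.
have weak_cvg chi : test_functions chi -> ip (pderiv j (p_ k)) chi @[k --> \oo] --> ip (g j) chi.
  move=> tc; have L := l2cvg_ip sp (fun=> sqint_test (test_pderiv j tc)) su (sqint_test (test_pderiv j tc))
    pu (@l2cvg_cst _ _ _ mu _ (pderiv j chi)).
  have -> : ip (g j) chi = - ip u (pderiv j chi) by rewrite (weak_pderiv_ip (wg j) tc) opprK.
  have -> : (fun k => ip (pderiv j (p_ k)) chi) = (fun k => - ip (p_ k) (pderiv j chi)).
    by apply/funext => k; rewrite (ip_pderiv j (tp k) tc).
  exact: cvgN.
(* Against a test function the Cauchy bound passes to the limit in k, where the gradients converge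
   weakly to [g j]; duality turns the result into a norm bound. *)
have bound n : ip (pderiv j (p_ n) \- g j) (pderiv j (p_ n) \- g j) <= 2 * A * e n.
  have c0 : 0 <= 2 * A * e n by rewrite mulr_ge0// mulr_ge0.
  rewrite -(sqr_sqrtr c0); apply: (ip_le_of_dense TL2 saS (sqrtr_ge0 _) (sqintB (sD n j) (sg j))).
  move=> chi tc sc.
  have L1 : ip (pderiv j (p_ n) \- pderiv j (p_ k)) chi @[k --> \oo] --> ip (pderiv j (p_ n) \- g j) chi.
    rewrite (ipBl (sD n j) (sg j) sc).
    have -> : (fun k => ip (pderiv j (p_ n) \- pderiv j (p_ k)) chi) =
        (fun k => ip (pderiv j (p_ n)) chi - ip (pderiv j (p_ k)) chi).
      by apply/funext => k; rewrite (ipBl (sD n j) (sD k j) sc).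
    exact: (cvgB (@cvg_cst _ _ _ _ _) (@weak_cvg _ tc)).
  have L2 : Num.sqrt (2 * A * (e n + e k)) * Num.sqrt (ip chi chi) @[k --> \oo] -->
      Num.sqrt (2 * A * e n) * Num.sqrt (ip chi chi).
    apply: cvgMl; apply: continuous_cvg; first exact: sqrt_continuous.
    apply: cvgMr; rewrite -[X in _ --> X]addr0.
    exact: (cvgD (@cvg_cst _ _ _ _ _) e0).
  apply: (ler_cvg_to L1 L2); apply: nearW => k.
  have sDD := sqintB (sD n j) (sD k j).
  apply: (le_trans (le_trans (ler_norm _) (ip_cauchy_schwarz sDD sc))).
  by apply: ler_wpM2r; [exact: sqrtr_ge0 | rewrite ler_wsqrtr].
apply: (@squeeze_cvgr _ _ _ _ (fun=> 0) (fun n => 2 * A * e n)).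
- by apply: nearW => n; rewrite ip_ge0 bound.
- exact: cvg_cst.
- by rewrite -[X in _ --> X](mulr0 (2 * A)); apply: cvgMr.
Qed.

Lemma sqint_formal v g : sqint v -> sqint (over_norm v) -> (forall j, sqint (g j)) -> sqint (formal v g).
Proof.
move=> sv so sg; have sK := sqint_kinetic alpha sg.
have [sW _] := sqint_potential measurable_W C1_ge0 W_bound sv so.
exact: (sqintD (sqintD sK (sqintZ m%:C (sqintM beta sv))) (sqintD sW (sqintZ c%:C sv))).
Qed.

Lemma ip_kinetic_test phi v g : test_functions phi -> sqint v -> (forall j, sqint (g j)) ->
  (forall j, weak_pderiv j v (g j)) ->
  ip (kinetic alpha (fun j => pderiv j phi)) v = ip phi (kinetic alpha g).
Proof.
move=> tp sv sg wg.
pose psi j : spinor := fun x => (- 'i *: alpha j) *m phi x.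
have tpsi j : test_functions (psi j) by exact: test_mulmx.
have Dpsi j : pderiv j (psi j) = (fun x => (- 'i *: alpha j) *m pderiv j phi x).
  exact: (pderiv_mulmx _ j (test_smooth tp)).
have sD j := sqint_test (test_pderiv j (tpsi j)).
have -> : kinetic alpha (fun j => pderiv j phi) = (fun x => \sum_j pderiv j (psi j) x).
  apply/funext => x; rewrite /kinetic scaler_sumr; apply: eq_bigr => j _.
  by rewrite Dpsi -scalemxAl.
have sB j : sqint (fun x => - 'i *: (alpha j *m g j x)) by exact: (sqintZ _ (sqintM _ (sg j))).
have -> : kinetic alpha g = (fun x => \sum_j - 'i *: (alpha j *m g j x)).
  by apply/funext => x; rewrite /kinetic scaler_sumr.
rewrite (ip_suml _ sD sv) (ip_sumr _ sB (sqint_test tp)); apply: eq_bigr => j _.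
rewrite ipC (weak_pderiv_ip (wg j) (tpsi j)) -[LHS]mulN1r -RintegralZl//; last first.
  exact: (integrable_rdot (sg j) (sqint_test (tpsi j))).
apply: eq_Rintegral => x _; rewrite mulN1r /psi -scalemxAl rdotC.
by rewrite (rdot_iherm _ _ (alpha_herm dm j)) opprK.
Qed.

Lemma ip_formal_test phi v g : test_functions phi -> sqint v -> sqint (over_norm v) ->
  (forall j, sqint (g j)) -> (forall j, weak_pderiv j v (g j)) ->
  ip (formal phi (fun j => pderiv j phi)) v = ip phi (formal v g).
Proof.
move=> tp sv so sg wg; have sp := sqint_test tp; have sD j := sqint_test (test_pderiv j tp).
have [sop _] := hardy_test_over_norm d_gt2 tp.
have sK := sqint_kinetic alpha sD; have sK' := sqint_kinetic alpha sg.
have [sW _] := sqint_potential measurable_W C1_ge0 W_bound sp sop.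
have [sW' _] := sqint_potential measurable_W C1_ge0 W_bound sv so.
pose L u : spinor := fun x => m%:C *: (beta *m u x) + (W x *m u x + c%:C *: u x).
have sL : sqint (L phi) := sqintD (sqintZ m%:C (sqintM beta sp)) (sqintD sW (sqintZ c%:C sp)).
have sL' : sqint (L v) := sqintD (sqintZ m%:C (sqintM beta sv)) (sqintD sW' (sqintZ c%:C sv)).
have E u h : formal u h = kinetic alpha h \+ L u by apply/funext => x; rewrite /= /L addrA.
rewrite (E phi) (E v) (ipDl sK sL sv) (ipDr sK' sL' sp) (ip_kinetic_test tp sv sg wg); congr (_ + _).
apply: eq_Rintegral => x _; rewrite /L !rdotDl !rdotDr !rdotZl !rdotZr.
by rewrite (rdot_herm _ _ (beta_herm dm)) (rdot_herm _ _ (W_herm x)).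
Qed.

Lemma formal_scale (z : R[i]) phi g x :
  formal (fun x => z *: phi x) (fun j x => z *: g j x) x = z *: formal phi g x.
Proof.
rewrite /dirac_formal /kinetic -!scalemxAr !scalerDr !scalerA (mulrC z m%:C) (mulrC z c%:C).
have -> : \sum_j alpha j *m (z *: g j x) = z *: (\sum_j alpha j *m g j x).
  by rewrite scaler_sumr; apply: eq_bigr => j _; rewrite scalemxAr.
by rewrite scalerA (mulrC z (- 'i)).
Qed.

(** The expression is symmetric between v and all test functions, so v belongs to the adjoint of T
    restricted to its core, which is T. Square integrability of v/|x| is what puts W v in L^2. *)
Lemma T_intro v g : sqint v -> sqint (over_norm v) ->
  (forall j, sqint (g j)) -> (forall j, weak_pderiv j v (g j)) -> T (v, formal v g).
Proof.
move=> sv so sg wg; have sF := sqint_formal sv so sg.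
apply: (core_adjoint TL2 saT saS sv sF) => phi f Tf tp; have [sp sf] := TL2 Tf.
have fE := T_test Tf tp; have sD j := sqint_test (test_pderiv j tp).
have [sop _] := hardy_test_over_norm d_gt2 tp.
have sFp := sqint_formal sp sop sD.
have Re_part w : sqint w -> ip f w = ip (formal phi (fun j => pderiv j phi)) w.
  by move=> sw; exact: (eq_ip_ae (proj1 sf) (proj1 sFp) (proj1 sw) fE).
have siv : sqint (fun x => 'i *: v x) := sqintZ 'i sv.
rewrite !L2dotE (Re_part _ sv) (Re_part _ siv) (ip_formal_test tp sv so sg wg); congr (_ +i* _).
(* The imaginary part of the symmetry is its real part for i phi. *)
have tip : test_functions (fun x => 'i *: phi x) := test_scale 'i tp.
have := ip_formal_test tip sv so sg wg.
have -> : formal (fun x => 'i *: phi x) (fun j => pderiv j (fun x => 'i *: phi x)) =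
    (fun x => 'i *: formal phi (fun j => pderiv j phi) x).
  apply/funext => x; rewrite -formal_scale; congr (formal _ _ _).
  by apply/funext => j; rewrite (pderiv_scale 'i j (test_smooth tp)).
have flip u w : sqint u -> sqint w -> ip (fun x => 'i *: u x) w = - ip u (fun x => 'i *: w x).
  move=> su sw; rewrite -[RHS]mulN1r -RintegralZl//; last exact: (integrable_rdot su (sqintZ 'i sw)).
  by apply: eq_Rintegral => x _; rewrite rdotil mulN1r.
by rewrite (flip _ _ sFp sv) (flip _ _ sp sF) => /oppr_inj.
Qed.

Lemma T_dil s u g : 0 < s -> sqint u -> sqint (over_norm u) ->
  (forall j, sqint (g j)) -> (forall j, weak_pderiv j u (g j)) ->
  T (dil s u, formal (dil s u) (fun j x => s%:C *: dil s (g j) x)).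
Proof.
move=> s0 su so sg wg; apply: T_intro.
- exact: sqint_dil.
- exact: sqint_over_norm_dil.
- by move=> j; exact: (sqintZ s%:C (sqint_dil s0 (sg j))).
- by move=> j; exact: (weak_pderiv_dil s0 su (sg j) (wg j)).
Qed.

(** A dilation multiplies the kinetic term by s and leaves m beta + c alone; the remainder is the
    finite form of the commutator with x . grad. *)
Lemma formal_dil s u g x :
  formal (dil s u) (fun j x => s%:C *: dil s (g j) x) x =
  dil s (formal u g) x +
  ((s - 1)%:C *: dil s (kinetic alpha g) x - (W (s *: x) - W x) *m dil s u x).
Proof.
rewrite /dirac_formal /dil /kinetic.
have -> : \sum_j alpha j *m (s%:C *: g j (s *: x)) = s%:C *: (\sum_j alpha j *m g j (s *: x)).
  by rewrite scaler_sumr; apply: eq_bigr => j _; rewrite scalemxAr.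
rewrite scalerA (mulrC _ s%:C) -scalerA rmorphB rmorph1 scalerBl scale1r mulmxBl.
set k := - 'i *: _; set b := m%:C *: _; set w := W x *m _; set w' := W (s *: x) *m _; set v := c%:C *: _.
move: k b w w' v => k b w w' v.
by rewrite opprB; apply/matrixP => a e; rewrite !mxE; ring.
Qed.

Section eigenfunction.
Variables (u f : spinor) (g : 'I_d -> spinor) (l : R).
Hypotheses (Tuf : T (u, f)) (fl : {ae mu, forall x, f x = l%:C *: u x}).
Hypotheses (sg : forall j, sqint (g j)) (wg : forall j, weak_pderiv j u (g j)).

Let su : sqint u. Proof. by case: (TL2 Tuf). Qed.
Let sf : sqint f. Proof. by case: (TL2 Tuf). Qed.
Let ug : test_limit u g. Proof. exact: h1_approx Tuf sg wg. Qed.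
Let so : sqint (over_norm u). Proof. by case: (test_limit_hardy su sg ug d_gt2). Qed.
Let K := kinetic alpha g.
Let sK : sqint K. Proof. exact: sqint_kinetic. Qed.
Let sF : sqint (formal u g). Proof. exact: sqint_formal. Qed.

Lemma formal_eigen : {ae mu, forall x, formal u g x = l%:C *: u x}.
Proof. by apply: filterS2 fl (T_weak Tuf sg wg) => x -> ->. Qed.

(* Both sides of <H u, u(s .)> = <u, H u(s .)> contain l <u, u(s .)>, which cancels. *)
Lemma virial_dil s : 0 < s ->
  (s - 1) * ip u (dil s K) = ip u (fun x => (W (s *: x) - W x) *m dil s u x).
Proof.
move=> s0; have sV0 : 0 < s^-1 by rewrite invr_gt0.
have Td := T_dil s0 su so sg wg; have [sd sG] := TL2 Td.
have sdo : sqint (over_norm (dil s u)) := sqint_over_norm_dil s0 so.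
have sdF := sqint_dil s0 sF; have sdK := sqint_dil s0 sK.
pose Z : spinor := fun x => (W (s *: x) - W x) *m dil s u x.
have sZ : sqint Z.
  have [s1 _] := sqint_potential measurable_W C1_ge0 W_bound su so.
  have [s2 _] := sqint_potential measurable_W C1_ge0 W_bound sd sdo.
  have := sqintB (sqint_dil s0 s1) s2; congr sqint.
  by apply/funext => x; rewrite /Z /dil /= mulmxBl.
have sZ1 : sqint (fun x => (s - 1)%:C *: dil s K x) := sqintZ _ sdK.
have Gu : ip u (formal (dil s u) (fun j x => s%:C *: dil s (g j) x)) =
    ip u (dil s (formal u g)) + ((s - 1) * ip u (dil s K) - ip u Z).
  rewrite -(ipZr (s - 1) sdK su) -(ipBr sZ1 sZ su) -(ipDr sdF (sqintB sZ1 sZ) su).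
  by apply: eq_Rintegral => x _; rewrite formal_dil.
have sym : ip f (dil s u) = ip u (formal (dil s u) (fun j x => s%:C *: dil s (g j) x)).
  have : op_adjoint T (dil s u, formal (dil s u) (fun j x => s%:C *: dil s (g j) x)) by rewrite saT.
  by case=> _ _ /(_ _ _ Tuf) /=; rewrite !L2dotE => -[].
have slu : sqint (fun x => l%:C *: u x) := sqintZ _ su.
have E1 : ip f (dil s u) = l * ip u (dil s u).
  by rewrite (eq_ip_ae (proj1 sf) (proj1 slu) (proj1 sd) fl) (ipZl l su sd).
(* The eigenvalue equation holds only almost everywhere. Moving the dilation to the other factor
   first avoids transporting the exceptional null set. *)
have E2 : ip u (dil s (formal u g)) = l * ip u (dil s u).
  have sq := sqint_dil sV0 su.
  rewrite -{1}(dilK u s0) (ip_dil s0 sq sF) ipC.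
  rewrite (eq_ip_ae (proj1 sF) (proj1 slu) (proj1 sq) formal_eigen) (ipZl l su sq).
  rewrite mulrCA; congr (_ * _); rewrite ipC -(ip_dil s0 sq su).
  by rewrite (dilK u s0).
have E3 : (s - 1) * ip u (dil s K) - ip u Z = 0.
  by apply: (addrI (l * ip u (dil s u))); rewrite addr0 -[in RHS]E1 sym Gu E2.
exact: (subr0_eq E3).
Qed.

End eigenfunction.

End dirac_realisation.

(** * The virial argument *)

(* Here p = |K|, z = |W u - U u| and h = <W u, U u>; the point is that <K + A, K + B> >= (1-s)^2 |K|^2
   as soon as |A|, |B| <= s |K| and s <= 1/2. *)
Lemma perturbed_square_eq0 (R : realType) (p z s e y a b h f : R) :
  0 <= p -> 0 <= z -> 0 <= s -> 0 <= e -> a <= s ^+ 2 * p ^+ 2 -> b <= s ^+ 2 * p ^+ 2 ->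
  z ^+ 2 <= 2 * (a + b) -> - (p * z) <= y -> f <= e * p ^+ 2 -> 2 * s + e < 1 ->
  z ^+ 2 = a + b - 2 * h -> p ^+ 2 + y - h - f = 0 -> p = 0.
Proof.
move=> p0 z0 s0 e0 ap bp zab yp fp se zE E.
have zp : z <= 2 * s * p.
  rewrite -(@ler_sqr _ z) ?nnegrE ?mulr_ge0//.
  have -> : (2 * s * p) ^+ 2 = 4 * (s ^+ 2 * p ^+ 2) by ring.
  lra.
(* Half this product is the excess of p^2 - p z + z^2 / 2 over its value at the endpoint z = 2 s p.
   The second factor is at least 2 p (1 - 2 s). *)
have prod : 0 <= (2 * s * p - z) * (2 * p - 2 * s * p - z).
  apply: mulr_ge0; first by rewrite subr_ge0.
  have : 0 <= p * (1 - 2 * s) by apply: mulr_ge0; lra.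
  by move: zp; rewrite mulrBr mulr1 [p * (2 * s)]mulrC; lra.
have : p ^+ 2 * (1 - 2 * s - e + s ^+ 2) <= 0.
  have -> : p ^+ 2 * (1 - 2 * s - e + s ^+ 2) =
    (p ^+ 2 + y - h - f) - (y + p * z) - (s ^+ 2 * p ^+ 2 - a) / 2
    - (s ^+ 2 * p ^+ 2 - b) / 2 - (e * p ^+ 2 - f) - (2 * s * p - z) * (2 * p - 2 * s * p - z) / 2.
    have -> : h = (a + b - z ^+ 2) / 2 by rewrite zE; field.
    by field.
  rewrite E; lra.
have pos : 0 < 1 - 2 * s - e + s ^+ 2 by have := sqr_ge0 s; lra.
rewrite pmulr_lle0// => p2; apply/eqP; rewrite -sqrf_eq0; apply/eqP/le_anti.
by rewrite p2 sqr_ge0.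
Qed.

Section virial_argument.
Context {R : realType} {d N : nat}.
Local Notation spinor := ('rV[R]_d -> 'cV[R[i]]_N).
Local Notation mu := (lebesgue_rV R d).
Local Notation ip := (ip mu).
Local Notation sqint := (sqint mu).
Variables (alpha : 'I_d -> 'M[R[i]]_N) (beta : 'M[R[i]]_N) (m c C1 C3 l : R)
  (W U : 'rV[R]_d -> 'M[R[i]]_N).
Hypotheses (dm : dirac_matrices alpha beta) (d_gt2 : (2 < d)%N).
Hypotheses (m_ge0 : 0 <= m) (C1_ge0 : 0 <= C1) (C3_ge0 : 0 <= C3).
Hypothesis measurable_W : forall a b,
  measurable_fun setT (fun x => complex.Re (W x a b)) /\
  measurable_fun setT (fun x => complex.Im (W x a b)).
Hypothesis measurable_U : forall a b,
  measurable_fun setT (fun x => complex.Re (U x a b)) /\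
  measurable_fun setT (fun x => complex.Im (U x a b)).
Hypothesis W_herm : forall x, W x \is hermsymmx.
Hypothesis W_bound : forall x (v : 'cV[R[i]]_N), cnorm (W x *m v) <= C1 * (inv_norm x * cnorm v).
Hypothesis U_bound : forall x (v : 'cV[R[i]]_N), cnorm (U x *m v) <= C1 * (inv_norm x * cnorm v).
Hypothesis W_step_bound : forall n (x : 'rV[R]_d) (v : 'cV[R[i]]_N),
  cnorm (n.+1%:R%:C *: ((W (step n *: x) - W x) *m v)) <= C1 * (inv_norm x * cnorm v).
Hypothesis W_step_cvg : forall (x : 'rV[R]_d) (v : 'cV[R[i]]_N),
  cnorm (n.+1%:R%:C *: ((W (step n *: x) - W x) *m v) - U x *m v) @[n --> \oo] --> (0 : R).
Hypothesis beta_U_bound : forall x (v : 'cV[R[i]]_N),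
  2 * `|rdot (beta *m v) (U x *m v)| <= C3 * (inv_norm x * cnorm v) ^+ 2.
Hypothesis small : 4 * C1 / (d%:R - 2) + 2 * m * C3 / (d%:R - 2) ^+ 2 < 1.

Variables (u : spinor) (g : 'I_d -> spinor).
Let K := kinetic alpha g.
Hypotheses (su : sqint u) (sg : forall j, sqint (g j)) (ug : test_limit u g).
Hypothesis eigen : {ae mu, forall x, dirac_formal alpha beta m c W u g x = l%:C *: u x}.
Hypothesis virial_dil : forall s : R, 0 < s ->
  (s - 1) * ip u (dil s K) = ip u (fun x => (W (s *: x) - W x) *m dil s u x).
Hypothesis K_dense : exists u_ : nat -> spinor, (forall n, test_functions (u_ n)) /\ l2cvg mu u_ K.

Let sK : sqint K. Proof. exact: sqint_kinetic. Qed.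
Let hardy := test_limit_hardy su sg ug d_gt2.
Let so : sqint (over_norm u). Proof. by case: hardy. Qed.
Let Wu : spinor := fun x => W x *m u x.
Let Uu : spinor := fun x => U x *m u x.
Let sW : sqint Wu. Proof. by case: (sqint_potential measurable_W C1_ge0 W_bound su so). Qed.
Let sU : sqint Uu. Proof. by case: (sqint_potential measurable_U C1_ge0 U_bound su so). Qed.
Let Yu n : spinor := fun x => n.+1%:R%:C *: ((W (step n *: x) - W x) *m u x).

Let Yu_bound n x : cnorm (Yu n x) <= C1 * cnorm (over_norm u x).
Proof. by rewrite cnorm_over_norm; exact: W_step_bound. Qed.

Let Uu_bound x : cnorm (Uu x) <= C1 * cnorm (over_norm u x).
Proof. by rewrite cnorm_over_norm; exact: U_bound. Qed.

Let measurable_Yu n : measurable_spinor (Yu n).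
Proof.
apply: measurable_spinorZ; apply: measurable_spinor_mulmx; last by case: su.
move=> a b; have [w1 w2] := measurable_W a b; split.
  have -> : (fun x => complex.Re ((W (step n *: x) - W x) a b)) =
      (fun x => complex.Re (W (step n *: x) a b)) \- (fun x => complex.Re (W x a b)).
    by apply/funext => x; rewrite !mxE cReD cReN.
  exact: measurable_funB (measurable_comp_dil (step n) w1) w1.
have -> : (fun x => complex.Im ((W (step n *: x) - W x) a b)) =
    (fun x => complex.Im (W (step n *: x) a b)) \- (fun x => complex.Im (W x a b)).
  by apply/funext => x; rewrite !mxE cImD cImN.
exact: measurable_funB (measurable_comp_dil (step n) w2) w2.
Qed.

(** By Hardy's inequality u/|x| is square integrable, and it dominates all difference quotients at
    once. *)
Let Yu_cvg : l2cvg mu Yu Uu.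
Proof.
apply: (@l2cvg_dominated _ _ _ mu _ _ _ (fun x => (2 * C1) ^+ 2 * cnorm (over_norm u x) ^+ 2)).
- exact: measurable_Yu.
- by case: sU.
- exact: (integrableZl measurableT ((2 * C1) ^+ 2) (sqint_integrable so)).
- move=> n x; rewrite -exprMn lerXn2r ?nnegrE ?mulr_ge0 ?cnorm_ge0//.
  have := cnormD (Yu n x) (- Uu x); rewrite cnormN.
  move: (Yu_bound n x) (Uu_bound x); move: (cnorm (over_norm u x)) => q.
  move: (cnorm (Yu n x)) (cnorm (Uu x)) (cnorm (Yu n x - Uu x)) => a b e *; lra.
- by move=> x; exact: W_step_cvg.
Qed.

(** In [virial_dil], divided by s - 1 = 1/(n+1), the Hermitian quotient of W is moved onto the fixed
    u. There it converges by domination, while the dilated factor converges independently. *)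
Lemma virial : ip u K = ip Uu u.
Proof.
have u_dense : exists u_ : nat -> spinor, (forall n, test_functions (u_ n)) /\ l2cvg mu u_ u.
  by case: ug => p_ [tp pu _]; exists p_.
have sY n : sqint (Yu n) := sqint_le (measurable_Yu n) so (Yu_bound n).
have E n : ip u (dil (step n) K) = ip (Yu n) (dil (step n) u).
  have sd := sqint_dil (step_gt0 n) su.
  have n0 : n.+1%:R != 0 :> R by rewrite pnatr_eq0.
  apply: (mulfI (invr_neq0 n0)).
  rewrite -[in LHS](step_sub1 n) (virial_dil (step_gt0 n)) -RintegralZl//; last exact: (integrable_rdot (sY n) sd).
  apply: eq_Rintegral => x _; rewrite /Yu rdotZl mulrA mulVf// mul1r.
  by rewrite !mulmxBl rdotBl rdotBr !(rdot_herm _ _ (W_herm _)).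
have L1 := l2cvg_ip (fun=> su) (fun n => sqint_dil (step_gt0 n) sK) su sK
  (@l2cvg_cst _ _ _ mu _ u) (dil_cvg sK K_dense).
have L2 := l2cvg_ip sY (fun n => sqint_dil (step_gt0 n) su) sU su Yu_cvg (dil_cvg su u_dense).
rewrite (_ : (fun n => ip u (dil (step n) K)) = (fun n => ip (Yu n) (dil (step n) u))) in L1.
  exact: (cvg_unique _ L1 L2).
by apply/funext.
Qed.

Lemma ip_beta_radial_le : ip (fun x => beta *m u x) Uu <= C3 / 2 * ip (over_norm u) (over_norm u).
Proof.
rewrite -(ipZl (C3 / 2) so so); apply: le_Rintegral => //.
- exact: (integrable_rdot (sqintM beta su) sU).
- exact: (integrable_rdot (sqintZ _ so) so).
- move=> x _; rewrite rdotZl -cnorm_sqr cnorm_over_norm.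
  have := beta_U_bound x (u x); have := ler_norm (rdot (beta *m u x) (U x *m u x)).
  rewrite -/(Uu x); move: (rdot _ _) (`|_|) (_ ^+ 2) => a b e *; lra.
Qed.

(** The constant c is absorbed into the eigenvalue, so the right-hand side of the equation is (l -
    c) u, orthogonal to K - U u by [virial]. *)
Lemma virial_identity :
  ip K K + (ip K Wu - ip K Uu) - ip Wu Uu - m * ip (fun x => beta *m u x) Uu = 0.
Proof.
pose Bu : spinor := fun x => m%:C *: (beta *m u x).
have sb := sqintM beta su; have sB : sqint Bu := sqintZ _ sb.
have sY := sqintB sK sU; have sX := sqintD (sqintD sK sB) sW.
have slu : sqint (fun x => (l - c)%:C *: u x) := sqintZ _ su.
have XE : {ae mu, forall x, ((K \+ Bu) \+ Wu) x = (l - c)%:C *: u x}.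
  apply: filterS eigen => x; rewrite /dirac_formal rmorphB scalerBl => <-.
  by rewrite addrA addrK.
have := eq_ip_ae (proj1 sX) (proj1 slu) (proj1 sY) XE.
rewrite (ipZl (l - c) su sY) (ipBr sK sU su) virial (ipC mu u Uu) subrr mulr0.
rewrite (ipDl (sqintD sK sB) sW sY) (ipDl sK sB sY) !(ipBr sK sU sK, ipBr sK sU sB, ipBr sK sU sW).
rewrite (ipZl m sb sK) (ipZl m sb sU) (test_limit_beta dm su sg ug) mulr0 (ipC mu Wu K).
move: (ip K K) (ip K Uu) (m * _) (ip K Wu) (ip Wu Uu) => a b e f h H.
by rewrite -H; ring.
Qed.

Lemma eigenfunction_eq0 : {ae mu, forall x, u x = 0}.
Proof.
have D0 : 0 < d%:R - 2 :> R by rewrite subr_gt0 ltr_nat.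
have [_ Hq] := hardy; rewrite -(test_limit_kinetic dm sg ug) -/K in Hq.
have [_ HW] := sqint_potential measurable_W C1_ge0 W_bound su so.
have [_ HU] := sqint_potential measurable_U C1_ge0 U_bound su so.
rewrite -/Wu in HW; rewrite -/Uu in HU.
set q := ip (over_norm u) (over_norm u) in Hq HW HU.
have P0 : 0 <= ip K K := ip_ge0 mu K.
pose s := C1 * (2 / (d%:R - 2)).
have s0 : 0 <= s by rewrite mulr_ge0// divr_ge0// ltW.
have scaled : C1 ^+ 2 * q <= s ^+ 2 * ip K K.
  have -> : s ^+ 2 * ip K K = C1 ^+ 2 * ((2 / (d%:R - 2)) ^+ 2 * ip K K).
    by rewrite /s; move: (ip K K) ((d%:R - 2)^-1) => k D; ring.
  exact: (ler_wpM2l (sqr_ge0 C1) Hq).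
have sWU := sqintB sW sU.
have K0 : Num.sqrt (ip K K) = 0.
  pose e := 2 * m * C3 / (d%:R - 2) ^+ 2.
  have e0 : 0 <= e by rewrite divr_ge0 ?sqr_ge0// mulr_ge0// mulr_ge0.
  have tau : ip (Wu \- Uu) (Wu \- Uu) <= 2 * (ip Wu Wu + ip Uu Uu) := ipBB_le sW sU.
  have tauE : ip (Wu \- Uu) (Wu \- Uu) = ip Wu Wu + ip Uu Uu - 2 * ip Wu Uu.
    rewrite (ipBl sW sU sWU) (ipBr sW sU sW) (ipBr sW sU sU) (ipC mu Uu Wu).
    move: (ip Wu Wu) (ip Uu Uu) (ip Wu Uu) => a b h; ring.
  have CS := ip_cauchy_schwarz sK sWU; rewrite (ipBr sW sU sK) in CS.
  apply: (@perturbed_square_eq0 R _ (Num.sqrt (ip (Wu \- Uu) (Wu \- Uu))) s e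
    (ip K Wu - ip K Uu) (ip Wu Wu) (ip Uu Uu) (ip Wu Uu) (m * ip (fun x => beta *m u x) Uu)).
  - exact: sqrtr_ge0.
  - exact: sqrtr_ge0.
  - exact: s0.
  - exact: e0.
  - by rewrite (sqr_sqrtr P0); exact: le_trans HW scaled.
  - by rewrite (sqr_sqrtr P0); exact: le_trans HU scaled.
  - by rewrite sqr_sqrtr ?ip_ge0//.
  - by move: CS; rewrite ler_norml => /andP[].
  - rewrite sqr_sqrtr//; have Hb := ler_wpM2l m_ge0 ip_beta_radial_le; apply: (le_trans Hb); rewrite -/q.
    apply: (@le_trans _ _ (m * (C3 / 2 * ((2 / (d%:R - 2)) ^+ 2 * ip K K)))).
      by apply: ler_wpM2l => //; apply: ler_wpM2l => //; rewrite divr_ge0.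
    rewrite /e le_eqVlt; apply/orP; left; apply/eqP.
    move: D0; move: (d%:R - 2) (ip K K) => D k D0; field; exact: lt0r_neq0.
  - move: small; rewrite /e /s; congr (_ < _); congr (_ + _).
    move: (d%:R - 2) => D; rewrite mulrCA !mulrA; congr (_ / _); ring.
  - by rewrite sqr_sqrtr ?ip_ge0.
  - by rewrite (sqr_sqrtr P0); exact: virial_identity.
(* Hardy's inequality turns the vanishing of K into that of u/|x|, hence of u off the origin, which
   is a null set. *)
have q0 : q = 0.
  have KK0 : ip K K = 0 by rewrite -(sqr_sqrtr P0) K0 expr0n.
  by apply/le_anti; rewrite ip_ge0 andbT (le_trans Hq)// KK0 mulr0.
have x0 := @ae_neq0 R d (ltn_trans (isT : (0 < 2)%N) d_gt2).
apply: filterS2 (ip_eq0 so q0) x0 => x; rewrite /over_norm => /eqP.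
rewrite scaler_eq0 => /orP[|/eqP//] i0 xn0; exfalso; move: i0.
rewrite eq_complex /= eqxx andbT invr_eq0 => /eqP e0.
by apply: xn0; apply/eqP; rewrite -enorm_eq0 e0.
Qed.

End virial_argument.

(** * The radial derivative of the potential *)

Section radial_part.
Context {R : realType} {d N : nat}.
Local Notation e j := (delta_mx 0 j : 'rV[R]_d).
Variables (V : 'rV[R]_d -> 'M[R[i]]_N) (C1 : R).
Hypothesis smoothV : smooth_on [set x | x != 0] V.
Hypothesis gradV : forall x, x != 0 -> grad_norm V x <= C1 / enorm x ^+ 2.
Hypothesis C1_ge0 : 0 <= C1.
Implicit Types (x y z : 'rV[R]_d) (v w : 'cV[R[i]]_N).

Lemma radial_deriv0 : radial_deriv V 0 = 0.
Proof. by rewrite /radial_deriv big1// => j _; rewrite mxE rmorph0 scale0r. Qed.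

Lemma radial_deriv_bound x v : cnorm (radial_deriv V x *m v) <= C1 * (inv_norm x * cnorm v).
Proof.
have [->|x0] := eqVneq x 0.
  by rewrite radial_deriv0 mul0mx cnorm0 mulr_ge0// mulr_ge0// ?cnorm_ge0// inv_norm_ge0.
have nx := enorm_gt0 x0; apply: le_trans (directional_deriv_bound gradV x v x0) _.
have -> : C1 * (inv_norm x * cnorm v) = C1 / enorm x * cnorm v by rewrite /inv_norm mulrA.
have -> : enorm x * (C1 / enorm x ^+ 2) = C1 / enorm x by field; exact: lt0r_neq0.
by [].
Qed.

Lemma measurable_smooth_off0 (F : 'rV[R]_d -> 'M[R[i]]_N) (l : seq 'I_d) a b :
  smooth_on [set x | x != 0] F ->
  measurable_fun setT (fun x => complex.Re (foldr (@pderiv R d N N) F l x a b)) /\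
  measurable_fun setT (fun x => complex.Im (foldr (@pderiv R d N N) F l x a b)).
Proof.
by move=> sF; split; apply: measurable_off0 => x x0; have [] := sF l x a b x0.
Qed.

Lemma measurable_radial_deriv a b :
  measurable_fun setT (fun x => complex.Re (radial_deriv V x a b)) /\
  measurable_fun setT (fun x => complex.Im (radial_deriv V x a b)).
Proof.
split.
  have -> : (fun x => complex.Re (radial_deriv V x a b)) =
      (fun x => \sum_j x 0 j * complex.Re (pderiv j V x a b)).
    by apply/funext => x; rewrite (re_directional_deriv V x x); apply: eq_bigr => j _; rewrite mxE.
  apply: measurable_sum => j; apply: measurable_funM; first exact: measurable_rV_coord.
  by have [] := measurable_smooth_off0 [:: j] a b smoothV.
have -> : (fun x => complex.Im (radial_deriv V x a b)) =
    (fun x => \sum_j x 0 j * complex.Im (pderiv j V x a b)).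
  by apply/funext => x; rewrite (im_directional_deriv V x x); apply: eq_bigr => j _; rewrite mxE.
apply: measurable_sum => j; apply: measurable_funM; first exact: measurable_rV_coord.
by have [] := measurable_smooth_off0 [:: j] a b smoothV.
Qed.

Lemma cvg_difference_quotient x v w : x != 0 ->
  n.+1%:R * rdot ((V (step n *: x) - V x) *m v) w @[n --> \oo] --> rdot (radial_deriv V x *m v) w.
Proof.
move=> x0; have D := is_derive_rdot_potential smoothV x v w x0.
have [df dv] := D; rewrite -[rdot (radial_deriv _ _ *m _) _]dv.
pose f t := rdot (V t *m v) w.
have L : h^-1 *: ((f \o shift x) (h *: x) - f x) @[h --> 0^'] --> 'D_x f x by exact: df.
have H0 : (n.+1%:R^-1 : R) @[n --> \oo] --> 0^'.
  move=> A A0; have [k _ Hk] := @cvg_harmonic R _ A0; exists k => // n kn.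
  by apply: (Hk n kn); rewrite /= invr_eq0 pnatr_eq0.
rewrite (_ : (fun n => _) = (fun h : R => h^-1 *: ((f \o shift x) (h *: x) - f x)) \o (fun n => n.+1%:R^-1)).
  exact: (@cvg_comp _ _ _ _ _ _ _ _ H0 L).
apply/funext => n; rewrite /= /f invrK /shift /= mulmxBl rdotBl.
by have -> : n.+1%:R^-1 *: x + x = step n *: x by rewrite /step scalerDl scale1r addrC.
Qed.

(** The radial derivative is a limit of difference quotients of V along the ray, and these are
    Hermitian. *)
Lemma radial_deriv_sym x v w : (forall y, y != 0 -> V y \is hermsymmx) -> x != 0 ->
  rdot (radial_deriv V x *m v) w = rdot v (radial_deriv V x *m w).
Proof.
move=> hV x0; have L1 := @cvg_difference_quotient x v w x0.
have L2 := @cvg_difference_quotient x w v x0.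
rewrite (_ : (fun _ => _) = (fun n => n.+1%:R * rdot ((V (step n *: x) - V x) *m v) w)) in L2.
  by rewrite [RHS]rdotC; exact: (cvg_unique _ L1 L2).
apply/funext => n; have sx : step n *: x != 0.
  by rewrite scaler_eq0 negb_or x0 andbT; exact: lt0r_neq0 (step_gt0 n).
by rewrite !mulmxBl !rdotBl (rdot_herm _ _ (hV _ sx)) (rdot_herm _ _ (hV _ x0)) !(rdotC w).
Qed.

Lemma pderiv_anticommutator (beta : 'M[R[i]]_N) j x : beta \is hermsymmx -> x != 0 ->
  pderiv j (fun y => anticommutator (V y) beta) x = anticommutator (pderiv j V x) beta.
Proof.
move=> hb x0; have DE : pderiv j V x = directional_deriv V (e j) x.
  rewrite /directional_deriv (bigD1 j)//= big1 ?addr0 => [|k kj]; first by rewrite mxE !eqxx scale1r.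
  by rewrite mxE (negbTE kj) rmorph0 scale0r.
have D v w : is_derive x (e j) (fun t => rdot (anticommutator (V t) beta *m v) w)
    (rdot (anticommutator (pderiv j V x) beta *m v) w).
  have split_rdot A : rdot (anticommutator A beta *m v) w = rdot (A *m (beta *m v)) w + rdot (A *m v) (beta *m w).
    by rewrite /anticommutator mulmxDl rdotDl -!mulmxA (rdot_herm _ _ hb).
  rewrite split_rdot DE; rewrite (_ : (fun _ => _) =
      (fun t => rdot (V t *m (beta *m v)) w) \+ (fun t => rdot (V t *m v) (beta *m w))); last first.
    by apply/funext => t; rewrite split_rdot.
  exact: is_deriveD (is_derive_rdot_potential smoothV (e j) (beta *m v) w x0)
    (is_derive_rdot_potential smoothV (e j) v (beta *m w) x0).
apply/matrixP => a b; rewrite [LHS]mxE; apply/eqP; rewrite eq_complex; apply/andP; split; apply/eqP => /=.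
  have -> : re_entry (fun y => anticommutator (V y) beta) a b =
      (fun t => rdot (anticommutator (V t) beta *m delta_mx b 0) (delta_mx a 0)).
    by apply/funext => t; rewrite (rdot_delta _ a).1 -colE mxE.
  by have [_ ->] := D (delta_mx b 0) (delta_mx a 0); rewrite (rdot_delta _ a).1 -colE mxE.
have -> : im_entry (fun y => anticommutator (V y) beta) a b =
    (fun t => rdot (anticommutator (V t) beta *m delta_mx b 0) ('i *: delta_mx a 0)).
  by apply/funext => t; rewrite (rdot_delta _ a).2 -colE mxE.
by have [_ ->] := D (delta_mx b 0) ('i *: delta_mx a 0); rewrite (rdot_delta _ a).2 -colE mxE.
Qed.

Lemma beta_radial_deriv_bound (beta : 'M[R[i]]_N) (C3 : R) x v : (forall y, y != 0 -> V y \is hermsymmx) ->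
  beta \is hermsymmx -> 0 <= C3 ->
  (forall y, y != 0 ->
    opnorm (radial_deriv (fun z => anticommutator (V z) beta) y) <= C3 / enorm y ^+ 2) ->
  2 * `|rdot (beta *m v) (radial_deriv V x *m v)| <= C3 * (inv_norm x * cnorm v) ^+ 2.
Proof.
move=> hV hb C30 HC3; have [->|x0] := eqVneq x 0.
  by rewrite radial_deriv0 mul0mx rdot0r normr0 mulr0 mulr_ge0// sqr_ge0.
(* As beta is constant the derivative passes to V; Hermiticity then makes the form of this
   anticommutator twice <beta v, U v>. *)
have DE : radial_deriv (fun z => anticommutator (V z) beta) x = anticommutator (radial_deriv V x) beta.
  rewrite /radial_deriv /anticommutator mulmx_suml mulmx_sumr -big_split /=.
  apply: eq_bigr => j _; rewrite (pderiv_anticommutator j hb x0) /anticommutator scalerDr.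
  by rewrite -scalemxAl -scalemxAr.
have := HC3 _ x0; rewrite DE => Hop.
have -> : 2 * `|rdot (beta *m v) (radial_deriv V x *m v)| =
    `|rdot (anticommutator (radial_deriv V x) beta *m v) v|.
  have -> : rdot (anticommutator (radial_deriv V x) beta *m v) v =
      2 * rdot (beta *m v) (radial_deriv V x *m v).
    rewrite /anticommutator mulmxDl rdotDl -!mulmxA (radial_deriv_sym _ _ hV x0).
    rewrite (rdot_herm (radial_deriv V x *m v) v hb) (rdotC (radial_deriv V x *m v)).
    by rewrite mulr_natl mulr2n.
  by rewrite normrM ger0_norm.
apply: (le_trans (rdot_cauchy_schwarz _ _)).
have H := le_trans (opnorm_le (anticommutator (radial_deriv V x) beta) v) (ler_wpM2r (cnorm_ge0 v) Hop).
apply: (le_trans (ler_wpM2r (cnorm_ge0 v) H)).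
rewrite /inv_norm le_eqVlt; apply/orP; left; apply/eqP.
by have /lt0r_neq0 := enorm_gt0 x0; move: (enorm x) (cnorm v) => k q k0; field.
Qed.

Variable c : R.
Hypothesis herm_V : forall y, y != 0 -> V y \is hermsymmx.
Hypothesis decay : forall x v, x != 0 -> cnorm ((V x - (c%:C)%:M) *m v) <= C1 / enorm x * cnorm v.

(* V is arbitrary at the origin, where the value 0 keeps every pointwise bound valid. *)
Definition centered_potential x : 'M[R[i]]_N := if x == 0 then 0 else V x - (c%:C)%:M.
Local Notation W := centered_potential.

Lemma centered_potential0 : W 0 = 0. Proof. by rewrite /W eqxx. Qed.

Lemma centered_potentialE x : x != 0 -> W x = V x - (c%:C)%:M.
Proof. by rewrite /W => /negbTE ->. Qed.

Lemma centered_potential_herm x : W x \is hermsymmx.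
Proof.
apply/is_hermitianmxP; rewrite expr0 scale1r; apply/matrixP => a b; rewrite !mxE.
have [->|x0] := eqVneq x 0; first by rewrite centered_potential0 !mxE rmorph0.
rewrite (centered_potentialE x0) !mxE (hermsymmx_entry (herm_V x0) a b) rmorphB /=.
congr (_ - _); rewrite eq_sym; case: (_ == _); rewrite ?mulr1n ?mulr0n ?rmorph0//.
by apply/eqP; rewrite eq_complex /= eqxx oppr0 eqxx.
Qed.

Lemma centered_potential_bound x v : cnorm (W x *m v) <= C1 * (inv_norm x * cnorm v).
Proof.
have [->|x0] := eqVneq x 0.
  by rewrite centered_potential0 mul0mx cnorm0 mulr_ge0// mulr_ge0// ?cnorm_ge0// inv_norm_ge0.
rewrite (centered_potentialE x0).
have -> : C1 * (inv_norm x * cnorm v) = C1 / enorm x * cnorm v by rewrite /inv_norm mulrA.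
exact: decay.
Qed.

Lemma centered_potential_step n x : x != 0 -> W (step n *: x) - W x = V (step n *: x) - V x.
Proof.
move=> x0; have sx : step n *: x != 0.
  by rewrite scaler_eq0 negb_or x0 andbT; exact: lt0r_neq0 (step_gt0 n).
by rewrite (centered_potentialE x0) (centered_potentialE sx) opprB addrA subrK.
Qed.

Lemma centered_potential_step_bound n x v :
  cnorm (n.+1%:R%:C *: ((W (step n *: x) - W x) *m v)) <= C1 * (inv_norm x * cnorm v).
Proof.
have [->|x0] := eqVneq x 0.
  rewrite scaler0 subrr mul0mx scaler0 cnorm0.
  by rewrite mulr_ge0// mulr_ge0// ?cnorm_ge0// inv_norm_ge0.
rewrite (centered_potential_step n x0) cnormZ ger0_norm//.
have H := potential_ray smoothV gradV C1_ge0 v x0 (step_gt0 n).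
have n0 : 0 <= n.+1%:R :> R by [].
apply: (le_trans (ler_wpM2l n0 H)).
have q0 : 0 <= C1 / enorm x * cnorm v.
  by rewrite mulr_ge0 ?cnorm_ge0// divr_ge0// ltW// enorm_gt0.
have -> : C1 * (inv_norm x * cnorm v) = C1 / enorm x * cnorm v by rewrite /inv_norm mulrA.
(* With s = 1 + 1/(n+1) the left side equals 1/s. *)
have key : n.+1%:R * `|1 - (step n)^-1| <= 1 :> R.
  have s1 : 1 <= step n :> R := step_ge1 n; have s0 : 0 < step n :> R := step_gt0 n.
  have -> : 1 - (step n)^-1 = n.+1%:R^-1 / step n :> R.
    by rewrite -[in RHS](step_sub1 n) mulrBl mul1r divff// lt0r_neq0.
  rewrite ger0_norm; last by rewrite divr_ge0// ltW.
  by rewrite mulrA divff ?pnatr_eq0// mul1r invf_le1.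
move: key q0; move: (C1 / enorm x) (cnorm v) (`|_|) (n.+1%:R) => q k t r key q0.
have -> : r * (q * t * k) = q * k * (r * t) by ring.
by rewrite ler_piMr.
Qed.

Lemma centered_potential_step_cvg x v :
  cnorm (n.+1%:R%:C *: ((W (step n *: x) - W x) *m v) - radial_deriv V x *m v) @[n --> \oo] --> (0 : R).
Proof.
apply: cnorm_cvg0 => w; have [->|x0] := eqVneq x 0.
  rewrite (_ : (fun _ => _) = (fun=> 0)); first exact: cvg_cst.
  by apply/funext => n; rewrite scaler0 subrr radial_deriv0 mul0mx scaler0 subr0 rdot0l.
rewrite (_ : (fun _ => _) = (fun n => n.+1%:R * rdot ((V (step n *: x) - V x) *m v) w -
    rdot (radial_deriv V x *m v) w)).
  rewrite -[X in _ --> X](subrr (rdot (radial_deriv V x *m v) w)).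
  exact: (cvgB (@cvg_difference_quotient x v w x0) (@cvg_cst _ _ _ _ _)).
by apply/funext => n; rewrite (centered_potential_step n x0) rdotBl rdotZl.
Qed.

Lemma measurable_centered_potential a b :
  measurable_fun setT (fun x => complex.Re (W x a b)) /\
  measurable_fun setT (fun x => complex.Im (W x a b)).
Proof.
(* The case distinction at the origin is encoded by the measurable factor [inv_norm x * enorm x],
   which is 0 there and 1 elsewhere. *)
have off (f : R[i] -> R) (g : 'rV[R]_d -> R) : f 0 = 0 -> measurable_fun setT g ->
    (forall x, f ((V x - (c%:C)%:M) a b) = g x) -> measurable_fun setT (fun x => f (W x a b)).
  move=> f0 mg fg; have -> : (fun x => f (W x a b)) = (fun x => inv_norm x * enorm x * g x).
    apply/funext => x; have [->|x0] := eqVneq x 0.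
      by rewrite centered_potential0 mxE f0 /inv_norm (eqP (_ : enorm 0 == 0)) ?enorm_eq0// mulr0 mul0r.
    by rewrite (centered_potentialE x0) fg mulVf ?mul1r// lt0r_neq0// enorm_gt0.
  apply: measurable_funM mg; apply: measurable_funM; first exact: measurable_inv_norm.
  by apply: continuous_measurable_rV; exact: continuous_enorm.
have [m1 m2] := measurable_smooth_off0 [::] a b smoothV; split.
  apply: (off (@complex.Re R) (fun x => complex.Re (V x a b) - complex.Re ((c%:C)%:M a b)) erefl).
    exact: measurable_funB m1 (measurable_cst _).
  by move=> x; rewrite !mxE cReD cReN.
apply: (off (@complex.Im R) (fun x => complex.Im (V x a b) - complex.Im ((c%:C)%:M a b)) erefl).
  exact: measurable_funB m2 (measurable_cst _).
by move=> x; rewrite !mxE cImD cImN.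
Qed.

End radial_part.

(** The imaginary part of <f, u> = <u, f> reads Im z |u|^2 = - Im z |u|^2. *)
Lemma eigenvalue_real (R : realType) (d N : nat)
    (T : set (('rV[R]_d -> 'cV[R[i]]_N) * ('rV[R]_d -> 'cV[R[i]]_N)))
    (u f : 'rV[R]_d -> 'cV[R[i]]_N) (z : R[i]) :
  op_adjoint T = T -> T (u, f) -> ~ ae_equal u (fun=> 0) ->
  ae_equal f (fun x => z *: u x) -> z = (complex.Re z)%:C.
Proof.
move=> saT Tuf u0 fz; have : op_adjoint T (u, f) by rewrite saT.
case=> su sf /(_ _ _ Tuf) /=; rewrite !L2dotE => -[_].
have siu := sqintZ 'i su; have szu := sqintZ z su.
rewrite (eq_ip_ae (proj1 sf) (proj1 szu) (proj1 siu) fz) => H.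
have E : ip (lebesgue_rV R d) u (fun x => 'i *: f x) = - ip (lebesgue_rV R d) (fun x => z *: u x) (fun x => 'i *: u x).
  have sif := sqintZ 'i sf.
  have ifz : {ae lebesgue_rV R d, forall x, 'i *: f x = 'i *: (z *: u x)}.
    by apply: filterS fz => x ->.
  rewrite ipC (eq_ip_ae (proj1 sif) (proj1 (sqintZ 'i szu)) (proj1 su) ifz) -[RHS]mulN1r.
  rewrite -RintegralZl//; last exact: (integrable_rdot szu siu).
  by apply: eq_Rintegral => x _; rewrite rdotil mulN1r.
have Z : ip (lebesgue_rV R d) (fun x => z *: u x) (fun x => 'i *: u x) =
    complex.Im z * ip (lebesgue_rV R d) u u.
  rewrite -(ipZl (complex.Im z) su su); apply: eq_Rintegral => x _.
  have iu0 : rdot (u x) ('i *: u x) = 0 by have := rdotil (u x) (u x); rewrite rdotC; lra.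
  have -> : z *: u x = (complex.Re z)%:C *: u x + (complex.Im z)%:C *: ('i *: u x).
    by rewrite scalerA -scalerDl; congr (_ *: _); rewrite {1}[z]complexE [LHS]addrC addrC mulrC.
  by rewrite rdotDl !rdotZl iu0 mulr0 add0r rdotii.
have {E} Iz : complex.Im z * ip (lebesgue_rV R d) u u = 0 by move: H; rewrite E Z; lra.
have : ip (lebesgue_rV R d) u u != 0 by apply/eqP => /(ip_eq0 su).
move/eqP: Iz; rewrite mulf_eq0 => /orP[/eqP Iz _|->//].
by apply/eqP; rewrite eq_complex /= eqxx Iz eqxx.
Qed.

Theorem theorem1p4 (R : realType) (d : nat) (m : R)
    (alpha : 'I_d -> 'M[R[i]]_(dirac_dim d)) (beta : 'M[R[i]]_(dirac_dim d))
    (V : 'rV[R]_d -> 'M[R[i]]_(dirac_dim d))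
    (D : set ('rV[R]_d -> 'cV[R[i]]_(dirac_dim d)))
    (C1 C2 C3 C4 : R) :
  (3 <= d)%N -> 0 < m ->
  dirac_matrices alpha beta ->
  (forall x, x != 0 -> V x \is hermsymmx) ->
  smooth_on [set x | x != 0] V ->
  bounded_away_from_0 V ->
  let H := op_restrict (dirac_op m alpha beta V) D in
  D `<=` sobolevH1 ->
  op_dom H = D ->
  essentially_self_adjoint_on H test_functions ->
  self_adjoint H ->
  0 < C1 -> 0 < C2 -> 0 < C3 -> 0 < C4 ->
  (forall x, x != 0 -> grad_norm V x <= C1 / enorm x ^+ 2) ->
  (forall j x, x != 0 -> opnorm (commutator (alpha j) (V x)) <= C2 / enorm x) ->
  (forall x, x != 0 ->
    opnorm (radial_deriv (fun y => anticommutator (V y) beta) x)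
      <= C3 / enorm x ^+ 2) ->
  (forall x, x != 0 ->
    opnorm (commutator beta (V x)) <= C4 / enorm x ^+ 2) ->
  4 * C1 / (d%:R - 2) + C2 + 2 * m * C4 / (d%:R - 2)
    + 2 * m * C3 / (d%:R - 2) ^+ 2 < 1 ->
  point_spectrum H = set0.
Proof.
move=> d3 m0 dm hV smoothV _ H _ _ [_ saS] [_ saT] C10 C20 C30 C40 gradV aV bV3 bV4 sm.
have D0 : 0 < d%:R - 2 :> R by rewrite subr_gt0 ltr_nat.
have small : 4 * C1 / (d%:R - 2) + 2 * m * C3 / (d%:R - 2) ^+ 2 < 1.
  apply: le_lt_trans sm; have : 0 <= 2 * m * C4 / (d%:R - 2).
    by rewrite divr_ge0 ?(ltW D0)// mulr_ge0 ?(ltW C40)// mulr_ge0// ltW.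
  move: (ltW C20); move: (4 * C1 / _) (_ * C4 / _) (_ / _ ^+ 2) => p q r; lra.
have C1_small : 4 * C1 < d%:R - 2.
  rewrite -(mul1r (d%:R - 2)) -ltr_pdivrMr//; apply: le_lt_trans small.
  by rewrite lerDl divr_ge0 ?sqr_ge0// mulr_ge0 ?(ltW C30)// mulr_ge0// ltW.
have C1' := ltW C10.
have d_gt0 : (0 < d)%N by exact: leq_trans d3.
have [E limE] := potential_limit_exists smoothV gradV C1' (ltnW d3).
have hE := potential_limit_herm limE d_gt0 hV.
have aE j : alpha j *m E = E *m alpha j.
  apply: (potential_limit_commute limE d_gt0 (k := 1) (C := C2)) => //; first exact: alpha_herm dm j.
  by move=> x x0; rewrite expr1; exact: aV.
have bE : beta *m E = E *m beta.
  by apply: (potential_limit_commute limE d_gt0 (k := 2) (C := C4)) => //; exact: beta_herm dm.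
have [c cE] := dirac_commutant dm hE aE bE; rewrite cE in limE.
have decay x (v : 'cV[R[i]]_(dirac_dim d)) (x0 : x != 0) :=
  potential_decay smoothV gradV C1' limE v x0.
pose W := centered_potential V c.
have mW := measurable_centered_potential smoothV c.
have mU := measurable_radial_deriv smoothV.
have W_bound := centered_potential_bound C1' decay.
have W_herm := centered_potential_herm c hV.
(* V and W + c may differ at the origin, which has measure zero since d > 0. *)
have TP u f : H (u, f) -> [/\ sqint (lebesgue_rV R d) u, sqint (lebesgue_rV R d) f & exists g,
    (forall j, sqint (lebesgue_rV R d) (g j) /\ weak_pderiv j u (g j)) /\
    {ae lebesgue_rV R d, forall x, f x = dirac_formal alpha beta m c W u g x}].
  case=> -[su sf [g [Hg fE]]] _; split; [exact: su | exact: sf | exists g; split; first exact: Hg].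
  apply: filterS2 fE (@ae_neq0 R d d_gt0) => x /= -> x0.
  rewrite /dirac_formal /W centered_potentialE; last exact/eqP.
  by rewrite mulmxBl mul_scalar_mx subrK.
apply/seteqP; split => // z [u [f [Tuf u0 fz]]]; apply: (u0).
have zE := eigenvalue_real saT Tuf u0 fz; rewrite zE in fz.
have [su sf [g [Hg _]]] := TP u f Tuf.
have sg j := proj1 (Hg j); have wg j := proj2 (Hg j).
have TL2 v h (Tvh : H (v, h)) : sqint (lebesgue_rV R d) v /\ sqint (lebesgue_rV R d) h.
  by case: (TP v h Tvh).
have ug := h1_approx dm d3 mW C1' W_bound C1_small TP saT saS Tuf sg wg.
have eigen := formal_eigen TP saS Tuf fz sg wg.
have vir := virial_dil dm d3 mW C1' W_bound C1_small W_herm TP saT saS Tuf fz sg wg.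
(* K is known only to be square integrable, so continuity of dilations on it rests on the density of
   test functions. *)
have [k_ [Hk kK]] := core_dense TL2 saS (sqint_kinetic alpha sg).
have K_dense : exists u_ : nat -> 'rV[R]_d -> 'cV[R[i]]_(dirac_dim d),
    (forall n, test_functions (u_ n)) /\ l2cvg (lebesgue_rV R d) u_ (kinetic alpha g).
  by exists k_; split; [move=> n; exact: (proj1 (Hk n)) | exact: kK].
have bU x (v : 'cV[R[i]]_(dirac_dim d)) :=
  beta_radial_deriv_bound smoothV x v hV (beta_herm dm) (ltW C30) bV3.
exact: (eigenfunction_eq0 dm d3 (ltW m0) C1' (ltW C30) mW mU W_herm W_bound
  (radial_deriv_bound gradV C1') (centered_potential_step_bound smoothV gradV C1' c)
  (centered_potential_step_cvg smoothV c) bU small su sg ug eigen vir K_dense).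
Qed.
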